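(* Let $\mathbf{B}$ be a binomial ring and $n$ a natural number. Let $F$ be a homogeneous strict polynomial functor of degree $n$ and $G$ a numerical functor of degree $n$ (over $\mathbf{B}$). There is an exact sequence $$0\to \operatorname{Ext}^1_{\mathrm{Hom}_n}\bigl(F,\operatorname{Nat}(Q_n,G)\bigr)\to \operatorname{Ext}^1_{\mathrm{Num}_n}(F,G)\to \operatorname{Nat}_{\mathrm{Hom}_n}\bigl(F,\operatorname{Ext}^1_{\mathrm{Num}_n}(Q_n,G)\bigr).$$ When, in addition, $G$ is (the underlying numerical functor of) a homogeneous strict polynomial functor of degree $n$ and is torsion-free, this simplifies to an exact sequence $$0\to \operatorname{Ext}^1_{\mathrm{Hom}_n}(F,G)\to \operatorname{Ext}^1_{\mathrm{Num}_n}(F,G)\to \operatorname{Nat}_{\mathrm{Hom}_n}\bigl(F,\operatorname{Ext}^1_{\mathrm{Num}_n}(Q_n,G)\bigr).$$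
   Context: A binomial ring is a commutative unital ring $\mathbf{B}$, torsion-free as an abelian group, such that for all $r\in\mathbf{B}$ and $k\ge 0$ the element $\binom rk=r(r-1)\cdots(r-k+1)/k!$ of $\mathbb{Q}\otimes_{\mathbb Z}\mathbf{B}$ lies in $\mathbf{B}$. All modules, homomorphisms and tensor products are over $\mathbf{B}$. A module functor is a functor from finitely generated free $\mathbf{B}$-modules to $\mathbf{B}$-modules. Deviations: for a map $\phi$ between modules, $\phi(x_1\diamond\cdots\diamond x_k)=\sum_{I\subseteq\{1,\dots,k\}}(-1)^{k-|I|}\phi\bigl(\sum_{i\in I}x_i\bigr)$; $\diamond_k x$ means $x\diamond\cdots\diamond x$ ($k$ copies), and for $k=0$ the value is $\phi(0)$. A module functor $F$ is numerical of degree (at most) $n$ if $F(\alpha_1\diamond\cdots\diamond\alpha_{n+1})=0$ for all homomorphisms $\alpha_1,\dots,\alpha_{n+1}\colon M\to N$ and $F(r\alpha)=\sum_{k=0}^n\binom rk F(\diamond_k\alpha)$ for all $r\in\mathbf{B}$, $\alpha\colon M\to N$. $\mathrm{Num}_n$ is the category of such functors and natural transformations. A module functor is strict polynomial if it is equipped with arrow maps $A\otimes\operatorname{Hom}(M,N)\to A\otimes\operatorname{Hom}(F(M),F(N))$ natural in the commutative unital $\mathbf{B}$-algebra $A$ (compatible with identities and composition) (Friedlander–Suslin); it is homogeneous of degree $n$ if these maps satisfy $F(a\alpha)=a^nF(\alpha)$ for all $a\in A$, $\alpha\in A\otimes \operatorname{Hom}(M,N)$. $\mathrm{Hom}_n$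 denotes the abelian category of homogeneous strict polynomial functors of degree $n$, and $\operatorname{Nat}_{\mathrm{Hom}_n}$ its morphism groups. There is a forgetful functor $\mathrm{Hom}_n\to\mathrm{Num}_n$, through which homogeneous functors are regarded as numerical functors. $Q_n=\Gamma^n\operatorname{Hom}(\mathbf{B}^n,-)$ is a projective generator of $\mathrm{Hom}_n$, where $\Gamma^n$ is the $n$'th divided power. Let $S=\Gamma^n(\mathbf{B}^{n\times n})$ be the Schur algebra (with product determined by $\sigma^{[n]}\tau^{[n]}=(\sigma\tau)^{[n]}$, $\mathbf{B}^{n\times n}$ being the matrix ring); then $H\mapsto H(\mathbf{B}^n)$ is an equivalence from $\mathrm{Hom}_n$ to left $S$-modules. $S$ acts on $Q_n$ from the right by precomposition. Hence $\operatorname{Nat}(Q_n,G)$ (natural transformations in $\mathrm{Num}_n$) and $\operatorname{Ext}^1_{\mathrm{Num}_n}(Q_n,G)$ are left $S$-modules, and they are regarded as objects of $\mathrm{Hom}_n$ through this equivalence. ''Torsion'' always means $\mathbb{Z}$-torsion; $G$ is torsion-free if all $G(M)$ are. *)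

(* Defs.v *)
From HB Require Import structures.
From mathcomp Require Import all_boot all_order all_fingroup all_algebra.
From mathcomp Require Import generic_quotient boolp.

Set Implicit Arguments.
Unset Strict Implicit.
Unset Printing Implicit Defensive.

Import GRing.Theory.
Import VectorInternalTheory.
Local Open Scope ring_scope.
Local Open Scope quotient_scope.

(* As B is torsion-free, B embeds in its rationalization, and the element
   r(r-1)...(r-k+1)/k! lies in B iff the division can be carried out in B; it is
   then unique, so that [binr] is determined by the ring. *)
HB.mixin Record isBinomialRing B of GRing.ComNzRing B := {
  binr : B -> nat -> B;
  binomial_torsion_free : forall (r : B) (k : nat), r *+ k.+1 = 0 -> r = 0;
  binrP : forall (r : B) (k : nat),
    binr r k *+ k`! = \prod_(i < k) (r - (i : nat)%:R)
}.

#[short(type="binomialRingType")]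
HB.structure Definition BinomialRing :=
  {B of isBinomialRing B & GRing.ComNzRing B}.

Section LinearMaps.
Variable R : comNzRingType.

Definition lhom (U V : lmodType R) := {linear U -> V}.

Section Module.
Variables U V : lmodType R.

HB.instance Definition _ := gen_eqMixin (lhom U V).
HB.instance Definition _ := gen_choiceMixin (lhom U V).

Lemma lhomP (f g : lhom U V) : f =1 g -> f = g.
Proof.
case: f g => [f [[zf] [lf]]] [g [[zg] [lg]]] /= /funext efg.
move: zf lf zg lg; rewrite efg => zf lf zg lg.
by rewrite (Prop_irrelevance zf zg) (Prop_irrelevance lf lg).
Qed.

Definition lhom0 : lhom U V := \0.
Definition lhomN (f : lhom U V) : lhom U V := \- f.
Definition lhomD (f g : lhom U V) : lhom U V := f \+ g.
Definition lhomZ (a : R) (f : lhom U V) : lhom U V := a \*: f.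

Fact lhomDA : associative lhomD.
Proof. by move=> f g h; apply: lhomP => x /=; rewrite addrA. Qed.
Fact lhomDC : commutative lhomD.
Proof. by move=> f g; apply: lhomP => x /=; rewrite addrC. Qed.
Fact lhom0D : left_id lhom0 lhomD.
Proof. by move=> f; apply: lhomP => x /=; rewrite add0r. Qed.
Fact lhomND : left_inverse lhom0 lhomN lhomD.
Proof. by move=> f; apply: lhomP => x /=; rewrite addNr. Qed.

HB.instance Definition _ :=
  GRing.isZmodule.Build (lhom U V) lhomDA lhomDC lhom0D lhomND.

Fact lhomZA a b f : lhomZ a (lhomZ b f) = lhomZ (a * b) f.
Proof. by apply: lhomP => x /=; rewrite scalerA. Qed.
Fact lhom1Z : left_id 1 lhomZ.
Proof. by move=> f; apply: lhomP => x /=; rewrite scale1r. Qed.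
Fact lhomZDr : right_distributive lhomZ +%R.
Proof. by move=> a f g; apply: lhomP => x /=; rewrite scalerDr. Qed.
Fact lhomZDl f : {morph lhomZ^~ f : a b / a + b}.
Proof. by move=> a b; apply: lhomP => x /=; rewrite scalerDl. Qed.

HB.instance Definition _ :=
  GRing.Zmodule_isLmodule.Build R (lhom U V) lhomZA lhom1Z lhomZDr lhomZDl.

Lemma lhomDE (f g : lhom U V) x : (f + g) x = f x + g x. Proof. by []. Qed.
Lemma lhomNE (f : lhom U V) x : (- f) x = - f x. Proof. by []. Qed.
Lemma lhomZE a (f : lhom U V) x : (a *: f) x = a *: f x. Proof. by []. Qed.
Lemma lhom0E x : (0 : lhom U V) x = 0. Proof. by []. Qed.

End Module.

Definition lid (U : lmodType R) : lhom U U := idfun.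
Definition lcomp (U V W : lmodType R) (g : lhom V W) (f : lhom U V) :
  lhom U W := g \o f.

End LinearMaps.

Section TensorProduct.
Variable R : comNzRingType.

Definition bilin (U V W : lmodType R) (f : U -> V -> W) : Prop :=
  (forall u, linear (f u)) /\ (forall v, linear (f^~ v)).

Section Construction.
Variables U V : lmodType R.

Definition tsum (W : lmodType R) (f : U -> V -> W) (s : seq (U * V)) : W :=
  \sum_(p <- s) f p.1 p.2.

(* A list of pairs stands for a formal sum of pure tensors; two formal sums are
   identified when no bilinear map separates them. *)
Definition tequiv (s t : seq (U * V)) : bool :=
  `[< forall (W : lmodType R) (f : U -> V -> W),
        bilin f -> tsum f s = tsum f t >].

Fact tequiv_refl : reflexive tequiv. Proof. by move=> s; apply/asboolP. Qed.
Fact tequiv_sym : symmetric tequiv.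
Proof. by move=> s t; apply/asboolP/asboolP => e W f bf; rewrite e. Qed.
Fact tequiv_trans : transitive tequiv.
Proof.
by move=> s t u /asboolP e1 /asboolP e2; apply/asboolP=> W f bf; rewrite e1 ?e2.
Qed.

Canonical tequiv_rel := EquivRel tequiv tequiv_refl tequiv_sym tequiv_trans.

Definition tens := {eq_quot tequiv}.
HB.instance Definition _ := Choice.on tens.

Definition ten (u : U) (v : V) : tens := \pi_tens [:: (u, v)].

(* Meaningful for bilinear f, when it is the linear map induced by f *)
Definition tlift (W : lmodType R) (f : U -> V -> W) (x : tens) : W :=
  tsum f (repr x).

Lemma tlift_pi (W : lmodType R) (f : U -> V -> W) s :
  bilin f -> tlift f (\pi_tens s) = tsum f s.
Proof.
move=> bf; rewrite /tlift.
have /eqmodP/asboolP : \pi_tens (repr (\pi_tens s)) = \pi_tens s.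
  by rewrite reprK.
exact.
Qed.

Lemma tensP (x y : tens) :
  (forall (W : lmodType R) (f : U -> V -> W),
     bilin f -> tlift f x = tlift f y) -> x = y.
Proof.
by move=> e; rewrite -(reprK x) -(reprK y); apply/eqmodP/asboolP.
Qed.

Lemma tlift_ten (W : lmodType R) (f : U -> V -> W) u v :
  bilin f -> tlift f (ten u v) = f u v.
Proof. by move=> bf; rewrite tlift_pi // /tsum big_seq1. Qed.

Definition tens0 : tens := \pi_tens [::].
Definition tensD (x y : tens) : tens := \pi_tens (repr x ++ repr y).
Definition tensZ (a : R) (x : tens) : tens :=
  \pi_tens [seq (a *: p.1, p.2) | p <- repr x].

Lemma tlift0 (W : lmodType R) (f : U -> V -> W) : bilin f -> tlift f tens0 = 0.
Proof. by move=> bf; rewrite tlift_pi // /tsum big_nil. Qed.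
Lemma tliftD (W : lmodType R) (f : U -> V -> W) x y :
  bilin f -> tlift f (tensD x y) = tlift f x + tlift f y.
Proof. by move=> bf; rewrite tlift_pi // /tsum big_cat. Qed.
Lemma tliftZ (W : lmodType R) (f : U -> V -> W) a x :
  bilin f -> tlift f (tensZ a x) = a *: tlift f x.
Proof.
move=> bf; rewrite tlift_pi // /tlift /tsum big_map scaler_sumr.
apply: eq_bigr => p _ /=; have := bf.2 p.2 a p.1 0.
have f0 : f 0 p.2 = 0.
  have := bf.2 p.2 1 0 0.
  by rewrite !scale1r addr0 -{1}[f 0 p.2]addr0 => /addrI <-.
by rewrite addr0 f0 addr0.
Qed.

Fact tensDA : associative tensD.
Proof. by move=> x y z; apply: tensP => W f bf; rewrite !tliftD // addrA. Qed.
Fact tensDC : commutative tensD.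
Proof. by move=> x y; apply: tensP => W f bf; rewrite !tliftD // addrC. Qed.
Fact tens0D : left_id tens0 tensD.
Proof.
by move=> x; apply: tensP => W f bf; rewrite tliftD // tlift0 // add0r.
Qed.
Fact tensND : left_inverse tens0 (tensZ (- 1)) tensD.
Proof.
move=> x; apply: tensP => W f bf.
by rewrite tliftD // tlift0 // tliftZ // scaleN1r addNr.
Qed.

HB.instance Definition _ :=
  GRing.isZmodule.Build tens tensDA tensDC tens0D tensND.

Fact tensZA a b x : tensZ a (tensZ b x) = tensZ (a * b) x.
Proof. by apply: tensP => W f bf; rewrite !tliftZ // scalerA. Qed.
Fact tens1Z : left_id 1 tensZ.
Proof. by move=> x; apply: tensP => W f bf; rewrite tliftZ // scale1r. Qed.
Fact tensZDr : right_distributive tensZ +%R.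
Proof.
move=> a x y; apply: tensP => W f bf.
by rewrite tliftZ // !tliftD // !tliftZ // scalerDr.
Qed.
Fact tensZDl x : {morph tensZ^~ x : a b / a + b}.
Proof.
move=> a b; apply: tensP => W f bf.
by rewrite tliftD // !tliftZ // scalerDl.
Qed.

HB.instance Definition _ :=
  GRing.Zmodule_isLmodule.Build R tens tensZA tens1Z tensZDr tensZDl.

Lemma tlift_linear (W : lmodType R) (f : U -> V -> W) :
  bilin f -> linear (tlift f).
Proof. by move=> bf a x y; rewrite tliftD // tliftZ. Qed.

Lemma ten_bilin : bilin ten.
Proof.
split=> [u a v v'|v a u u']; apply: tensP => W f bf;
  by rewrite tlift_linear // !tlift_ten //; case: bf => bl br; rewrite ?bl ?br.
Qed.

Lemma tens_sum (x : tens) : x = \sum_(p <- repr x) ten p.1 p.2.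
Proof.
apply: tensP => W f bf; rewrite {1}/tlift /tsum.
elim: (repr x) => [|p s IHs]; first by rewrite !big_nil tlift0.
by rewrite !big_cons IHs tliftD // tlift_ten.
Qed.

End Construction.

Definition tmap (U V U' V' : lmodType R) (f : U -> U') (g : V -> V') :
  tens U V -> tens U' V' := tlift (fun u v => ten (f u) (g v)).

(* (a (x) v, b (x) w) |-> ab (x) m v w *)
Definition tmul (A : comAlgType R) (V W Z : lmodType R) (m : V -> W -> Z)
    (x : tens A V) (y : tens A W) : tens A Z :=
  tlift (fun a v => tlift (fun b w => ten (a * b) (m v w)) y) x.

Definition tscale (A : comAlgType R) (V : lmodType R) (a : A) :
  tens A V -> tens A V := tmap ( *%R a) id.

End TensorProduct.

(* Gamma^n of a finitely generated free module V, as the module of symmetric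
   tensors of order n.  Tensors are written in the basis e of V that underlies
   its vectType structure: the value at a word u is the coefficient of
   e_(u 0) (x) ... (x) e_(u (n-1)).  A symmetric tensor is constant on words with
   the same content nu; this value is its coefficient on the basis element
   e^[nu] = \prod_i e_i^[nu_i] of the divided power module.  In particular
   x^[n] is x (x) ... (x) x. *)
Section DividedPower.
Variables (R : comNzRingType) (n : nat).

Definition word (V : vectType R) := {ffun 'I_n -> 'I_(dim V)}.

Definition crd (V : vectType R) (i : 'I_(dim V)) (x : V) : R := v2r x 0 i.
Definition bvec (V : vectType R) (i : 'I_(dim V)) : V := r2v (delta_mx 0 i).

Definition wperm (I : finType) (s : 'S_n) (u : {ffun 'I_n -> I}) :
  {ffun 'I_n -> I} := [ffun j => u (s j)].

Definition symt (V : vectType R) : {pred {ffun word V -> R^o}} :=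
  [pred t : {ffun word V -> R^o} |
    [forall s : 'S_n, forall u : word V, t (wperm s u) == t u]].

Arguments symt : clear implicits.

Lemma symtP (V : vectType R) (t : {ffun word V -> R^o}) :
  reflect (forall s u, t (wperm s u) = t u) (t \in symt V).
Proof.
apply: (iffP forallP) => [h s u|h s]; first by have /forallP/(_ u)/eqP := h s.
by apply/forallP=> u; rewrite h.
Qed.

Fact symt_submod (V : vectType R) : submod_closed (symt V).
Proof.
split=> [|a t t' /symtP ht /symtP ht']; apply/symtP => s u; rewrite !ffunE //.
by rewrite ht ht'.
Qed.

HB.instance Definition _ (V : vectType R) :=
  GRing.isSubmodClosed.Build R {ffun word V -> R^o} (symt V) (symt_submod V).

Record gam (V : vectType R) :=
  Gam { gval :> {ffun word V -> R^o}; gvalP : gval \in symt V }.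

HB.instance Definition _ (V : vectType R) := [isSub of gam V for @gval V].
HB.instance Definition _ (V : vectType R) := [Choice of gam V by <:].
HB.instance Definition _ (V : vectType R) :=
  [SubChoice_isSubZmodule of gam V by <:].
HB.instance Definition _ (V : vectType R) :=
  [SubZmodule_isSubLmodule of gam V by <:].

Lemma wperm_inj (I : finType) (s : 'S_n) : injective (@wperm I s).
Proof.
apply: (can_inj (g := @wperm I s^-1%g)) => u.
by apply/ffunP=> j; rewrite !ffunE permKV.
Qed.

(* Gamma^n(f), the restriction of f (x) ... (x) f *)
Fact gmap_subproof (V W : vectType R) (f : V -> W) (t : gam V) :
  [ffun u : word W => \sum_(w : word V) t w * \prod_j crd (u j) (f (bvec (w j)))]
    \in symt W.
Proof.
apply/symtP => s u; rewrite !ffunE (reindex_inj (@wperm_inj _ s)) /=.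
apply: eq_bigr => w _; have /symtP -> := gvalP t; congr (_ * _).
rewrite [RHS](reindex_inj (@perm_inj _ s)) /=.
by apply: eq_bigr => j _; rewrite !ffunE.
Qed.
Definition gmap (V W : vectType R) (f : V -> W) (t : gam V) : gam W :=
  Gam (gmap_subproof f t).

(* For bilinear m, the restriction to symmetric tensors of
   (x_1 (x) ... (x) x_n, y_1 (x) ... (x) y_n)
     |-> m x_1 y_1 (x) ... (x) m x_n y_n;
   in particular it sends (x^[n], y^[n]) to (m x y)^[n], see [gmul_pow]. *)
Fact gmul_subproof (U V W : vectType R) (m : U -> V -> W)
    (t : gam U) (t' : gam V) :
  [ffun u : word W => \sum_(v : word U) \sum_(w : word V)
     t v * t' w * \prod_j crd (u j) (m (bvec (v j)) (bvec (w j)))] \in symt W.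
Proof.
apply/symtP => s u; rewrite !ffunE (reindex_inj (@wperm_inj _ s)) /=.
apply: eq_bigr => v _; rewrite (reindex_inj (@wperm_inj _ s)) /=.
apply: eq_bigr => w _; have /symtP -> := gvalP t; have /symtP -> := gvalP t'.
congr (_ * _).
rewrite [RHS](reindex_inj (@perm_inj _ s)) /=.
by apply: eq_bigr => j _; rewrite !ffunE.
Qed.
Definition gmul (U V W : vectType R) (m : U -> V -> W) (t : gam U) (t' : gam V) :
  gam W := Gam (gmul_subproof m t t').

(* The divided monomial \prod_i x_i^[nu_i] (for \sum_i nu_i = n): the sum of the
   distinct rearrangements of x_0 (x) ... (x) x_0 (x) x_1 (x) ... *)
Fact gmon_subproof (V : vectType R) (r : nat) (x : 'I_r -> V) (nu : 'I_r -> nat) :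
  [ffun u : word V =>
     \sum_(w : {ffun 'I_n -> 'I_r} | [forall i, #|[set j | w j == i]| == nu i])
        \prod_j crd (u j) (x (w j))] \in symt V.
Proof.
apply/symtP => s u; rewrite !ffunE (reindex_inj (@wperm_inj _ s)) /=.
apply: eq_big => w /= => [|_].
  apply: eq_forallb => i; congr (_ == _).
  have -> : [set j | wperm s w j == i] = s @^-1: [set j | w j == i].
    by apply/setP => j; rewrite !inE ffunE.
  by rewrite card_preimset //; apply: perm_inj.
rewrite [RHS](reindex_inj (@perm_inj _ s)) /=.
by apply: eq_bigr => j _; rewrite !ffunE.
Qed.
Definition gmon (V : vectType R) (r : nat) (x : 'I_r -> V) (nu : 'I_r -> nat) :
  gam V := Gam (gmon_subproof x nu).

Lemma crd_sum (V : vectType R) (x : V) : x = \sum_i crd i x *: bvec i.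
Proof.
apply: v2r_inj; rewrite {1}[v2r x]row_sum_delta linear_sum /=.
by apply: eq_bigr => i _; rewrite linearZ /= r2vK.
Qed.

Lemma crd_bvec (V : vectType R) (i j : 'I_(dim V)) : crd i (bvec j) = (i == j)%:R.
Proof. by rewrite /crd /bvec r2vK mxE eqxx. Qed.

Fact gmap_is_linear (V W : vectType R) (f : V -> W) : linear (gmap f).
Proof.
move=> a t t'; apply/val_inj/ffunP => u; rewrite !ffunE scaler_sumr -big_split /=.
by apply: eq_bigr => w _; rewrite !ffunE mulrDl -scalerAl.
Qed.
HB.instance Definition _ (V W : vectType R) (f : V -> W) :=
  GRing.isLinear.Build R (gam V) (gam W) _ (gmap f) (gmap_is_linear f).

Lemma gmap_id (V : vectType R) (f : V -> V) (t : gam V) :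
  f =1 id -> gmap f t = t.
Proof.
move=> fid; apply/val_inj/ffunP => u; rewrite !ffunE (bigD1 u) //=.
have -> : \prod_j crd (u j) (f (bvec (u j))) = 1.
  by apply: big1 => j _; rewrite fid crd_bvec eqxx.
rewrite mulr1 [X in _ + X]big1 ?addr0 // => w neq.
case: (pickP (fun j => u j != w j)) => [j ne|eq].
  by rewrite (bigD1 j) //= fid crd_bvec (negbTE ne) mul0r mulr0.
by case/eqP: neq; apply/ffunP => j; have /negbFE/eqP := eq j.
Qed.

Lemma gmap_comp (U V W : vectType R) (g : {linear V -> W}) (f : U -> V)
  (t : gam U) : gmap g (gmap f t) = gmap (g \o f) t.
Proof.
apply/val_inj/ffunP => u; rewrite !ffunE.
under eq_bigr => v _ do rewrite ffunE mulr_suml.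
rewrite exchange_big /=; apply: eq_bigr => w _.
under eq_bigr => v _ do rewrite -mulrA -big_split /=.
rewrite -mulr_sumr; congr (_ * _).
rewrite -(bigA_distr_bigA (fun j k =>
  crd k (f (bvec (w j))) * crd (u j) (g (bvec k)))) /=.
apply: eq_bigr => j _; rewrite {2}[f _]crd_sum linear_sum /= /crd linear_sum.
by rewrite summxE; apply: eq_bigr => k _; rewrite !linearZ /= mxE.
Qed.

Definition gpow (V : vectType R) (x : V) : gam V :=
  gmon (fun _ : 'I_1 => x) (fun _ => n).

Lemma gpowE (V : vectType R) (x : V) u : gpow x u = \prod_j crd (u j) x.
Proof.
rewrite ffunE (big_pred1 [ffun _ => ord0]); last first.
  move=> w /=; have -> : w = [ffun _ => ord0].
    by apply/ffunP => j; rewrite ffunE ord1.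
  rewrite eqxx; apply/forallP => i.
  rewrite (_ : [set j | _] = setT) ?cardsT ?card_ord //.
  by apply/setP => j; rewrite !inE ffunE [i]ord1.
by [].
Qed.

Lemma gmul_pow (U V W : vectType R) (m : U -> V -> W) x y : bilin m ->
  gmul m (gpow x) (gpow y) = gpow (m x y).
Proof.
move=> bm; apply/val_inj/ffunP => u /=; rewrite -/(gval _) gpowE ffunE.
have mE j : crd (u j) (m x y) =
    \sum_i \sum_k crd i x * crd k y * crd (u j) (m (bvec i) (bvec k)).
  pose mr v : {linear U -> W} :=
    HB.pack (m^~ v) (GRing.isLinear.Build _ _ _ _ _ (bm.2 v)).
  pose ml v : {linear V -> W} :=
    HB.pack (m v) (GRing.isLinear.Build _ _ _ _ _ (bm.1 v)).
  have Zl a z t : m (a *: z) t = a *: m z t by have := linearZ_LR (mr t) a z; apply.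
  have Zr a z t : m z (a *: t) = a *: m z t by have := linearZ_LR (ml z) a t; apply.
  rewrite {1}[x]crd_sum -[m _ _]/(mr y _) linear_sum /= /crd linear_sum summxE.
  apply: eq_bigr => i _; rewrite Zl linearZ mxE {1}[y]crd_sum -[m _ _]/(ml _ _).
  rewrite linear_sum /= linear_sum summxE mulr_sumr; apply: eq_bigr => k _.
  by rewrite Zr linearZ mxE mulrA.
under [RHS]eq_bigr => j _ do rewrite mE.
rewrite bigA_distr_bigA /=; apply: eq_bigr => v _.
rewrite bigA_distr_bigA /=; apply: eq_bigr => w _.
by rewrite !gpowE -!big_split.
Qed.

End DividedPower.

Section ModuleFunctors.
Variable B : binomialRingType.

(* [vectType B] is the type of finitely generated free B-modules. *)
Record modFunctor := ModFunctor {
  fobj :> vectType B -> lmodType B;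
  fmap : forall M N : vectType B, 'Hom(M, N) -> lhom (fobj M) (fobj N);
  fmap_id : forall M : vectType B, fmap (\1%VF : 'Hom(M, M)) = lid (fobj M);
  fmap_comp : forall (M N P : vectType B) (g : 'Hom(N, P)) (f : 'Hom(M, N)),
    fmap (g \o f)%VF = lcomp (fmap g) (fmap f)
}.

Record nat_trans (F G : modFunctor) := NatTrans {
  nt :> forall M : vectType B, lhom (F M) (G M);
  nt_natural : forall (M N : vectType B) (f : 'Hom(M, N)) (x : F M),
    nt N (fmap F f x) = fmap G f (nt M x)
}.

Definition deviation (U V : lmodType B) (phi : U -> V) (k : nat)
    (x : 'I_k -> U) : V :=
  \sum_(I : {set 'I_k}) (- 1) ^+ (k - #|I|) *: phi (\sum_(i in I) x i).

Definition numerical (n : nat) (F : modFunctor) : Prop :=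
  (forall (M N : vectType B) (f : 'I_n.+1 -> 'Hom(M, N)),
     deviation (@fmap F M N) f = 0) /\
  (forall (M N : vectType B) (r : B) (f : 'Hom(M, N)),
     fmap F (r *: f) =
     \sum_(k < n.+1) binr r k *: deviation (@fmap F M N) (fun _ : 'I_k => f)).

Definition functor_torsion_free (F : modFunctor) : Prop :=
  forall (M : vectType B) (x : F M) (k : nat), x *+ k.+1 = 0 -> x = 0.

(* By [smap_fmap], [sfun] is the case A = B of the arrow maps. *)
Record strictFunctor := StrictFunctor {
  sfun :> modFunctor;
  smap : forall (A : comAlgType B) (M N : vectType B),
    tens A 'Hom(M, N) -> tens A (lhom (sfun M) (sfun N));
  smap_natural : forall (A A' : comAlgType B) (h : {lrmorphism A -> A'})
      (M N : vectType B) (x : tens A 'Hom(M, N)),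
    smap (tmap h id x) = tmap h id (smap x);
  smap_id : forall (A : comAlgType B) (M : vectType B),
    smap (ten (1 : A) (\1%VF : 'Hom(M, M))) = ten (1 : A) (lid (sfun M));
  smap_comp : forall (A : comAlgType B) (M N P : vectType B)
      (y : tens A 'Hom(N, P)) (x : tens A 'Hom(M, N)),
    smap (tmul (fun g f => (g \o f)%VF) y x) =
    tmul (fun g f => lcomp g f) (smap y) (smap x);
  smap_fmap : forall (A : comAlgType B) (M N : vectType B) (f : 'Hom(M, N)),
    smap (ten (1 : A) f) = ten (1 : A) (fmap sfun f)
}.

Definition homogeneous (n : nat) (F : strictFunctor) : Prop :=
  forall (A : comAlgType B) (M N : vectType B) (a : A) (x : tens A 'Hom(M, N)),
    smap F (tscale a x) = tscale (a ^+ n) (smap F x).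

(* Naturality over every algebra A, expressed in A (x) Hom(F(M), G(N)) *)
Definition strict_natural (F G : strictFunctor) (h : nat_trans F G) : Prop :=
  forall (A : comAlgType B) (M N : vectType B) (x : tens A 'Hom(M, N)),
    tmap id (fun f => lcomp (h N) f) (smap F x) =
    tmap id (fun g => lcomp g (h M)) (smap G x).

(* A category of functors: those [cob] that satisfy [cin], with as arrows the
   natural transformations that satisfy [chom].  Keeping [cin] apart from [cob]
   lets strict polynomial functors occur in NumCat through the coercion [sfun]. *)
Record functorCat := FunctorCat {
  cob : Type;
  cund : cob -> modFunctor;
  cin : cob -> Prop;
  chom : forall X Y : cob, nat_trans (cund X) (cund Y) -> Prop
}.

Definition NumCat (n : nat) : functorCat :=
  @FunctorCat modFunctor id (numerical n) (fun _ _ _ => True).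
Definition HomCat (n : nat) : functorCat :=
  @FunctorCat strictFunctor sfun (homogeneous n) strict_natural.

(* An abelian group, given by a type of representatives with the equality, the
   zero and the graph of the addition they induce; this accommodates groups of
   classes, such as Ext^1, whose representatives form a large type. *)
Record group_data := GroupData {
  gcar :> Type;
  geq : gcar -> gcar -> Prop;
  gzero : gcar -> Prop;
  gadd : gcar -> gcar -> gcar -> Prop
}.

Definition group_hom (X Y : group_data) (f : X -> Y) : Prop :=
  (forall x x', geq x x' -> geq (f x) (f x')) /\
  (forall x y z, gadd x y z -> gadd (f x) (f y) (f z)).

(* 0 -> X -> Y -> Z is exact *)
Definition left_exact_at (X Y Z : group_data) (f : X -> Y) (g : Y -> Z) : Prop :=
  [/\ group_hom f, group_hom g,
      forall x x', geq (f x) (f x') -> geq x x'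
    & forall y, gzero (g y) <-> exists x, geq (f x) y].

Definition exact_sequence (X Y Z : group_data) : Prop :=
  exists (f : X -> Y) (g : Y -> Z), left_exact_at f g.

Section Extensions.
Variables (C : functorCat) (F G : cob C).

Record extension := Extension {
  emid : cob C;
  emid_in : cin emid;
  einj : nat_trans (cund G) (cund emid);
  eprj : nat_trans (cund emid) (cund F);
  einj_hom : chom einj;
  eprj_hom : chom eprj;
  einj_inj : forall M, injective (einj M);
  e_exact : forall M x, eprj M x = 0 <-> exists y, einj M y = x;
  eprj_surj : forall M z, exists x, eprj M x = z
}.

Definition ext_eq (E E' : extension) : Prop :=
  exists h : nat_trans (cund (emid E)) (cund (emid E')),
    [/\ chom h,
        forall M y, h M (einj E M y) = einj E' M y
      & forall M x, eprj E' M (h M x) = eprj E M x].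

Definition ext_split (E : extension) : Prop :=
  exists s : nat_trans (cund F) (cund (emid E)),
    chom s /\ forall M z, eprj E M (s M z) = z.

(* Baer sum: the pullback P of E1 and E2 over F is an extension of F by G (+) G,
   and q maps it to E over the sum G (+) G -> G and the identity of F. *)
Definition ext_add (E1 E2 E : extension) : Prop :=
  exists (P : cob C)
    (p1 : nat_trans (cund P) (cund (emid E1)))
    (p2 : nat_trans (cund P) (cund (emid E2)))
    (q : nat_trans (cund P) (cund (emid E))),
    [/\ cin P, chom p1, chom p2 & chom q] /\
    [/\ forall M x, eprj E1 M (p1 M x) = eprj E2 M (p2 M x),
        forall M x1 x2, eprj E1 M x1 = eprj E2 M x2 ->
          exists! x, p1 M x = x1 /\ p2 M x = x2,
        forall M x, eprj E M (q M x) = eprj E1 M (p1 M x)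
      & forall M x y1 y2, p1 M x = einj E1 M y1 -> p2 M x = einj E2 M y2 ->
          q M x = einj E M (y1 + y2)].

Definition Ext1 : group_data := GroupData ext_eq ext_split ext_add.

Definition Nat : group_data :=
  @GroupData {h : nat_trans (cund F) (cund G) | chom h}
    (fun h h' => forall M x, sval h M x = sval h' M x)
    (fun h => forall M x, sval h M x = 0)
    (fun h h' k => forall M x, sval k M x = sval h M x + sval h' M x).

End Extensions.

Section Schur.
Variable n : nat.

Notation Bn := 'cV[B]_n.

Definition Qobj (M : vectType B) : lmodType B := gam n 'Hom(Bn, M).
Definition Qmap (M N : vectType B) (f : 'Hom(M, N)) : lhom (Qobj M) (Qobj N) :=
  gmap (fun g : 'Hom(Bn, M) => (f \o g)%VF).

Fact Qmap_id (M : vectType B) : Qmap (\1%VF : 'Hom(M, M)) = lid (Qobj M).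
Proof. by apply: lhomP => t; apply: gmap_id => g; rewrite comp_lfun1l. Qed.

Fact Qmap_comp (M N P : vectType B) (g : 'Hom(N, P)) (f : 'Hom(M, N)) :
  Qmap (g \o f)%VF = lcomp (Qmap g) (Qmap f).
Proof.
apply: lhomP => t.
have lg : linear (fun h : 'Hom(Bn, N) => (g \o h)%VF).
  by move=> a h h'; rewrite comp_lfunDr comp_lfunZr.
pose gl : {linear 'Hom(Bn, N) -> 'Hom(Bn, P)} :=
  HB.pack (fun h : 'Hom(Bn, N) => (g \o h)%VF) (GRing.isLinear.Build _ _ _ _ _ lg).
rewrite /= (gmap_comp gl); congr (gmap _ t).
by apply: funext => h /=; rewrite comp_lfunA.
Qed.

Definition Q : modFunctor := ModFunctor Qmap_id Qmap_comp.

Definition schur := gam n 'Hom(Bn, Bn).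

(* Right action of the Schur algebra on Q by precomposition; for M = B^n it is
   the product of the algebra. *)
Definition Qact (M : vectType B) (t : Q M) (s : schur) : Q M :=
  gmul (fun (g : 'Hom(Bn, M)) (f : 'Hom(Bn, Bn)) => (g \o f)%VF) t s.

(* The left module structure of H(B^n) over the Schur algebra: rho s is the
   action of s when the polynomial law of H is f |-> rho (f^[n]), that is, when
   H(\sum_i a_i (x) f_i) = \sum_nu a^nu (x) rho (\prod_i f_i^[nu_i]). *)
Definition is_schur_action (H : strictFunctor)
    (rho : schur -> lhom (H Bn) (H Bn)) : Prop :=
  linear rho /\
  forall (A : comAlgType B) (r : nat) (a : 'I_r -> A) (f : 'I_r -> 'Hom(Bn, Bn)),
    smap H (\sum_(i < r) ten (a i) (f i)) =
    \sum_(nu : {ffun 'I_r -> 'I_n.+1} | (\sum_i (nu i : nat))%N == n)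
       ten (\prod_i a i ^+ nu i) (rho (gmon n f (fun i => nu i))).

Definition pullback_along (G : modFunctor) (s : schur)
    (E E' : extension (C := NumCat n) Q G) : Prop :=
  exists h : nat_trans (emid E') (emid E),
    (forall M y, h M (einj E' M y) = einj E M y) /\
    (forall M x, eprj E M (h M x) = Qact (eprj E' M x) s).

(* The S-module Nat(Q, G) as an object of HomCat n: a homogeneous functor with an
   S-linear isomorphism from its value at B^n onto Nat(Q, G). *)
Record NatQ (G : modFunctor) := MkNatQ {
  nq :> strictFunctor;
  nq_homogeneous : homogeneous n nq;
  nq_act : schur -> lhom (nq Bn) (nq Bn);
  nq_actP : is_schur_action nq_act;
  nq_iso : nq Bn -> nat_trans Q G;
  nq_bij : bijective nq_iso;
  nq_add : forall x y M t, nq_iso (x + y) M t = nq_iso x M t + nq_iso y M t;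
  nq_schur : forall s x M t, nq_iso (nq_act s x) M t = nq_iso x M (Qact t s)
}.

(* Likewise for the S-module Ext^1(Q, G) *)
Record ExtQ (G : modFunctor) := MkExtQ {
  xq :> strictFunctor;
  xq_homogeneous : homogeneous n xq;
  xq_act : schur -> lhom (xq Bn) (xq Bn);
  xq_actP : is_schur_action xq_act;
  xq_iso : xq Bn -> extension (C := NumCat n) Q G;
  xq_inj : forall x y, ext_eq (xq_iso x) (xq_iso y) -> x = y;
  xq_surj : forall E, exists x, ext_eq (xq_iso x) E;
  xq_add : forall x y, ext_add (xq_iso x) (xq_iso y) (xq_iso (x + y));
  xq_schur : forall s x, pullback_along s (xq_iso x) (xq_iso (xq_act s x))
}.

End Schur.

End ModuleFunctors.

(* Main.v *)
(* Write S for the Schur algebra, Q for Gamma^n Hom(B^n, -).  Call eps : R -> G, with R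
   homogeneous, a coreflection of G if every natural map Q -> G has the form
   t |-> eps (t y) for a unique y in R(B^n).  Given one, an extension of F by R
   in Hom_n is sent to its pushout along eps, and an extension A of F by G in
   Num_n is sent to the map taking z in F(B^n) to the class of the pullback of A
   along Q -> F, t |-> t z.  If all of these pullbacks split, the pairs (l, z) of
   a lift l : Q -> A of t |-> t z form an S-module, hence a homogeneous functor,
   which is an extension of F by R whose pushout is A; and an extension of F by R
   can be recovered from its pushout by the uniqueness of y.

   Homogeneous functors are modules over S and natural maps between numerical
   functors are determined at B^n, because the identity of M is, up to deviations
   of order > n, a combination of maps that factor through B^n.  The coreflection
   is the functor of Nat(Q, G).  When G itself is homogeneous and torsion-free,
   it is its own coreflection: by polarization the powers f^[n] span
   Gamma^n up to torsion, and naturality decides the value of Q -> G on powers.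

   Extensions of Q by G form a proper class; the module Ext^1(Q, G) is realized by
   the cocycles of set-theoretic sections at B^n modulo coboundaries. *)
Require Import Defs.
From HB Require Import structures.
From mathcomp Require Import all_boot all_order all_fingroup all_algebra.
From mathcomp Require Import generic_quotient boolp functions mpoly.

Set Implicit Arguments.
Unset Strict Implicit.
Unset Printing Implicit Defensive.

Import GRing.Theory.
Import VectorInternalTheory.
Local Open Scope ring_scope.

(** * Divided powers as symmetric tensors *)

(** The sequence is the low-degree part of a Grothendieck spectral sequence: G |-> Nat(Q, G) is
    right adjoint to the exact forgetful functor from Hom_n to Num_n, and its first derived functor
    is Ext^1(Q, -). A coreflection is the counit of this adjunction; no resolutions are used, all
    maps are built on short exact sequences. The obstacle is torsion. A natural map between
    homogeneous functors need not be strict: naturality concerns the powers f^[n] only, and these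
    span Gamma^n merely up to torsion. Identities inside Gamma^n can be checked on powers, because B
    is torsion-free, but identities with values in a general module cannot. So the arrow maps of a
    homogeneous functor H are linearized to [theta], an action of all of Gamma^n Hom(M, N) on H,
    whose multiplicativity is read off from coefficients at generic points over polynomial algebras.
    Likewise two elements x, x' are compared through the maps t |-> t x and t |-> t x' on Q and not
    through their images alone; this makes the resulting maps S-linear, hence strict. *)

Definition mklin (R : comNzRingType) (U V : lmodType R) (f : U -> V)
  (lf : linear f) : lhom U V := HB.pack f (GRing.isLinear.Build _ _ _ _ f lf).

Lemma mklinE (R : comNzRingType) (U V : lmodType R) (f : U -> V)
  (lf : linear f) x : mklin lf x = f x.
Proof. by []. Qed.

Section LinearProperties.
Variables (R : comNzRingType) (U V : lmodType R) (f : U -> V) (lf : linear f).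

Lemma lin_sum I r (P : pred I) F :
  f (\sum_(i <- r | P i) F i) = \sum_(i <- r | P i) f (F i).
Proof. exact: (linear_sum (mklin lf)). Qed.
Lemma linZ a x : f (a *: x) = a *: f x.
Proof. exact: (linearZ_LR (mklin lf)). Qed.
Lemma lin0 : f 0 = 0.
Proof. exact: (linear0 (mklin lf)). Qed.

End LinearProperties.

Section Tensors.
Variables (B : binomialRingType) (n : nat).
Implicit Types V W : vectType B.

Definition torsion_free (U : lmodType B) := forall (x : U) k, x *+ k.+1 = 0 -> x = 0.

Lemma crd_is_linear V i : linear (crd i : V -> B^o).
Proof. by move=> a x y; rewrite /crd linearP !mxE. Qed.
HB.instance Definition _ V i :=
  GRing.isLinear.Build B V B^o _ (crd i) (@crd_is_linear V i).

Lemma gamP V (t t' : gam n V) : (forall u, t u = t' u) -> t = t'.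
Proof. by move=> e; apply/val_inj/ffunP => u /=; apply: e. Qed.

Definition gev V (u : word n V) (t : gam n V) : B^o := t u.
Lemma gev_is_linear V (u : word n V) : linear (gev u).
Proof. by move=> a t t'; rewrite /gev !ffunE. Qed.
HB.instance Definition _ V u :=
  GRing.isLinear.Build B (gam n V) B^o _ (gev u) (@gev_is_linear V u).

Lemma gam_sumE V I r (P : pred I) (F : I -> gam n V) (u : word n V) :
  (\sum_(i <- r | P i) F i) u = \sum_(i <- r | P i) F i u.
Proof. exact: (linear_sum (gev u)). Qed.
Lemma gamZE V a (t : gam n V) (u : word n V) : (a *: t) u = a * t u.
Proof. by rewrite ffunE. Qed.
Lemma gamDE V (t t' : gam n V) (u : word n V) : (t + t') u = t u + t' u.
Proof. by rewrite ffunE. Qed.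

Lemma gam_torsion_free V : torsion_free (gam n V).
Proof.
move=> t k tk; apply: gamP => u; have := congr1 (gev u) tk.
by rewrite linearMn linear0 /gev [in X in _ -> X]ffunE => /binomial_torsion_free.
Qed.

(** Toggling an element outside K is an involution of the index set that reverses the sign. So the
    sum is its own negative, and B has no 2-torsion. *)
Lemma sum_sign_superset k (K : {set 'I_k}) :
  \sum_(I : {set 'I_k} | K \subset I) (- 1) ^+ (k - #|I|) = (K == setT)%:R :> B.
Proof.
case: eqP => [->|/eqP].
  rewrite (big_pred1 setT) ?cardsT ?card_ord ?subnn // => I /=.
  by rewrite subTset.
rewrite -subTset => /subsetPn [i _ iK].
apply: (@binomial_torsion_free B _ 1); set S := \sum_(_ | _) _.
have toggleK : involutive (fun I : {set 'I_k} => if i \in I then I :\ i else i |: I).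
  move=> I /=; case: (boolP (i \in I)) => iI; first by rewrite setD11 setD1K.
  by rewrite setU11 setU1K.
suff : S = - S by move=> e; rewrite mulr2n {1}e addNr.
rewrite /S {1}(reindex_inj (can_inj toggleK)) /= -sumrN.
apply: eq_big => [I|I].
  case: ifP => iI; apply/idP/idP.
  - by move/subset_trans; apply; apply: subsetDl.
  - by move=> KI; rewrite subsetD1 KI.
  - by move=> KI; apply/subsetP => j jK; have := subsetP KI j jK;
      rewrite !inE => /orP[/eqP ji|//]; rewrite -ji jK in iK.
  - by move/subset_trans; apply; apply: subsetUr.
case: ifP => iI _.
  have cI := max_card (mem I); rewrite card_ord (cardsD1 i I) iI add1n in cI *.
  by rewrite -(subnSK cI) exprS mulN1r.
have cI : (#|i |: I| <= k)%N by rewrite -[X in (_ <= X)%N]card_ord max_card.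
rewrite cardsU1 iI add1n in cI *.
by rewrite -(subnSK cI) exprS mulN1r opprK.
Qed.

(* Expand the product of sums over the maps g : 'I_n -> 'I_k; inclusion-exclusion
   kills the g that are not onto. *)
Lemma deviation_gpow V k (x : 'I_k -> V) (u : word n V) :
  deviation (@gpow B n V) x u =
  \sum_(g : {ffun 'I_n -> 'I_k} | [set g j | j in 'I_n] == setT)
     \prod_j crd (u j) (x (g j)).
Proof.
rewrite /deviation gam_sumE.
transitivity (\sum_(I : {set 'I_k}) \sum_(g : {ffun 'I_n -> 'I_k} |
    [set g j | j in 'I_n] \subset I) (- 1) ^+ (k - #|I|) * \prod_j crd (u j) (x (g j))).
  apply: eq_bigr => I _; rewrite gamZE gpowE -mulr_sumr; congr (_ * _).
  under eq_bigr => j _ do rewrite linear_sum.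
  rewrite bigA_distr_big /=; apply: eq_bigl => g.
  apply/ffun_onP/subsetP => [gI i /imsetP[j _ ->] //|gI j].
  by apply: gI; apply: imset_f.
rewrite (exchange_big_dep xpredT) //= [RHS]big_mkcond /=; apply: eq_bigr => g _.
rewrite -mulr_suml sum_sign_superset; case: eqP; rewrite ?mul1r ?mul0r //.
Qed.

(** An n-set has no map onto a set of n + 1 elements, so the sum in [deviation_gpow] is empty. *)
Lemma gpow_degree V (x : 'I_n.+1 -> V) : deviation (@gpow B n V) x = 0.
Proof.
apply: gamP => u; rewrite deviation_gpow ffunE; apply: big1 => g /eqP gT.
have := leq_imset_card g 'I_n; rewrite gT cardsT !card_ord.
by rewrite ltnn.
Qed.

Definition num_onto k m : nat :=
  #|[set g : {ffun 'I_m -> 'I_k} | [set g j | j in 'I_m] == setT]|.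

(** An onto self-map of 'I_n is a permutation, and t is invariant under permutations. *)
Lemma onto_word_perm V (t : gam n V) (g : {ffun 'I_n -> 'I_n}) (u : word n V) :
  [set g j | j in 'I_n] == setT ->
  \sum_(w : word n V) t w * (u == [ffun j => w (g j)])%:R = t u.
Proof.
move=> gT; have gi : injective g.
  by have /imset_injP gi : #|g @: 'I_n| == #|'I_n|;
    [rewrite (eqP gT) cardsT|move=> i j; apply: gi].
have E (w : word n V) : [ffun j => w (g j)] = wperm (perm gi) w.
  by apply/ffunP => j; rewrite !ffunE permE.
rewrite (bigD1 (wperm (perm gi)^-1%g u)) //= E.
have -> : wperm (perm gi) (wperm (perm gi)^-1%g u) = u.
  by apply/ffunP => j; rewrite !ffunE permK.
have /symtP -> := gvalP t; rewrite eqxx mulr1 big1 ?addr0 // => w wn.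
rewrite E; case: eqP => [ue|]; last by rewrite mulr0.
case/eqP: wn; rewrite ue; apply/ffunP => j; by rewrite !ffunE permKV.
Qed.

(** Each surjection g in [deviation_gpow] contributes one copy of t, by [onto_word_perm]. The factor
    is n!; only its positivity matters later. *)
Lemma polarization V (t : gam n V) :
  t *+ num_onto n n =
  \sum_(w : word n V) t w *: deviation (@gpow B n V) (fun j => bvec (w j)).
Proof.
apply: gamP => u; rewrite gam_sumE.
under eq_bigr => w _ do rewrite gamZE deviation_gpow mulr_sumr.
rewrite exchange_big /= -[LHS]/(gev u _) linearMn -[gev u t *+ _]mulr_natr /num_onto.
rewrite -sum1_card natr_sum mulr_sumr; apply: eq_big => [g|g]; first by rewrite inE.
rewrite inE => gT; rewrite mulr1 /gev -(onto_word_perm t u gT); apply: eq_bigr => w _.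
congr (_ * _); case: eqP => [->|ne].
  by rewrite big1 // => j _; rewrite ffunE crd_bvec eqxx.
case: (pickP (fun j => u j != w (g j))) => [j uj|eq].
  by rewrite (bigD1 j) //= crd_bvec (negbTE uj) mul0r.
by case: ne; apply/ffunP => j; rewrite ffunE; have /negbFE/eqP := eq j.
Qed.

Lemma num_onto_gt0 : (0 < num_onto n n)%N.
Proof.
apply/card_gt0P; exists [ffun j => j]; rewrite inE; apply/eqP/setP => j.
by rewrite inE; apply/imsetP; exists j => //; rewrite ffunE.
Qed.

(* By polarization the powers span the divided power up to torsion. *)
Lemma gam_ext V (U : lmodType B) (f g : gam n V -> U) :
  linear f -> linear g -> torsion_free U ->
  (forall x, f (gpow n x) = g (gpow n x)) -> f =1 g.
Proof.
move=> lf lg tU e t; pose h := mklin lf - mklin lg.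
suff: h t = 0 by move/eqP; rewrite subr_eq0 => /eqP.
have h0 x : h (gpow n x) = 0 by rewrite lhomDE lhomNE /= e subrr.
apply: (tU _ (num_onto n n).-1); rewrite (prednK num_onto_gt0) -linearMn polarization.
rewrite linear_sum big1 // => w _; rewrite linearZ_LR linear_sum big1 ?scaler0 //.
by move=> I _; rewrite linearZ_LR h0 scaler0.
Qed.

(* The number of maps of an m-set onto a k-set, by recursion on m. *)
Fixpoint ontos (k m : nat) : nat :=
  match m, k with
  | 0, 0 => 1 | 0, _.+1 => 0 | _.+1, 0 => 0
  | m'.+1, k'.+1 => k * (ontos k m' + ontos k' m')
  end.

Lemma ontos_small k m : (m < k)%N -> ontos k m = 0%N.
Proof.
elim: m k => [|m IHm] [|k] //= mk.
by rewrite !IHm ?muln0 // ltnW.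
Qed.

(** The expansion of r^m in binomial coefficients, with k! times Stirling numbers of the second
    kind. The sequence b is kept abstract to serve both for [binr r] and for the integers 'C(N,
    k). *)
Lemma expr_ontos (r : B) (b : nat -> B) m : b 0%N = 1 ->
  (forall k, b k.+1 *+ k.+1 = (r - k%:R) * b k) ->
  r ^+ m = \sum_(k < m.+1) b k *+ ontos k m.
Proof.
move=> b0 bS; elim: m => [|m IHm]; first by rewrite big_ord1 b0 expr0.
have rb k : r * b k = b k.+1 *+ k.+1 + b k *+ k.
  by rewrite bS mulrBl mulr_natl subrK.
rewrite exprS IHm mulr_sumr [RHS]big_ord_recl /= mulr0n add0r.
transitivity (\sum_(k < m.+1) b k.+1 *+ k.+1 *+ ontos k m +
              \sum_(k < m.+1) b k *+ k *+ ontos k m).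
  rewrite -big_split; apply: eq_bigr => k _ /=.
  by rewrite mulrnAr rb mulrnDl.
rewrite [X in _ + X]big_ord_recl mulr0n mul0rn add0r.
have -> : \sum_(i < m) b (lift ord0 i) *+ lift ord0 i *+ ontos (lift ord0 i) m =
          \sum_(k < m.+1) b k.+1 *+ k.+1 *+ ontos k.+1 m.
  by rewrite big_ord_recr /= (@ontos_small m.+1) // mulr0n addr0.
rewrite -big_split; apply: eq_bigr => k _ /=.
by rewrite /bump /= add1n -mulrnDr -mulrnA [(ontos _ _ + _)%N]addnC.
Qed.

Lemma binr0 (r : B) : binr r 0 = 1.
Proof. by have := binrP r 0; rewrite big_ord0 fact0. Qed.

Lemma binrS (r : B) k : binr r k.+1 *+ k.+1 = (r - k%:R) * binr r k.
Proof.
apply/eqP; rewrite -subr_eq0; apply/eqP.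
apply: (@binomial_torsion_free B _ (k`!).-1); rewrite (prednK (fact_gt0 k)).
rewrite mulrnBl -mulrnA -factS binrP big_ord_recr /= -binrP.
by rewrite mulrnAl [in X in _ - X]mulrC subrr.
Qed.

Lemma bin_subsets (T : finType) (I : {set T}) j :
  'C(#|I|, j)%:R = \sum_(K : {set T} | (K \subset I) && (#|K| == j)) 1 :> B.
Proof.
by rewrite -cards_draws -sum1_card natr_sum; apply: eq_bigl => K; rewrite inE.
Qed.

(** The deviation of order k of the function x^m at 1, ..., 1. Expanding #|I|^m in binomial
    coefficients replaces 'C(#|I|, j) by a count of the j-subsets K of I, and inclusion-exclusion
    leaves only K = 'I_k. *)
Lemma deviation_exp k m :
  \sum_(I : {set 'I_k}) (- 1) ^+ (k - #|I|) * (#|I|%:R : B) ^+ m = (ontos k m)%:R.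
Proof.
have E N : (N%:R : B) ^+ m = \sum_(j < m.+1) 'C(N, j)%:R *+ ontos j m.
  apply: (@expr_ontos _ (fun j => 'C(N, j)%:R)) => [|j]; first by rewrite bin0.
  rewrite -mulrnA mulnC mul_bin_left; case: (ltnP N j) => [Nj|jN].
    by rewrite bin_small // muln0 mulr0.
  by rewrite natrM natrB.
transitivity (\sum_(j < m.+1) (\sum_(K : {set 'I_k} | #|K| == j)
   \sum_(I : {set 'I_k} | K \subset I) (- 1) ^+ (k - #|I|) : B) *+ ontos j m).
  under eq_bigr => I _ do rewrite E mulr_sumr.
  rewrite exchange_big /=; apply: eq_bigr => j _.
  under eq_bigr => I _ do rewrite mulrnAr.
  rewrite sumrMnl; congr (_ *+ _).
  transitivity (\sum_(I : {set 'I_k})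
      \sum_(K : {set 'I_k} | (K \subset I) && (#|K| == j)) (- 1) ^+ (k - #|I|) : B).
    apply: eq_bigr => I _; rewrite (bin_subsets I j) mulr_sumr.
    by apply: eq_bigr => K _; rewrite mulr1.
  rewrite (exchange_big_dep (fun K : {set 'I_k} => #|K| == j)) /=; last first.
    by move=> I K _ /andP[].
  by apply: eq_bigr => K Kj; apply: eq_bigl => I; rewrite Kj andbT.
under eq_bigr => j _ do (under eq_bigr => K _ do rewrite sum_sign_superset).
case: (ltnP m k) => [mk|km].
  rewrite ontos_small // big1 // => j _; rewrite big1 ?mul0rn // => K /eqP Kj.
  case: eqP => // KT; have := ltn_ord j.
  by rewrite -Kj KT cardsT card_ord ltnS leqNgt mk.
rewrite -ltnS in km; rewrite (bigD1 (Ordinal km)) //= (bigD1 setT) /=; last first.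
  by rewrite cardsT card_ord.
rewrite eqxx [X in (_ + X) *+ _]big1 => [|K /andP[_ /negbTE->] //].
rewrite addr0 big1 ?addr0 // => j jk; rewrite big1 ?mul0rn // => K /eqP Kj.
case: eqP => // KT; case/eqP: jk; apply/val_inj.
by rewrite /= -Kj KT cardsT card_ord.
Qed.

Lemma gpowZ V (r : B) (x : V) : gpow n (r *: x) = r ^+ n *: gpow n x.
Proof.
apply: gamP => u; rewrite gamZE !gpowE.
under eq_bigr => j _ do rewrite linearZ.
by rewrite big_split /= prodr_const card_ord.
Qed.

(** When all arguments equal x, the partial sum over I is #|I| x, with power #|I|^n x^[n]. So the
    identity reduces to scalars, where it is [expr_ontos] combined with [deviation_exp]. *)
Lemma gpow_binomial V (r : B) (x : V) :
  gpow n (r *: x) =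
  \sum_(k < n.+1) binr r k *: deviation (@gpow B n V) (fun _ : 'I_k => x).
Proof.
rewrite gpowZ (expr_ontos n (binr0 r) (binrS r)) scaler_suml.
apply: eq_bigr => k _; rewrite -mulr_natr -scalerA -deviation_exp scaler_suml.
congr (_ *: _); apply: eq_bigr => I _.
by rewrite sumr_const -scaler_nat gpowZ scalerA.
Qed.

End Tensors.

(** * The category with morphism modules Gamma^n Hom(M, N) *)

Section DividedPowerCategory.
Variables (B : binomialRingType) (n : nat).
Implicit Types M N P K : vectType B.

Lemma gmulE (U V W : vectType B) (m : U -> V -> W) (t : gam n U) (t' : gam n V) u :
  gmul m t t' u = \sum_(v : word n U) \sum_(w : word n V)
     t v * t' w * \prod_j crd (u j) (m (bvec (v j)) (bvec (w j))).
Proof. by rewrite ffunE. Qed.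

Lemma gmul_linear_l (U V W : vectType B) (m : U -> V -> W) (t' : gam n V) :
  linear (fun t : gam n U => gmul m t t').
Proof.
move=> a s t; apply: gamP => u; rewrite gamDE gamZE !gmulE mulr_sumr -big_split /=.
apply: eq_bigr => v _; rewrite mulr_sumr -big_split /=; apply: eq_bigr => w _.
have -> : (a *: s + t) v = a * s v + t v by rewrite !ffunE.
by rewrite !mulrDl !mulrA.
Qed.

Lemma gmul_linear_r (U V W : vectType B) (m : U -> V -> W) (t : gam n U) :
  linear (gmul m t : gam n V -> gam n W).
Proof.
move=> a s s'; apply: gamP => u; rewrite gamDE gamZE !gmulE mulr_sumr -big_split /=.
apply: eq_bigr => v _; rewrite mulr_sumr -big_split /=; apply: eq_bigr => w _.
have -> : (a *: s + s') w = a * s w + s' w by rewrite !ffunE.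
by rewrite mulrDr mulrDl !mulrA [t v * a]mulrC.
Qed.

Lemma comp_bilin M N P :
  bilin (fun (g : 'Hom(N, P)) (f : 'Hom(M, N)) => (g \o f)%VF).
Proof.
split=> [g a f f'|f a g g'].
  by rewrite comp_lfunDr comp_lfunZr.
by rewrite comp_lfunDl comp_lfunZl.
Qed.

Definition gcomp M N P (t : gam n 'Hom(N, P)) (s : gam n 'Hom(M, N)) :
  gam n 'Hom(M, P) := gmul (fun g f => (g \o f)%VF) t s.

Lemma gcomp_linear_l M N P (s : gam n 'Hom(M, N)) :
  linear (fun t : gam n 'Hom(N, P) => gcomp t s).
Proof. exact: gmul_linear_l. Qed.

Lemma gcomp_linear_r M N P (t : gam n 'Hom(N, P)) :
  linear (fun s : gam n 'Hom(M, N) => gcomp t s).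
Proof. exact: gmul_linear_r. Qed.

Lemma gcomp_pow M N P (g : 'Hom(N, P)) (f : 'Hom(M, N)) :
  gcomp (gpow n g) (gpow n f) = gpow n (g \o f)%VF.
Proof. exact: (gmul_pow n g f (@comp_bilin M N P)). Qed.

Lemma comp_linear (U V W : lmodType B) (g : V -> W) (f : U -> V) :
  linear g -> linear f -> linear (fun x => g (f x)).
Proof. by move=> lg lf a x y; rewrite lf lg. Qed.

(** Both sides are linear in each variable and Gamma^n is torsion-free, so [gam_ext] reduces the
    three variables in turn to powers. *)
Lemma gcompA M N P K (t : gam n 'Hom(P, K)) (s : gam n 'Hom(N, P))
    (r : gam n 'Hom(M, N)) :
  gcomp (gcomp t s) r = gcomp t (gcomp s r).
Proof.
have tf := @gam_torsion_free B n 'Hom(M, K).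
move: t; apply: gam_ext (tf) _ => [||h].
- exact: (comp_linear (gcomp_linear_l r) (gcomp_linear_l s)).
- exact: gcomp_linear_l.
move: s; apply: gam_ext (tf) _ => [||g].
- exact: (comp_linear (gcomp_linear_l r) (gcomp_linear_r _)).
- exact: (comp_linear (gcomp_linear_r _) (gcomp_linear_l r)).
move: r; apply: gam_ext (tf) _ => [||f].
- exact: gcomp_linear_r.
- exact: (comp_linear (gcomp_linear_r _) (gcomp_linear_r _)).
by rewrite !gcomp_pow comp_lfunA.
Qed.

Lemma gcomp1l M N (t : gam n 'Hom(M, N)) : gcomp (gpow n \1%VF) t = t.
Proof.
move: t; apply: (gam_ext (gcomp_linear_r _) _ (@gam_torsion_free _ _ _)) => [a x y //|f].
by rewrite gcomp_pow comp_lfun1l.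
Qed.

Lemma gcomp1r M N (t : gam n 'Hom(M, N)) : gcomp t (gpow n \1%VF) = t.
Proof.
move: t; apply: (gam_ext (gcomp_linear_l _) _ (@gam_torsion_free _ _ _)) => [a x y //|f].
by rewrite gcomp_pow comp_lfun1r.
Qed.

Lemma gmapE (V W : vectType B) (f : V -> W) (t : gam n V) u :
  gmap f t u = \sum_(w : word n V) t w * \prod_j crd (u j) (f (bvec (w j))).
Proof. by rewrite ffunE. Qed.

Lemma gpow_word (V : vectType B) (x : V) (u : word n V) :
  gpow n x u = \prod_j crd (u j) x.
Proof. exact: gpowE. Qed.

Lemma gmap_pow (V W : vectType B) (f : V -> W) x : linear f ->
  gmap f (gpow n x) = gpow n (f x).
Proof.
move=> lf; pose g := mklin lf; apply: gamP => u; rewrite gmapE gpow_word.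
have E j : crd (u j) (f x) = \sum_k crd k x * crd (u j) (f (bvec k)).
  rewrite -[f x]/(g x) {1}[x]crd_sum linear_sum linear_sum.
  by apply: eq_bigr => k _; rewrite linearZ_LR linearZ_LR.
rewrite (eq_bigr _ (fun j _ => E j)) bigA_distr_bigA.
by apply: eq_bigr => w _; rewrite gpow_word big_split.
Qed.

Lemma Qmap_gcomp M N (f : 'Hom(M, N)) (t : Q B n M) :
  fmap (Q B n) f t = gcomp (gpow n f) t.
Proof.
move: t; apply: (gam_ext _ (gcomp_linear_r _) (@gam_torsion_free _ _ _)) => [|g].
  exact: (gmap_is_linear (n := n) (fun g : 'Hom('cV_n, M) => (f \o g)%VF)).
rewrite gcomp_pow; apply: gmap_pow => a x y.
by rewrite comp_lfunDr comp_lfunZr.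
Qed.

End DividedPowerCategory.

(** * Polynomial laws and their linearizations *)

Section Words.
Variables (n d : nat).
Implicit Types u v : {ffun 'I_n -> 'I_d}.

Definition content u : {ffun 'I_d -> nat} := [ffun i => #|[set j | u j == i]|].

(** A representative of the orbit of u under permutation of positions. It depends on the content
    alone ([rep_content]), so the condition rep u = u selects one word from each orbit. *)
Definition rep u := choose [pred v | content v == content u] u.

Lemma content_rep u : content (rep u) = content u.
Proof. by apply/eqP; rewrite /rep; apply: (@chooseP _ [pred v | content v == content u]) => /=. Qed.

Lemma rep_content u v : content u = content v -> rep u = rep v.
Proof.
move=> e; rewrite /rep; set P := [pred w | _].
rewrite -(@eq_choose _ P) => [|w /=]; last by rewrite e.
by apply: choose_id => /=; rewrite ?e.
Qed.

Lemma repK u : rep (rep u) = rep u.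
Proof. exact/rep_content/content_rep. Qed.

Lemma content_perm u v : content u = content v -> exists s, u = wperm s v.
Proof.
move=> e; have /tuple_permP[s us] : perm_eq [tuple u i | i < n] [tuple v i | i < n].
  apply/allP => i _ /=; have := congr1 (fun c : {ffun 'I_d -> nat} => c i) e.
  rewrite !ffunE !cardsE /= => ei; rewrite !count_map -!size_filter.
  move: ei; rewrite !cardE -!enumT !size_filter => ei.
  by apply/eqP; rewrite -!size_filter; move: ei; rewrite !enumT !size_filter => ->.
exists s; apply/ffunP => j; rewrite ffunE.
have := congr1 (fun t => nth (u j) t j) us.
rewrite -(tnth_nth _ [tuple u i | i < n] j) tnth_mktuple => ->.
by rewrite (nth_map j) ?size_enum_ord // nth_ord_enum tnth_mktuple.
Qed.

Lemma prod_content (A : comNzRingType) (a : 'I_d -> A) u :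
  \prod_j a (u j) = \prod_i a i ^+ content u i.
Proof.
rewrite (partition_big u xpredT) //=; apply: eq_bigr => i _.
rewrite ffunE -prodr_const; apply: eq_big => [j|j /eqP -> //].
by rewrite inE.
Qed.

End Words.

(** * Tensors over an algebra and their coordinates *)

Section PolynomialLaws.
Variables (B : binomialRingType) (n : nat).
Implicit Types (V : vectType B) (A : comAlgType B) (W : lmodType B).

Lemma tlift_sum (U V W : lmodType B) (f : U -> V -> W) I r (P : pred I) F :
  bilin f -> tlift f (\sum_(i <- r | P i) F i) = \sum_(i <- r | P i) tlift f (F i).
Proof. by move=> bf; apply: (linear_sum (mklin (tlift_linear bf))). Qed.

Lemma ten_suml (U V : lmodType B) I r (P : pred I) (F : I -> U) (v : V) :
  ten (\sum_(i <- r | P i) F i) v = \sum_(i <- r | P i) ten (F i) v.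
Proof. exact: (linear_sum (mklin ((@ten_bilin B U V).2 v))). Qed.
Lemma ten_sumr (U V : lmodType B) I r (P : pred I) (u : U) (F : I -> V) :
  ten u (\sum_(i <- r | P i) F i) = \sum_(i <- r | P i) ten u (F i).
Proof. exact: (linear_sum (mklin ((@ten_bilin B U V).1 u))). Qed.
Lemma tenZl (U V : lmodType B) a (u : U) (v : V) : ten (a *: u) v = a *: ten u v.
Proof. exact: (linearZ_LR (mklin ((@ten_bilin B U V).2 v))). Qed.
Lemma tenZr (U V : lmodType B) a (u : U) (v : V) : ten u (a *: v) = a *: ten u v.
Proof. exact: (linearZ_LR (mklin ((@ten_bilin B U V).1 u))). Qed.
Lemma tenZlr (U V : lmodType B) a (u : U) (v : V) : ten u (a *: v) = ten (a *: u) v.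
Proof. by rewrite tenZl tenZr. Qed.

Lemma bilin_comp (U V U' V' W : lmodType B) (f : U' -> V' -> W) (g : U -> U')
    (h : V -> V') : linear g -> linear h -> bilin f ->
  bilin (fun u v => f (g u) (h v)).
Proof. by move=> lg lh [f1 f2]; split=> [u|v] a x y; rewrite ?lh ?lg ?f1 ?f2. Qed.

Lemma tmap_ten (U V U' V' : lmodType B) (f : U -> U') (g : V -> V') u v :
  linear f -> linear g -> tmap f g (ten u v) = ten (f u) (g v).
Proof.
move=> lf lg; apply: tlift_ten; exact: (bilin_comp lf lg (@ten_bilin _ _ _)).
Qed.

Lemma tmap_linear (U V U' V' : lmodType B) (f : U -> U') (g : V -> V') :
  linear f -> linear g -> linear (tmap f g).
Proof.
move=> lf lg; apply: tlift_linear; exact: (bilin_comp lf lg (@ten_bilin _ _ _)).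
Qed.

Lemma tmap_sum (U V U' V' : lmodType B) (f : U -> U') (g : V -> V') I r (P : pred I) F :
  linear f -> linear g ->
  tmap f g (\sum_(i <- r | P i) F i) = \sum_(i <- r | P i) tmap f g (F i).
Proof. by move=> lf lg; apply: (linear_sum (mklin (tmap_linear lf lg))). Qed.

Lemma id_linear (U : lmodType B) : linear (@id U).
Proof. by []. Qed.

Lemma lrm_linear A A' (h : {lrmorphism A -> A'}) : linear h.
Proof. by move=> a x y; rewrite linearP. Qed.

Lemma mulr_linear A (a : A) : linear ( *%R a).
Proof. by move=> b x y; rewrite mulrDr scalerAr. Qed.

Section TensorMul.
Variables (A : comAlgType B) (V W Z : lmodType B) (m : V -> W -> Z).
Hypothesis bm : bilin m.

Lemma tmul_bilin_r (a : A) (v : V) : bilin (fun (b : A) (w : W) => ten (a * b) (m v w)).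
Proof.
apply: (bilin_comp (@mulr_linear A a) _ (@ten_bilin _ _ _)).
by case: bm => + _; apply.
Qed.

Lemma tmul_bilin_l (y : tens A W) : bilin (fun (a : A) (v : V) =>
  tlift (fun (b : A) (w : W) => ten (a * b) (m v w)) y).
Proof.
have E a v : tlift (fun (b : A) (w : W) => ten (a * b) (m v w)) y =
    \sum_(p <- repr y) ten (a * p.1) (m v p.2) by [].
split=> [a|v] c x x'; rewrite !E scaler_sumr -big_split; apply: eq_bigr => p _ /=.
  by case: bm => _ ->; rewrite (@ten_bilin _ _ _).1.
by rewrite mulrDl -scalerAl (@ten_bilin _ _ _).2.
Qed.

Lemma tmul_sum I J (r : seq I) (P : pred I) (s : seq J) (R : pred J)
    (a : I -> A) (v : I -> V) (b : J -> A) (w : J -> W) :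
  tmul m (\sum_(i <- r | P i) ten (a i) (v i)) (\sum_(j <- s | R j) ten (b j) (w j)) =
  \sum_(i <- r | P i) \sum_(j <- s | R j) ten (a i * b j) (m (v i) (w j)).
Proof.
rewrite /tmul; set y := \sum_(j <- s | _) _.
rewrite (tlift_sum _ _ _ (tmul_bilin_l y)); apply: eq_bigr => i _.
rewrite tlift_ten; last exact: tmul_bilin_l.
rewrite (tlift_sum _ _ _ (tmul_bilin_r (a i) (v i))); apply: eq_bigr => j _.
by rewrite tlift_ten //; apply: tmul_bilin_r.
Qed.

End TensorMul.

Definition tcoord A V (i : 'I_(dim V)) (x : tens A V) : A :=
  tlift (fun (a : A) (v : V) => crd i v *: a) x.

Lemma tcoord_bilin A V (i : 'I_(dim V)) : bilin (fun (a : A) (v : V) => crd i v *: a).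
Proof.
split=> [a c v v'|v c a a'].
  by rewrite -[crd i _]/((crd i : lhom V B^o) _) linearP scalerDl scalerA.
by rewrite scalerDr !scalerA mulrC.
Qed.

Lemma tcoord_linear A V (i : 'I_(dim V)) : linear (@tcoord A V i).
Proof. exact: (tlift_linear (@tcoord_bilin A V i)). Qed.

Lemma tcoord_ten A V (i : 'I_(dim V)) a v : tcoord i (ten (a : A) v) = crd i v *: a.
Proof. exact: (tlift_ten _ _ (@tcoord_bilin A V i)). Qed.

Lemma tcoord_sum A V (i : 'I_(dim V)) I r (P : pred I) (F : I -> tens A V) :
  tcoord i (\sum_(k <- r | P k) F k) = \sum_(k <- r | P k) tcoord i (F k).
Proof. exact: (linear_sum (mklin (@tcoord_linear A V i))). Qed.

Lemma tens_basis A V (x : tens A V) : x = \sum_i ten (tcoord i x) (bvec i).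
Proof.
rewrite {1}[x]tens_sum (eq_bigr (fun p => \sum_i ten (tcoord i (ten p.1 p.2)) (bvec i))).
  rewrite exchange_big; apply: eq_bigr => i _ /=.
  by rewrite -ten_suml -tcoord_sum -tens_sum.
move=> p _; rewrite {1}[p.2]crd_sum ten_sumr; apply: eq_bigr => i _.
by rewrite tcoord_ten tenZlr.
Qed.

Lemma tcoord_map A A' (h : {lrmorphism A -> A'}) V (i : 'I_(dim V)) (x : tens A V) :
  tcoord i (tmap h id x) = h (tcoord i x).
Proof.
rewrite {1}[x]tens_sum tmap_sum; [|exact: lrm_linear|exact: id_linear].
rewrite {2}[x]tens_sum !tcoord_sum linear_sum; apply: eq_bigr => p _.
rewrite tmap_ten; [|exact: lrm_linear|exact: id_linear].
by rewrite !tcoord_ten linearZ.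
Qed.

Lemma tcoord_scale A V (i : 'I_(dim V)) (a : A) (x : tens A V) :
  tcoord i (tscale a x) = a * tcoord i x.
Proof.
rewrite /tscale {1}[x]tens_sum tmap_sum; [|exact: mulr_linear|exact: id_linear].
rewrite {2}[x]tens_sum !tcoord_sum mulr_sumr; apply: eq_bigr => p _.
rewrite tmap_ten; [|exact: mulr_linear|exact: id_linear].
by rewrite !tcoord_ten scalerAr.
Qed.

End PolynomialLaws.

(** * Evaluation of homogeneous polynomial laws *)

Section PolynomialEvaluation.
Variables (B : binomialRingType) (n : nat).
Implicit Types (V : vectType B) (A : comAlgType B) (W : lmodType B).

Lemma orb_subproof V (u : word n V) :
  [ffun v : word n V => (rep v == u)%:R : B^o] \in @symt B n V.
Proof.
apply/symtP => s v; rewrite !ffunE; congr (_ == _)%:R.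
apply: rep_content; apply/ffunP => i; rewrite !ffunE.
have -> : [set j | wperm s v j == i] = s @^-1: [set j | v j == i].
  by apply/setP => j; rewrite !inE ffunE.
by rewrite card_preimset //; apply: perm_inj.
Qed.
(* The orb u with rep u = u form a basis of Gamma^n V. *)
Definition orb V (u : word n V) : gam n V := Gam (orb_subproof u).

Lemma orbE V (u v : word n V) : orb u v = (rep v == u)%:R.
Proof. by rewrite ffunE. Qed.

Lemma gam_rep V (t : gam n V) (u : word n V) : t (rep u) = t u.
Proof.
have [s ->] := content_perm (content_rep u).
by have /symtP -> := gvalP t.
Qed.

Lemma sum_rep W V (T : word n V -> W) (v : word n V) :
  (forall u, T (rep u) = T u) ->
  \sum_(u : word n V | rep u == u) orb u v *: T u = T v.
Proof.
move=> Tr; rewrite (bigD1 (rep v)) /=; last by rewrite repK.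
rewrite orbE eqxx scale1r Tr big1 ?addr0 // => u /andP[_ uv].
by rewrite orbE eq_sym (negbTE uv) scale0r.
Qed.

Lemma gam_orb V (t : gam n V) :
  t = \sum_(u : word n V | rep u == u) t u *: orb u.
Proof.
apply: gamP => v; rewrite gam_sumE -(@sum_rep B^o V (fun w => t w) v (gam_rep t)).
by apply: eq_bigr => u _; rewrite gamZE mulrC.
Qed.

(** The coordinate at u of the n-th divided power of x, formed over A; compare [gpowE]. *)
Definition apow A V (x : tens A V) (u : word n V) : A := \prod_j tcoord (u j) x.

Lemma apow_rep A V (x : tens A V) (u : word n V) : apow x (rep u) = apow x u.
Proof.
rewrite /apow (prod_content (fun i => tcoord i x)) content_rep.
by rewrite -(prod_content (fun i => tcoord i x)).
Qed.

(* The value at x of the homogeneous polynomial law with linearization rho: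
   rho applied to the n-th divided power of x over A. *)
Definition polyev A V W (rho : gam n V -> W) (x : tens A V) : tens A W :=
  \sum_(u : word n V | rep u == u) ten (apow x u) (rho (orb u)).

(** Any expansion of the divided power of x into terms c_k (x) t_k computes the law, not only the
    one along the basis [orb]. The second hypothesis is such an expansion, tested on coordinates. *)
Lemma polyev_expand A V W (rho : gam n V -> W) (x : tens A V) I r (P : pred I)
    (c : I -> A) (t : I -> gam n V) : linear rho ->
  (forall u : word n V, \sum_(k <- r | P k) t k u *: c k = apow x u) ->
  polyev rho x = \sum_(k <- r | P k) ten (c k) (rho (t k)).
Proof.
move=> lr ct; rewrite /polyev.
rewrite [RHS](eq_bigr (fun k => \sum_(u : word n V | rep u == u)
    ten (t k u *: c k) (rho (orb u)))); last first.
  move=> k _; rewrite {1}[t k]gam_orb (lin_sum lr) ten_sumr.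
  by apply: eq_bigr => u _; rewrite (linZ lr) tenZlr.
rewrite exchange_big; apply: eq_bigr => u _ /=.
by rewrite -ten_suml ct.
Qed.

Lemma polyev_gmon A V W (rho : gam n V -> W) r (a : 'I_r -> A) (f : 'I_r -> V) :
  linear rho ->
  polyev rho (\sum_(i < r) ten (a i) (f i)) =
  \sum_(nu : {ffun 'I_r -> 'I_n.+1} | (\sum_i (nu i : nat))%N == n)
     ten (\prod_i a i ^+ nu i) (rho (gmon n f (fun i => nu i))).
Proof.
move=> lr; apply: polyev_expand lr _ => u.
rewrite (eq_bigr (fun nu : {ffun 'I_r -> 'I_n.+1} =>
  \sum_(w : {ffun 'I_n -> 'I_r} | [forall i, #|[set j | w j == i]| == nu i])
     (\prod_j (crd (u j) (f (w j)) *: a (w j))))); last first.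
  move=> nu _; rewrite ffunE scaler_suml; apply: eq_bigr => w /forallP wnu.
  rewrite scaler_prod prod_content; congr (_ *: _); apply: eq_bigr => i _.
  by rewrite ffunE (eqP (wnu i)).
(* Each word w occurs for exactly one nu, given by the sizes of its fibres; these are at most n and
   add up to n. *)
rewrite (exchange_big_dep xpredT) //=; under eq_bigr => w _.
  have cl i : (#|[set j | w j == i]| < n.+1)%N.
    by rewrite ltnS -[X in (_ <= X)%N]card_ord max_card.
  rewrite (big_pred1 [ffun i => Ordinal (cl i)]); last first.
    move=> nu /=; apply/andP/eqP => [[_ /forallP wnu]|->].
      by apply/ffunP => i; rewrite ffunE; apply/val_inj => /=; rewrite (eqP (wnu i)).
    split; last by apply/forallP => i; rewrite ffunE.
    apply/eqP; transitivity (\sum_(i < r) \sum_(j < n | w j == i) 1)%N.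
      by apply: eq_bigr => i _; rewrite ffunE /= -sum1_card; apply: eq_bigl => j; rewrite inE.
    transitivity (\sum_(j < n) 1)%N; last by rewrite sum1_card card_ord.
    by rewrite [RHS](partition_big w xpredT).
  over.
rewrite /apow -(bigA_distr_bigA (fun j k => crd (u j) (f k) *: a k)).
by apply: eq_bigr => j _; rewrite tcoord_sum; apply: eq_bigr => k _; rewrite tcoord_ten.
Qed.

Lemma polyev_one A V W (rho : gam n V -> W) (f : V) : linear rho ->
  polyev rho (ten (1 : A) f) = ten (1 : A) (rho (gpow n f)).
Proof.
move=> lr; rewrite (@polyev_expand A V W rho _ unit (tt :: nil) xpredT
  (fun=> 1) (fun=> gpow n f) lr) ?big_seq1 // => u.
rewrite big_seq1 gpowE /apow; under [RHS]eq_bigr => j _ do rewrite tcoord_ten.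
by rewrite scaler_prod [X in _ = _ *: X]big1.
Qed.

Lemma polyev_map A A' (h : {lrmorphism A -> A'}) V W (rho : gam n V -> W) (x : tens A V) :
  polyev rho (tmap h id x) = tmap h id (polyev rho x).
Proof.
rewrite /polyev tmap_sum; [|exact: lrm_linear|exact: id_linear].
apply: eq_bigr => u _; rewrite tmap_ten; [|exact: lrm_linear|exact: id_linear].
by congr ten; rewrite rmorph_prod; apply: eq_bigr => j _; rewrite tcoord_map.
Qed.

Lemma polyev_scale A V W (rho : gam n V -> W) (a : A) (x : tens A V) :
  polyev rho (tscale a x) = tscale (a ^+ n) (polyev rho x).
Proof.
rewrite /polyev /tscale tmap_sum; [|exact: mulr_linear|exact: id_linear].
apply: eq_bigr => u _; rewrite tmap_ten; [|exact: mulr_linear|exact: id_linear].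
congr ten; rewrite /apow; under eq_bigr => j _ do rewrite tcoord_scale.
by rewrite big_split /= prodr_const card_ord.
Qed.

Lemma polyev_post A V W W' (g : W -> W') (rho : gam n V -> W) (x : tens A V) :
  linear g -> tmap id g (polyev rho x) = polyev (fun t => g (rho t)) x.
Proof.
move=> lg; rewrite /polyev tmap_sum //; apply: eq_bigr => u _.
by rewrite tmap_ten.
Qed.

(* Over A, y^[n] x^[n] = (y x)^[n]; this is its coordinate at the word u. *)
Lemma apow_comp A (M N P : vectType B) (y : tens A 'Hom(N, P)) (x : tens A 'Hom(M, N))
    (u : word n 'Hom(M, P)) :
  \sum_(v : word n 'Hom(N, P) | rep v == v) \sum_(w : word n 'Hom(M, N) | rep w == w)
     gcomp (orb v) (orb w) u *: (apow y v * apow x w) =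
  apow (tmul (fun g f => (g \o f)%VF) y x) u.
Proof.
pose c (k : 'I_(dim 'Hom(M, P))) i l : B := crd k (@bvec B 'Hom(N, P) i \o @bvec B 'Hom(M, N) l)%VF.
have tE (k : 'I_(dim 'Hom(M, P))) : tcoord k (tmul (fun g f => (g \o f)%VF) y x) =
    \sum_i \sum_l c k i l *: (tcoord i y * tcoord l x).
  rewrite {1}[y]tens_basis {1}[x]tens_basis (tmul_sum (@comp_bilin B M N P)).
  rewrite tcoord_sum; apply: eq_bigr => i _; rewrite tcoord_sum; apply: eq_bigr => l _.
  by rewrite tcoord_ten.
pose S (v' : word n 'Hom(N, P)) (w' : word n 'Hom(M, N)) : B := \prod_j c (u j) (v' j) (w' j).
transitivity (\sum_(v' : word n 'Hom(N, P)) \sum_(w' : word n 'Hom(M, N))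
    S v' w' *: (apow y v' * apow x w')).
  transitivity (\sum_(v : word n 'Hom(N, P) | rep v == v)
    \sum_(w : word n 'Hom(M, N) | rep w == w)
    \sum_(v' : word n 'Hom(N, P)) \sum_(w' : word n 'Hom(M, N))
     S v' w' *: ((orb v v' *: apow y v) * (orb w w' *: apow x w))).
    apply: eq_bigr => v _; apply: eq_bigr => w _.
    rewrite gmulE scaler_suml; apply: eq_bigr => v' _.
    rewrite scaler_suml; apply: eq_bigr => w' _.
    rewrite -[in RHS]scalerAr -[in RHS]scalerAl !scalerA; congr (_ *: _).
    by rewrite mulrC mulrA mulrAC.
  under eq_bigr => v _ do rewrite exchange_big.
  rewrite exchange_big; apply: eq_bigr => v' _.
  under eq_bigr => v _ do rewrite exchange_big.
  rewrite exchange_big; apply: eq_bigr => w' _.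
  transitivity (S v' w' *:
    ((\sum_(v : word n 'Hom(N, P) | rep v == v) orb v v' *: apow y v) *
     (\sum_(w : word n 'Hom(M, N) | rep w == w) orb w w' *: apow x w))).
    rewrite mulr_suml scaler_sumr; apply: eq_bigr => v _.
    by rewrite mulr_sumr scaler_sumr.
  by rewrite !sum_rep //; [exact: apow_rep|exact: apow_rep].
rewrite /apow (eq_bigr _ (fun j _ => tE (u j))) bigA_distr_bigA.
apply: eq_bigr => v' _; rewrite bigA_distr_bigA; apply: eq_bigr => w' _.
by rewrite scaler_prod big_split.
Qed.

Lemma polyev_comp A (M N P : vectType B) W (r : gam n 'Hom(M, P) -> W)
    (y : tens A 'Hom(N, P)) (x : tens A 'Hom(M, N)) :
  linear r ->
  polyev r (tmul (fun g f => (g \o f)%VF) y x) =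
  \sum_(v : word n 'Hom(N, P) | rep v == v) \sum_(w : word n 'Hom(M, N) | rep w == w)
    ten (apow y v * apow x w) (r (gcomp (orb v) (orb w))).
Proof.
move=> lr; rewrite pair_big /=.
apply: polyev_expand lr _ => u; rewrite -apow_comp pair_big /=.
by apply: eq_bigr.
Qed.

Lemma tmul_polyev A (M N P : vectType B) (W1 W2 W : lmodType B) (m : W1 -> W2 -> W)
    (r1 : gam n 'Hom(N, P) -> W1) (r2 : gam n 'Hom(M, N) -> W2)
    (y : tens A 'Hom(N, P)) (x : tens A 'Hom(M, N)) : bilin m ->
  tmul m (polyev r1 y) (polyev r2 x) =
  \sum_(v : word n 'Hom(N, P) | rep v == v) \sum_(w : word n 'Hom(M, N) | rep w == w)
    ten (apow y v * apow x w) (m (r1 (orb v)) (r2 (orb w))).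
Proof. by move=> bm; rewrite tmul_sum. Qed.

End PolynomialEvaluation.

(** * Generic points: recovering a linear map from its law *)

Section Coefficients.
Variables (B : binomialRingType) (n : nat).
Implicit Types (V : vectType B) (A : comAlgType B) (W : lmodType B).

Definition tcoef d W (m : 'X_{1..d}) (x : tens {mpoly B[d]} W) : W :=
  tlift (fun (p : {mpoly B[d]}) (w : W) => p@_m *: w) x.

Lemma tcoef_bilin d W (m : 'X_{1..d}) :
  bilin (fun (p : {mpoly B[d]}) (w : W) => p@_m *: w).
Proof.
split=> [p a w w'|w a p p'].
  by rewrite scalerDr !scalerA mulrC.
by rewrite mcoeffD mcoeffZ scalerDl scalerA.
Qed.

Lemma tcoef_sum d W (T : finType) (P : pred T) (m : T -> 'X_{1..d}) (w : T -> W) k :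
  {in P &, injective m} -> P k ->
  tcoef (m k) (\sum_(i | P i) ten ('X_[m i] : {mpoly B[d]}) (w i)) = w k.
Proof.
move=> mi Pk; rewrite /tcoef tlift_sum; last exact: tcoef_bilin.
rewrite (bigD1 k) //= tlift_ten; last exact: tcoef_bilin.
rewrite mcoeffX eqxx scale1r big1 ?addr0 // => i /andP[Pi ik].
rewrite tlift_ten; last exact: tcoef_bilin.
rewrite mcoeffX; case: eqP => [/mi e|_]; last by rewrite scale0r.
by rewrite e ?eqxx // in ik.
Qed.

Definition wmon d e (f : 'I_d -> 'I_e) (u : {ffun 'I_n -> 'I_d}) : 'X_{1..e} :=
  (\sum_j U_(f (u j)))%MM.

Lemma prod_wmon d e (f : 'I_d -> 'I_e) (u : {ffun 'I_n -> 'I_d}) :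
  \prod_j 'X_(f (u j)) = 'X_[wmon f u] :> {mpoly B[e]}.
Proof. exact: mprodXE. Qed.

Lemma wmonE d e (f : 'I_d -> 'I_e) (u : {ffun 'I_n -> 'I_d}) i :
  wmon f u i = #|[set j | f (u j) == i]|.
Proof.
rewrite /wmon mnm_sumE -sum1_card [RHS]big_mkcond /=.
by apply: eq_bigr => j _; rewrite inE mnm1E; case: eqP.
Qed.

Lemma wmon_inj d e (f : 'I_d -> 'I_e) (u v : {ffun 'I_n -> 'I_d}) :
  injective f -> (forall i, wmon f u (f i) = wmon f v (f i)) -> rep u = rep v.
Proof.
move=> fi e0; apply: rep_content; apply/ffunP => i; rewrite !ffunE.
have := e0 i; rewrite !wmonE; have E w : [set j | f (w j) == f i] = [set j | w j == i].
  by apply/setP => j; rewrite !inE (inj_eq fi).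
by rewrite !E.
Qed.

(** The map f assigns variables to coordinates. An injection that is not onto leaves variables free
    for a second generic point or for a scaling parameter. *)
Definition generic d V (f : 'I_(dim V) -> 'I_d) : tens {mpoly B[d]} V :=
  \sum_i ten ('X_(f i) : {mpoly B[d]}) (bvec i).

Lemma tcoord_generic d V (f : 'I_(dim V) -> 'I_d) i : tcoord i (generic f) = 'X_(f i).
Proof.
rewrite /generic tcoord_sum (bigD1 i) //= tcoord_ten crd_bvec eqxx scale1r.
rewrite big1 ?addr0 // => j ji; rewrite tcoord_ten crd_bvec eq_sym (negbTE ji).
by rewrite scale0r.
Qed.

Lemma apow_generic d V (f : 'I_(dim V) -> 'I_d) (u : word n V) :
  apow (generic f) u = 'X_[wmon f u].
Proof. by rewrite -prod_wmon; apply: eq_bigr => j _; rewrite tcoord_generic. Qed.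

Lemma gam_linear_ext V W (r r' : gam n V -> W) : linear r -> linear r' ->
  (forall u : word n V, rep u == u -> r (orb u) = r' (orb u)) -> r =1 r'.
Proof.
move=> lr lr' e t; rewrite [t]gam_orb (lin_sum lr) (lin_sum lr').
by apply: eq_bigr => u ru; rewrite (linZ lr) (linZ lr') e.
Qed.

(** At the generic point different orbits of words give different monomials, so that the
    coefficients of the law are the values on the basis [orb]. *)
Lemma polyev_inj V W (r r' : gam n V -> W) : linear r -> linear r' ->
  polyev r (generic id) = polyev r' (generic id) -> r =1 r'.
Proof.
move=> lr lr' e; apply: gam_linear_ext => // u ru.
have wi : {in [pred v : word n V | rep v == v] &, injective (wmon id)}.
  move=> v w /eqP rv /eqP rw vw; rewrite -rv -rw; apply: wmon_inj (fun x y => id) _ => i.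
  by rewrite vw.
have := congr1 (tcoef (wmon id u)) e; rewrite /polyev.
do 2!rewrite (eq_bigr _ (fun v _ => congr1 (fun p => ten p _) (apow_generic id v))).
by rewrite !(tcoef_sum _ wi).
Qed.

(** W may have torsion, so a check on powers would not suffice. Instead y and x are generic points
    in disjoint sets of variables, and the coefficient of a product of two monomials isolates one
    pair of basis elements. *)
Lemma polyev_mulP (M N P : vectType B) (W1 W2 W : lmodType B) (m : W1 -> W2 -> W)
    (r1 : gam n 'Hom(N, P) -> W1) (r2 : gam n 'Hom(M, N) -> W2)
    (r : gam n 'Hom(M, P) -> W) :
  linear r1 -> linear r2 -> linear r -> bilin m ->
  (forall (A : comAlgType B) (y : tens A 'Hom(N, P)) (x : tens A 'Hom(M, N)),
     polyev r (tmul (fun g f => (g \o f)%VF) y x) = tmul m (polyev r1 y) (polyev r2 x)) ->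
  forall t s, r (gcomp t s) = m (r1 t) (r2 s).
Proof.
move=> l1 l2 l bm e t s.
pose y := generic (@lshift (dim 'Hom(N, P)) (dim 'Hom(M, N))).
pose x := generic (@rshift (dim 'Hom(N, P)) (dim 'Hom(M, N))).
pose mon2 (p : word n 'Hom(N, P) * word n 'Hom(M, N)) :=
  (wmon (@lshift (dim 'Hom(N, P)) (dim 'Hom(M, N))) p.1 +
   wmon (@rshift (dim 'Hom(N, P)) (dim 'Hom(M, N))) p.2)%MM.
have monx p : apow y p.1 * apow x p.2 = 'X_[mon2 p].
  by rewrite !apow_generic -mpolyXD.
pose P2 := [pred p : word n 'Hom(N, P) * word n 'Hom(M, N) |
  (rep p.1 == p.1) && (rep p.2 == p.2)].
have wl (u : word n 'Hom(N, P)) j :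
    wmon (@lshift (dim 'Hom(N, P)) (dim 'Hom(M, N))) u (rshift _ j) = 0%N.
  rewrite wmonE; apply/eqP; rewrite cards_eq0; apply/eqP/setP => k.
  by rewrite !inE eq_lrshift.
have wr (u : word n 'Hom(M, N)) j :
    wmon (@rshift (dim 'Hom(N, P)) (dim 'Hom(M, N))) u (lshift _ j) = 0%N.
  rewrite wmonE; apply/eqP; rewrite cards_eq0; apply/eqP/setP => k.
  by rewrite !inE eq_rlshift.
have mi : {in P2 &, injective mon2}.
  move=> [v w] [v' w'] /= /andP[/eqP /= rv /eqP rw] /andP[/eqP /= rv' /eqP rw'] ee.
  rewrite -rv -rw -rv' -rw'; congr (_, _).
    apply: (wmon_inj (@lshift_inj _ (dim 'Hom(M, N)))) => i.
    have := congr1 (fun m : 'X_{1.._} => m (lshift _ i)) ee; rewrite /mon2 !mnmDE !wr !addn0. exact id.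
  apply: (wmon_inj (@rshift_inj (dim 'Hom(N, P)) _)) => i.
  have := congr1 (fun m : 'X_{1.._} => m (rshift _ i)) ee; rewrite /mon2 !mnmDE !wl !add0n.
  exact id.
have key v w : rep v == v -> rep w == w ->
    r (gcomp (orb v) (orb w)) = m (r1 (orb v)) (r2 (orb w)).
  move=> rv rw; have := e _ y x; rewrite (polyev_comp _ _ l) (tmul_polyev _ _ _ _ bm).
  rewrite !pair_big /= => ee; have := congr1 (tcoef (mon2 (v, w))) ee.
  do 2!rewrite (eq_bigr _ (fun p _ => congr1 (fun q => ten q _) (monx p))).
  by rewrite !(tcoef_sum _ mi) //= rv rw.
rewrite [t]gam_orb [s]gam_orb.
rewrite (lin_sum (gcomp_linear_l _)) (lin_sum l) (lin_sum l1).
rewrite (lin_sum (bm.2 _)); apply: eq_bigr => v rv.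
rewrite (linZ (gcomp_linear_l _)) (linZ l) (linZ l1) (linZ (bm.2 _)); congr (_ *: _).
rewrite (lin_sum (gcomp_linear_r _)) (lin_sum l) (lin_sum l2) (lin_sum (bm.1 _)).
apply: eq_bigr => w rw.
by rewrite (linZ (gcomp_linear_r _)) (linZ l) (linZ l2) (linZ (bm.1 _)) key.
Qed.

End Coefficients.

Lemma content_surj n d (c : {ffun 'I_d -> nat}) : (\sum_i c i)%N = n ->
  exists u : {ffun 'I_n -> 'I_d}, content u = c.
Proof.
move=> cn; pose s := flatten [seq nseq (c i) i | i <- enum 'I_d].
have ss : size s == n.
  rewrite size_flatten /shape -map_comp sumnE big_map -cn enumT.
  by apply/eqP/eq_bigr => i _; rewrite /= size_nseq.
exists [ffun j => tnth (Tuple ss) j]; apply/ffunP => i; rewrite ffunE cardsE.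
transitivity (count_mem i s).
  rewrite -[s]/(tval (Tuple ss)) -{2}(map_tnth_enum (Tuple ss)) count_map.
  rewrite -sum1_card -sum1_count big_enum_cond; apply: eq_bigl => j.
  by rewrite /in_mem /= ffunE.
rewrite /s count_flatten -map_comp sumnE big_map enumT (bigD1 i) //= count_nseq /= eqxx mul1n.
by rewrite big1 ?addn0 // => j ji; rewrite count_nseq /= (negbTE ji).
Qed.

(** * Every homogeneous polynomial law comes from a linear map on Gamma^n *)

Section Linearization.
Variables (B : binomialRingType) (n : nat).
Implicit Types (V : vectType B) (A : comAlgType B) (W : lmodType B).

Section Evaluation.
Variables (k : nat) (A : comAlgType B) (g : 'I_k -> A).

Definition mev : {mpoly B[k]} -> A := mmap (in_alg A) g.

Fact mev_is_scalable : scalable mev.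
Proof. by move=> c p; rewrite /mev mmapZ /= -scalerAl mul1r. Qed.

HB.instance Definition _ := GRing.RMorphism.on mev.
HB.instance Definition _ := GRing.isScalable.Build B {mpoly B[k]} A *:%R mev mev_is_scalable.

Lemma mevX i : mev 'X_i = g i.
Proof. by rewrite /mev mmapX mmap1U. Qed.

Lemma mevC c : mev c%:MP = c%:A.
Proof. by rewrite /mev mmapC. Qed.

End Evaluation.

Lemma mpoly_rmorph_ext k (S : comNzRingType) (f g : {rmorphism {mpoly B[k]} -> S}) :
  (forall c, f c%:MP = g c%:MP) -> (forall i, f 'X_i = g 'X_i) -> f =1 g.
Proof.
move=> fgc fgx p; rewrite [p]mpolyE !rmorph_sum; apply: eq_bigr => m _.
rewrite -mul_mpolyC !rmorphM fgc mpolyXE_id !rmorph_prod; congr (_ * _).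
by apply: eq_bigr => i _; rewrite !rmorphXn fgx.
Qed.

Section Existence.
Variables (V : vectType B) (W : lmodType B).
Variable p : forall A, tens A V -> tens A W.
Hypothesis p_natural : forall A A' (h : {lrmorphism A -> A'}) (x : tens A V),
  p (tmap h id x) = tmap h id (p x).
Hypothesis p_homogeneous : forall A (a : A) (x : tens A V),
  p (tscale a x) = tscale (a ^+ n) (p x).

(* The coordinates of V at the generic point x0 are the first d variables.  The last
   variable T stays free for a scaling of x0: comparing p (T x0) with T^n p (x0)
   leaves only the monomials of degree n in the X_i. *)
Let d := dim V.
Let R := {mpoly B[d.+1]}.
Let x0 : tens R V := @generic B d.+1 V (lift ord_max).

Definition valuation A (x : tens A V) (i : 'I_d.+1) : A :=
  if unlift ord_max i is Some j then @tcoord B A V j x else 1.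

Let ev A (x : tens A V) : R -> A := mev (valuation x).

Lemma evE A (x : tens A V) (i : 'I_(dim V)) : ev x 'X_(lift ord_max i) = tcoord i x.
Proof. by rewrite /ev mevX /valuation liftK. Qed.

Lemma tmap_ev A (x : tens A V) : tmap (ev x) id x0 = x.
Proof.
rewrite /x0 /generic tmap_sum; [|exact: lrm_linear|exact: id_linear].
rewrite [RHS]tens_basis; apply: eq_bigr => i _.
by rewrite tmap_ten; [rewrite evE|exact: lrm_linear|exact: id_linear].
Qed.

Let T : R := 'X_ord_max.
Let x1 := tscale T x0.
Let z := p x0.

(** Both sides are p (T x0): [ev x1] carries x0 to T x0, while [ev x0] fixes x0, though it sends the
    variable T to 1. *)
Lemma ev_scaled : tmap (ev x1) id z = tscale (T ^+ n) (tmap (ev x0) id z).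
Proof. by rewrite -[tmap (ev x0) id z]p_natural -p_natural !tmap_ev p_homogeneous. Qed.

Section Point.
Variables (A : comAlgType B) (x : tens A V).

(* A[t]-point: X_i goes to the coordinate of x and T to t *)
Let point (i : 'I_d.+1) : {poly A} :=
  if unlift ord_max i is Some j then (@tcoord B A V j x)%:P else 'X.
Let psi : R -> {poly A} := mmap (polyC \o in_alg A) point.
HB.instance Definition _ := GRing.RMorphism.on psi.

Lemma psiC c : psi c%:MP = (c%:A)%:P.
Proof. by rewrite /psi mmapC. Qed.

Lemma psiX i : psi 'X_i = point i.
Proof. by rewrite /psi mmapX mmap1U. Qed.

Lemma psiM P P' : psi (P * P') = psi P * psi P'.
Proof. exact: rmorphM. Qed.

Lemma psi_ev P : psi (ev x0 P) = (ev x P)%:P.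
Proof.
apply: (@mpoly_rmorph_ext _ _ (psi \o ev x0) (polyC \o ev x)) => [c|i] /=.
  by rewrite !mevC -mul_mpolyC mulr1 psiC.
rewrite !mevX /valuation; case: unliftP => [j _|_]; last by rewrite rmorph1.
by rewrite /x0 tcoord_generic psiX /point liftK.
Qed.

(** Linear but not multiplicative: the coefficient of t^n at the point x. It undoes a multiplication
    by T^n, see [lam_T]. *)
Let lam (P : R) : A := (psi P)`_n.
Lemma lam_linear : linear lam.
Proof.
move=> c P P'; rewrite /lam rmorphD coefD /=; congr (_ + _).
by rewrite -mul_mpolyC psiM psiC coefCM -scalerAl mul1r.
Qed.

Lemma lam_T P : lam (T ^+ n * ev x0 P) = ev x P.
Proof.
rewrite /lam psiM psi_ev -[psi (_ ^+ _)]/((psi : {rmorphism R -> {poly A}}) _) rmorphXn /= psiX /point unlift_none.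
by rewrite coefXnM ltnn subnn coefC.
Qed.

(** Apply [lam] to [ev_scaled]: on the right it cancels T^n and leaves the image of z under [ev x],
    which is p x by naturality. *)
Lemma p_lam : p x = tmap lam id (tmap (ev x1) id z).
Proof.
rewrite ev_scaled -{1}[x]tmap_ev p_natural -/z [z]tens_sum.
have l1 := @lrm_linear B _ _ (ev x); have l2 := @lrm_linear B _ _ (ev x0).
have l3 := @mulr_linear B R (T ^+ n).
rewrite /tscale !(tmap_sum _ _ _ l1) ?(tmap_sum _ _ _ l2) ?(tmap_sum _ _ _ l3)
  ?(tmap_sum _ _ _ lam_linear) //; apply: eq_bigr => q _.
by rewrite !(tmap_ten _ _ _ _) //= ?lam_T //; apply: lam_linear.
Qed.

Definition mcontent (m : 'X_{1..d.+1}) : {ffun 'I_d -> nat} :=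
  [ffun i => m (lift ord_max i)].

Lemma psi_ev_mon m :
  psi (ev x1 'X_[m]) = 'X^(\sum_i mcontent m i)%N * (\prod_i @tcoord B A V i x ^+ mcontent m i)%:P.
Proof.
have E (i : 'I_(dim V)) : psi (ev x1 'X_(lift ord_max i)) = 'X * (tcoord i x)%:P.
  rewrite /ev mevX /valuation liftK /x1 tcoord_scale psiM /x0 tcoord_generic !psiX.
  by rewrite /point unlift_none liftK.
pose h : {rmorphism R -> {poly A}} := psi \o ev x1.
have hT : h 'X_ord_max = 1.
  by rewrite /= mevX /valuation unlift_none -[psi _]/((psi : {rmorphism R -> {poly A}}) _) rmorph1.
rewrite -[LHS]/(h 'X_[m]) mpolyXE_id rmorph_prod (bigD1_ord ord_max) //.
rewrite rmorphXn hT expr1n [LHS]mul1r.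
rewrite (eq_bigr (fun i => 'X ^+ mcontent m i * (@tcoord B A V i x ^+ mcontent m i)%:P)).
  by rewrite big_split prodrXr rmorph_prod.
by move=> i _; rewrite rmorphXn [h _]E ffunE exprMn rmorphXn.
Qed.

(** At most one representative word has the content of m, and there is one exactly when m has degree
    n in the coordinate variables. Otherwise both sides vanish. *)
Lemma lam_ev_mon m : lam (ev x1 'X_[m]) =
  \sum_(u : word n V | (rep u == u) && (content u == mcontent m)) apow x u.
Proof.
rewrite /lam psi_ev_mon coefMC coefXn.
case: (pickP [pred u : word n V | (rep u == u) && (content u == mcontent m)]) => [u|no].
  move=> /= /andP[/eqP ru /eqP cu]; rewrite (big_pred1 u) => [|v /=]; last first.
    apply/andP/eqP => [[/eqP <- /eqP cv]|->]; last by rewrite ru cu.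
    by rewrite -ru; apply: rep_content; rewrite -content_rep cv.
  rewrite /apow (prod_content (fun i => tcoord i x)) -cu; suff -> : (\sum_i content u i)%N = n by rewrite eqxx mul1r.
  transitivity (\sum_(j < n) 1)%N; last by rewrite sum1_card card_ord.
  rewrite [RHS](partition_big u xpredT) //; apply: eq_bigr => i _.
  by rewrite ffunE -sum1_card; apply: eq_bigl => j; rewrite inE.
rewrite [RHS]big_pred0 //; have [e|_] := eqVneq n (\sum_i mcontent m i)%N; last by rewrite mul0r.
have [u cu] := content_surj (esym e).
by have := no (rep u); rewrite /= repK content_rep cu !eqxx.
Qed.

Lemma lam_ev P : lam (ev x1 P) =
  \sum_(m <- msupp P) P@_m *: lam (ev x1 'X_[m]).
Proof.
rewrite {1}[P]mpolyE -[ev x1 _]/((ev x1 : {linear R -> R}) _) linear_sum.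
rewrite (lin_sum lam_linear); apply: eq_bigr => m _.
by rewrite linearZ_LR (linZ lam_linear).
Qed.

End Point.

(** The coefficient of z at the coordinate monomial of u, summed over all exponents of T, because
    [ev x1] sends T to 1. *)
Let coefw (u : word n V) : W := \sum_(q <- repr z)
  \sum_(m <- msupp q.1 | content u == mcontent m) q.1@_m *: q.2.

Definition linearization (t : gam n V) : W :=
  \sum_(u : word n V | rep u == u) t u *: coefw u.

Lemma linearization_linear : linear linearization.
Proof.
move=> a t t'; rewrite /linearization scaler_sumr -big_split; apply: eq_bigr => u _.
have -> : (a *: t + t') u = a * t u + t' u by rewrite !ffunE.
by rewrite scalerDl scalerA.
Qed.

Lemma linearizationP A (x : tens A V) : p x = polyev linearization x.
Proof.
have lo (u : word n V) : rep u == u -> linearization (orb u) = coefw u.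
  move=> ru; rewrite /linearization (bigD1 u) //= orbE ru scale1r big1 ?addr0 // => v /andP[rv vu].
  by rewrite orbE (eqP rv) (negbTE vu) scale0r.
rewrite /polyev (eq_bigr _ (fun u ru => congr1 (ten _) (lo u ru))).
rewrite p_lam {1}[z]tens_sum (tmap_sum _ _ _ (@lrm_linear B _ _ (ev x1))) //.
rewrite (tmap_sum _ _ _ (@lam_linear A x)) //.
under [RHS]eq_bigr => u _ do rewrite /coefw ten_sumr.
rewrite [RHS]exchange_big; apply: eq_bigr => q _.
rewrite (tmap_ten _ _ (@lrm_linear B _ _ (ev x1))) // (tmap_ten _ _ (@lam_linear A x)) //.
rewrite /= lam_ev ten_suml.
under [RHS]eq_bigr => u _ do rewrite ten_sumr big_mkcond.
rewrite [RHS]exchange_big; apply: eq_bigr => m _.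
rewrite lam_ev_mon tenZl ten_suml scaler_sumr big_mkcondr; apply: eq_bigr => u _.
by case: ifP => // _; rewrite tenZr.
Qed.

End Existence.
End Linearization.

(** * Modules and functors *)

Section Submodules.
Variables (R : comNzRingType) (V : lmodType R).

Record submodule := Submodule {
  smem :> V -> Prop;
  smem0 : smem 0;
  smem_linear : forall a x y, smem x -> smem y -> smem (a *: x + y)
}.

Implicit Types S : submodule.

Definition spred S : {pred V} := [pred x | `[< S x >]].

Fact spred_closed S : submod_closed (spred S).
Proof.
split=> [|a x y /asboolP Sx /asboolP Sy]; apply/asboolP; first exact: smem0.
exact: smem_linear.
Qed.

HB.instance Definition _ S := GRing.isSubmodClosed.Build R V (spred S) (spred_closed S).

Record smod (S : submodule) := Smod { sval_ : V; svalP_ : sval_ \in spred S }.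

HB.instance Definition _ S := [isSub of smod S for @sval_ S].
HB.instance Definition _ S := [Choice of smod S by <:].
HB.instance Definition _ S := [SubChoice_isSubZmodule of smod S by <:].
HB.instance Definition _ S := [SubZmodule_isSubLmodule of smod S by <:].

Definition smk S x (Sx : S x) : smod S := Smod (introT (asboolP (S x)) Sx).
Lemma sinc_linear S : linear (@sval_ S).
Proof. by []. Qed.
Definition sinc S : lhom (smod S) V := mklin (@sinc_linear S).
Lemma sincP S (x : smod S) : S (sinc S x).
Proof. exact/asboolP/(svalP_ x). Qed.
Lemma sinc_inj S : injective (sinc S).
Proof. by move=> x y e; apply: val_inj. Qed.
Lemma sinc_mk S x (Sx : S x) : sinc S (smk Sx) = x.
Proof. by []. Qed.

End Submodules.

Definition scorestr (R : comNzRingType) (U V : lmodType R) (S : submodule V)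
  (f : U -> V) (fS : forall x, S (f x)) (x : U) : smod S := smk (fS x).

Lemma scorestr_linear (R : comNzRingType) (U V : lmodType R) (S : submodule V)
  (f : U -> V) (fS : forall x, S (f x)) : linear f -> linear (scorestr fS).
Proof. by move=> lf a x y; apply: sinc_inj; rewrite linearP /= lf. Qed.

(** * Homogeneous functors as linear functors on the divided power category *)

Section StrictFunctors.
Variables (B : binomialRingType) (n : nat).
Implicit Types (M N P : vectType B) (H K : strictFunctor B) (A : comAlgType B).
Notation Bn := ('cV[B]_n : vectType B).

Lemma lcomp_bilin (U V W : lmodType B) :
  bilin (fun (g : lhom V W) (f : lhom U V) => lcomp g f).
Proof.
split=> [g a f f'|f a g g']; apply: lhomP => x //=.
by rewrite linearP.
Qed.

(** The polynomials in no variables stand for B as an algebra over itself; taking the constant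
    coefficient recovers w. *)
Lemma ten1_inj W (w w' : W : lmodType B) :
  ten (1 : {mpoly B[0]}) w = ten (1 : {mpoly B[0]}) w' -> w = w'.
Proof.
move=> /(congr1 (tcoef 0%MM)); rewrite /tcoef !tlift_ten; try exact: tcoef_bilin.
by rewrite mcoeff1 eqxx !scale1r.
Qed.

Lemma polyev_ext (V : vectType B) (W : lmodType B) (r r' : gam n V -> W)
    (A : comAlgType B) (x : tens A V) : r =1 r' -> polyev r x = polyev r' x.
Proof. by move=> /funext ->. Qed.

Section Theta.
Variable H : strictFunctor B.
Hypothesis hH : homogeneous n H.

(** The linear map on Gamma^n Hom(M, N) that corresponds to the polynomial law of H on arrows. On
    powers it is [fmap] ([theta_pow]), and it turns [gcomp] into composition ([theta_comp]). *)
Definition theta M N : gam n 'Hom(M, N) -> lhom (H M) (H N) :=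
  @linearization B n 'Hom(M, N) (lhom (H M) (H N)) (fun A => @smap B H A M N).

Lemma theta_linear M N : linear (@theta M N).
Proof. exact: linearization_linear. Qed.

Lemma smap_theta A M N (x : tens A 'Hom(M, N)) : smap H x = polyev (@theta M N) x.
Proof.
apply: (@linearizationP B n 'Hom(M, N) (lhom (H M) (H N))
  (fun A => @smap B H A M N)) => [A1 A2 h y|A1 a y].
  exact: smap_natural.
exact: hH.
Qed.

Lemma theta_uniq M N (r : gam n 'Hom(M, N) -> lhom (H M) (H N)) : linear r ->
  (forall A (x : tens A 'Hom(M, N)), smap H x = polyev r x) -> r =1 @theta M N.
Proof.
move=> lr e; apply: polyev_inj lr (@theta_linear M N) _.
by rewrite -e smap_theta.
Qed.

Lemma theta_pow M N (f : 'Hom(M, N)) : theta (gpow n f) = fmap H f.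
Proof.
apply: ten1_inj; rewrite -smap_fmap smap_theta polyev_one //.
exact: theta_linear.
Qed.

Lemma theta1 M x : theta (gpow n \1%VF) x = x :> H M.
Proof. by rewrite theta_pow fmap_id. Qed.

Lemma theta_comp M N P (t : gam n 'Hom(N, P)) (s : gam n 'Hom(M, N)) x :
  theta (gcomp t s) x = theta t (theta s x).
Proof.
suff -> : theta (gcomp t s) = lcomp (theta t) (theta s) by [].
apply: (polyev_mulP (@theta_linear N P) (@theta_linear M N) (@theta_linear M P)
  (@lcomp_bilin _ _ _)) => A y z.
by rewrite -!smap_theta smap_comp.
Qed.

Lemma theta_schur : is_schur_action (@theta Bn Bn).
Proof.
split; first exact: theta_linear.
by move=> A r a f; rewrite smap_theta polyev_gmon //; apply: theta_linear.
Qed.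

(** Hence the actions stored in [NatQ] and [ExtQ] may be computed with [theta]. *)
Lemma schur_theta (rho : schur B n -> lhom (H Bn) (H Bn)) :
  is_schur_action rho -> rho =1 @theta Bn Bn.
Proof.
case=> lr e; apply: theta_uniq => // A x.
by rewrite [x]tens_basis e -polyev_gmon.
Qed.

End Theta.

(** Strictness is commutation with all of [theta]. Plain naturality gives this on the powers f^[n]
    only. *)
Lemma strict_naturalP H K (hH : homogeneous n H) (hK : homogeneous n K)
    (h : nat_trans H K) :
  strict_natural h <->
  forall M N (t : gam n 'Hom(M, N)) x, h N (theta H t x) = theta K t (h M x).
Proof.
have l1 M N (t : gam n 'Hom(M, N)) := @lcomp_bilin (H M) (H N) (K N).
split=> [sh M N t x|e A M N x].
  have lH : linear (fun t => lcomp (h N) (@theta H M N t)).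
    by move=> a s s'; rewrite theta_linear (@lcomp_bilin _ _ _).1.
  have lK : linear (fun t => lcomp (@theta K M N t) (h M)).
    by move=> a s s'; rewrite theta_linear (@lcomp_bilin _ _ _).2.
  have E : lcomp (h N) (theta H t) = lcomp (theta K t) (h M).
    apply: (polyev_inj lH lK).
    have := sh _ M N (generic id); rewrite !smap_theta // !polyev_post //.
    - exact: (@lcomp_bilin _ _ _).2.
    - exact: (@lcomp_bilin _ _ _).1.
  by have := congr1 (fun f : lhom (H M) (K N) => f x) E.
rewrite !smap_theta // !polyev_post //.
- by apply: polyev_ext => t; apply: lhomP => y /=; rewrite e.
- exact: (@lcomp_bilin _ _ _).2.
- exact: (@lcomp_bilin _ _ _).1.
Qed.

Section FromAction.
Variable ob : vectType B -> lmodType B.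
Variable act : forall M N, gam n 'Hom(M, N) -> lhom (ob M) (ob N).
Hypothesis act_linear : forall M N, linear (@act M N).
Hypothesis act1 : forall M x, act (gpow n (\1%VF : 'Hom(M, M))) x = x.
Hypothesis act_comp : forall M N P (t : gam n 'Hom(N, P)) (s : gam n 'Hom(M, N)) x,
  act (gcomp t s) x = act t (act s x).

Fact afun_id M : act (gpow n (\1%VF : 'Hom(M, M))) = lid (ob M).
Proof. by apply: lhomP => x; rewrite act1. Qed.
Fact afun_comp M N P (g : 'Hom(N, P)) (f : 'Hom(M, N)) :
  act (gpow n (g \o f)%VF) = lcomp (act (gpow n g)) (act (gpow n f)).
Proof. by apply: lhomP => x; rewrite -gcomp_pow act_comp. Qed.

Definition afun : modFunctor B := ModFunctor afun_id afun_comp.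

Definition asmap A M N (x : tens A 'Hom(M, N)) : tens A (lhom (afun M) (afun N)) :=
  polyev (@act M N) x.

Fact asmap_natural A A' (h : {lrmorphism A -> A'}) M N (x : tens A 'Hom(M, N)) :
  asmap (tmap h id x) = tmap h id (asmap x).
Proof. exact: polyev_map. Qed.
Fact asmap_fmap A M N (f : 'Hom(M, N)) :
  asmap (ten (1 : A) f) = ten (1 : A) (fmap afun f).
Proof. exact/polyev_one/act_linear. Qed.
Fact asmap_id A M : asmap (ten (1 : A) (\1%VF : 'Hom(M, M))) = ten (1 : A) (lid (afun M)).
Proof. by rewrite asmap_fmap fmap_id. Qed.
Fact asmap_comp A M N P (y : tens A 'Hom(N, P)) (x : tens A 'Hom(M, N)) :
  asmap (tmul (fun g f => (g \o f)%VF) y x) =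
  tmul (fun g f => lcomp g f) (asmap y) (asmap x).
Proof.
rewrite /asmap polyev_comp; last exact: act_linear.
rewrite tmul_polyev; last exact: lcomp_bilin.
apply: eq_bigr => v _; apply: eq_bigr => w _; congr ten.
by apply: lhomP => z; rewrite act_comp.
Qed.

Definition astrict : strictFunctor B :=
  StrictFunctor asmap_natural asmap_id asmap_comp asmap_fmap.

Lemma astrict_homogeneous : homogeneous n astrict.
Proof. by move=> A M N a x; apply: polyev_scale. Qed.

Lemma theta_astrict M N (t : gam n 'Hom(M, N)) : theta astrict t = act t.
Proof. by symmetry; apply: (theta_uniq astrict_homogeneous (act_linear (N:=N))). Qed.

End FromAction.

(** The map f |-> f^[n] satisfies both axioms of degree n, by [gpow_degree] and [gpow_binomial], and
    the linear L transports them to F. *)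
Lemma numerical_of_linear (F : modFunctor B)
    (L : forall M N, gam n 'Hom(M, N) -> lhom (F M) (F N)) :
  (forall M N, linear (@L M N)) -> (forall M N (f : 'Hom(M, N)), fmap F f = L M N (gpow n f)) ->
  numerical n F.
Proof.
move=> lL e; have dE M N k (f : 'I_k -> 'Hom(M, N)) :
    deviation (@fmap _ F M N) f = L M N (deviation (@gpow B n _) f).
  rewrite /deviation (lin_sum (lL M N)); apply: eq_bigr => I _.
  by rewrite (linZ (lL M N)) e.
split=> [M N f|M N r f]; first by rewrite dE gpow_degree (lin0 (lL M N)).
rewrite e gpow_binomial (lin_sum (lL M N)); apply: eq_bigr => k _.
by rewrite (linZ (lL M N)) dE.
Qed.

Lemma homogeneous_numerical H : homogeneous n H -> numerical n H.
Proof.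
move=> hH; apply: (numerical_of_linear (@theta_linear H)) => M N f.
by rewrite theta_pow.
Qed.

Lemma Q_numerical : numerical n (Q B n).
Proof.
pose L M N (t : gam n 'Hom(M, N)) : lhom (Q B n M) (Q B n N) :=
  mklin (@gcomp_linear_r B n Bn M N t).
apply: (@numerical_of_linear _ L) => [M N a t t'|M N f]; apply: lhomP => x.
  exact: gcomp_linear_l.
exact: Qmap_gcomp.
Qed.

End StrictFunctors.

(** * Functors determined by their value at B^n *)

(** The common device for maps out of quotients, into subobjects and between fibre products: writing
    down the graph avoids choosing representatives. Single-valuedness follows from closure under
    linear combinations and the kernel condition. *)
Lemma linear_rel (R : comNzRingType) (U V : lmodType R) (r : U -> V -> Prop) :
  (forall x, exists y, r x y) ->
  (forall a x y x' y', r x y -> r x' y' -> r (a *: x + x') (a *: y + y')) ->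
  (forall y, r 0 y -> y = 0) ->
  exists h : lhom U V, (forall x, r x (h x)) /\ (forall x y, r x y -> h x = y).
Proof.
move=> tot lin ker.
have fn x y y' : r x y -> r x y' -> y = y'.
  move=> rx /(lin (-1) _ _ _ _ rx); rewrite !scaleN1r addNr => /ker /eqP.
  by rewrite addrC subr_eq0 => /eqP ->.
pose h x := sval (cid (tot x)); have hr x : r x (h x) by rewrite /h; case: cid.
have lh : linear h by move=> a x y; apply: fn (hr _) _; apply: lin; apply: hr.
by exists (mklin lh); split=> [//|x y]; apply: fn.
Qed.

Section NaturalTransformations.
Variable B : binomialRingType.
Implicit Types (F G K : modFunctor B) (M N P : vectType B).

Lemma natural_rel F G (r : forall M, F M -> G M -> Prop) :
  (forall M x, exists y, r M x y) ->
  (forall M a x y x' y', r M x y -> r M x' y' -> r M (a *: x + x') (a *: y + y')) ->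
  (forall M y, r M 0 y -> y = 0) ->
  (forall M N (f : 'Hom(M, N)) x y, r M x y -> r N (fmap F f x) (fmap G f y)) ->
  exists h : nat_trans F G,
    (forall M x, r M x (h M x)) /\ (forall M x y, r M x y -> h M x = y).
Proof.
move=> tot lin ker nat.
pose h M := sval (cid (linear_rel (tot M) (@lin M) (ker M))).
have hr M : (forall x, r M x (h M x)) /\ (forall x y, r M x y -> h M x = y).
  by rewrite /h; case: cid.
have hn M N (f : 'Hom(M, N)) x : h N (fmap F f x) = fmap G f (h M x).
  by apply: (hr N).2; apply: nat; apply: (hr M).1.
by exists (NatTrans hn); split=> M; apply (hr M).
Qed.

Lemma natural_comp_subproof F G K (g : nat_trans G K) (f : nat_trans F G) M N
  (a : 'Hom(M, N)) x : g N (f N (fmap F a x)) = fmap K a (g M (f M x)).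
Proof. by rewrite !nt_natural. Qed.
Definition ncomp F G K (g : nat_trans G K) (f : nat_trans F G) : nat_trans F K :=
  @NatTrans B F K (fun M => lcomp (g M) (f M)) (natural_comp_subproof g f).

Definition nid F : nat_trans F F := @NatTrans B F F (fun M => lid (F M)) (fun _ _ _ _ => erefl).

End NaturalTransformations.

Section Generation.
Variables (B : binomialRingType) (n : nat).
Notation Bn := ('cV[B]_n : vectType B).

(* A sum of more than n terms is grouped into n+1 nonempty blocks; as the deviation
   of order n+1 vanishes, phi of it is a combination of phi of shorter sums. *)
Lemma degree_span (U W : lmodType B) (phi : U -> W) m (x : 'I_m -> U) (P : W -> Prop) :
  (forall y : 'I_n.+1 -> U, deviation phi y = 0) ->
  P 0 -> (forall a w w', P w -> P w' -> P (a *: w + w')) ->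
  (forall J : {set 'I_m}, (#|J| <= n)%N -> P (phi (\sum_(i in J) x i))) ->
  forall I : {set 'I_m}, P (phi (\sum_(i in I) x i)).
Proof.
move=> dev P0 Pl Psmall I; have [k] := ubnP #|I|; elim: k I => // k IHk I; rewrite ltnS => Ik.
have [|nI] := leqP #|I| n; first exact: Psmall.
(* The first n + 1 elements of I get a block each, and [inord] defaults to block 0 for the others;
   so no block is empty. *)
pose b (i : 'I_m) : 'I_n.+1 := inord (index i (enum I)).
pose y (j : 'I_n.+1) := \sum_(i in I | b i == j) x i.
have yE (K : {set 'I_n.+1}) : \sum_(j in K) y j = \sum_(i in I :&: [set i | b i \in K]) x i.
  rewrite (partition_big b (mem K)) => [|i]; last by rewrite !inE => /andP[].
  apply: eq_bigr => j jK; apply: eq_bigl => i; rewrite !inE.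
  by case: eqP => [->|]; rewrite ?andbF ?andbT ?jK ?andbT.
have := dev y; rewrite /deviation (bigD1 setT) //= yE.
have -> : I :&: [set i | b i \in [set: 'I_n.+1]] = I.
  by apply/setP => i; rewrite !inE andbT.
rewrite cardsT card_ord subnn scale1r => /eqP; rewrite addr_eq0 => /eqP ->.
rewrite -scaleN1r -[_ *: _]addr0; apply: (Pl) (P0); elim/big_rec: _ => [//|K w KT Pw].
apply: (Pl) Pw; rewrite yE; apply: IHk; apply: leq_trans Ik.
(* A proper K misses some block j, hence the j-th element of I, and the sum over K is shorter. *)
have /subsetPn[j _ jK] : ~~ ([set: 'I_n.+1] \subset K) by rewrite subTset.
have jI : (j < size (enum I))%N by rewrite -cardE (leq_trans (ltn_ord j)).
have [i0 _] : exists i : 'I_m, true.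
  by case: (enum I) jI => // i; exists i.
apply/proper_card/properP; split; first exact: subsetIl.
exists (nth i0 (enum I) j); first by rewrite -mem_enum mem_nth.
by rewrite !inE /b index_uniq ?enum_uniq // inord_val negb_and jK orbT.
Qed.

(** The coordinates in J, in the order of [enum J], become the first entries of a column. The inner
    sum has at most one term; nothing is lost as long as J has at most n elements. *)
Definition factor_out (M : vectType B) (J : {set 'I_(dim M)}) (x : M) : Bn :=
  \col_k \sum_(i in J | index i (enum J) == k) crd i x.
Definition factor_in (M : vectType B) (J : {set 'I_(dim M)}) (y : Bn) : M :=
  \sum_(i in J) (\sum_(k < n | index i (enum J) == k) y k 0) *: bvec i.

Lemma factor_out_linear M J : linear (@factor_out M J).
Proof.
move=> a x y; apply/matrixP => k j; rewrite !mxE mulr_sumr -big_split.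
by apply: eq_bigr => i _; rewrite linearP.
Qed.
Lemma factor_in_linear M J : linear (@factor_in M J).
Proof.
move=> a x y; rewrite /factor_in scaler_sumr -big_split; apply: eq_bigr => i _.
rewrite /= scalerA -scalerDl mulr_sumr -big_split; congr (_ *: _).
by apply: eq_bigr => k _; rewrite !mxE.
Qed.

Definition diag_proj (M : vectType B) (i : 'I_(dim M)) : 'Hom(M, M) :=
  linfun (mklin (U := M) (V := M) (f := fun x => crd i x *: bvec i)
    (fun a x y => etrans (congr1 (fun c => c *: bvec i) (linearP _ a x y))
       (etrans (scalerDl _ _ _) (congr1 (fun c => c + _) (esym (scalerA _ _ _)))))).

Lemma factorization (M : vectType B) (J : {set 'I_(dim M)}) : (#|J| <= n)%N ->
  exists (g : 'Hom(Bn, M)) (f : 'Hom(M, Bn)), \sum_(i in J) diag_proj i = (g \o f)%VF.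
Proof.
move=> Jn; exists (linfun (mklin (factor_in_linear J))), (linfun (mklin (factor_out_linear J))).
apply/lfunP => x; rewrite comp_lfunE !lfunE /= /factor_in sum_lfunE.
apply: eq_bigr => i iJ; rewrite lfunE /=; congr (_ *: _).
have ij : (index i (enum J) < n)%N.
  by apply: leq_trans Jn; rewrite cardE index_mem mem_enum.
rewrite (big_pred1 (Ordinal ij)) => [|k]; last by rewrite /= -val_eqE /= eq_sym.
rewrite mxE (big_pred1 i) // => j /=; apply/andP/eqP => [[jJ /eqP e]|->]; last by [].
by rewrite -(nth_index i (s := enum J) (x := j)) ?mem_enum // e nth_index ?mem_enum.
Qed.

(** The identity of M is the sum of its coordinate projections; by [degree_span] only sums of at
    most n of them matter, and [factorization] splits these through B^n. *)
Lemma numerical_span (H : modFunctor B) (M : vectType B) : numerical n H ->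
  exists s : seq (B * 'Hom(Bn, M) * 'Hom(M, Bn)),
    forall x, x = \sum_(q <- s) q.1.1 *: fmap H q.1.2 (fmap H q.2 x).
Proof.
case=> dev _.
pose P (w : lhom (H M) (H M)) := exists s : seq (B * 'Hom(Bn, M) * 'Hom(M, Bn)),
    forall x, w x = \sum_(q <- s) q.1.1 *: fmap H q.1.2 (fmap H q.2 x).
suff [s sx] : P (fmap H (\sum_(i in [set: 'I_(dim M)]) diag_proj i)).
  exists s => x; rewrite -sx; have -> : \sum_(i in [set: 'I_(dim M)]) diag_proj i = \1%VF.
    apply/lfunP => y; rewrite sum_lfunE id_lfunE {2}[y]crd_sum; apply: eq_big => i.
      by rewrite inE.
    by rewrite lfunE.
  by rewrite fmap_id.
apply: (degree_span (phi := @fmap B H M M)) => [y|||J /factorization[g [f ->]]].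
- exact: dev.
- by exists [::] => x; rewrite big_nil.
- move=> a w w' [s sx] [s' sx'].
  exists ([seq (a * q.1.1, q.1.2, q.2) | q <- s] ++ s') => x.
  rewrite big_cat big_map /= -sx' sx scaler_sumr; congr (_ + _).
  by apply: eq_bigr => q _; rewrite scalerA.
- by exists [:: (1, g, f)] => x; rewrite big_seq1 scale1r fmap_comp.
Qed.

End Generation.

(** * Testing and constructing natural maps at B^n *)

Section Evaluation.
Variables (B : binomialRingType) (n : nat).
Notation Bn := ('cV[B]_n : vectType B).
Implicit Types (F G : modFunctor B) (H K : strictFunctor B) (M N P : vectType B).

Lemma fmap_compE F M N P (g : 'Hom(N, P)) (f : 'Hom(M, N)) x :
  fmap F g (fmap F f x) = fmap F (g \o f)%VF x.
Proof. by rewrite fmap_comp. Qed.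

Lemma separated_at_Bn F M (x : F M) : numerical n F ->
  (forall f : 'Hom(M, Bn), fmap F f x = 0) -> x = 0.
Proof.
move=> nF e; have [s sx] := numerical_span M nF; rewrite (sx x).
by apply: big1 => q _; rewrite e linear0 scaler0.
Qed.

Lemma natural_ext F G (h h' : nat_trans F G) : numerical n F ->
  (forall x, h Bn x = h' Bn x) -> forall M x, h M x = h' M x.
Proof.
move=> nF e M x; have [s sx] := numerical_span M nF.
rewrite (sx x) !linear_sum; apply: eq_bigr => q _.
by rewrite !linearZ_LR [h M _]nt_natural [h' M _]nt_natural e.
Qed.

Lemma injective_at_Bn F G (h : nat_trans F G) : numerical n F ->
  injective (h Bn) -> forall M, injective (h M).
Proof.
move=> nF hi M x y exy; apply/eqP; rewrite -subr_eq0; apply/eqP.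
apply: separated_at_Bn nF _ => f; apply: hi.
by rewrite nt_natural !linearB /= exy subrr !linear0.
Qed.

Lemma surjective_at_Bn F G (h : nat_trans F G) : numerical n G ->
  (forall y, exists x, h Bn x = y) -> forall M y, exists x, h M x = y.
Proof.
move=> nG hs M y; have [s sy] := numerical_span M nG.
pose l z := sval (cid (hs z)); have hl z : h Bn (l z) = z by rewrite /l; case: cid.
exists (\sum_(q <- s) q.1.1 *: fmap F q.1.2 (l (fmap G q.2 y))).
rewrite [RHS]sy linear_sum; apply: eq_bigr => q _.
by rewrite linearZ_LR nt_natural hl.
Qed.

Lemma kernel_at_Bn F G K (i : nat_trans F G) (p : nat_trans G K) :
  numerical n F -> numerical n G ->
  (forall x, p Bn x = 0 <-> exists y, i Bn y = x) ->
  forall M x, p M x = 0 <-> exists y, i M y = x.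
Proof.
move=> nF nG ip M x; split=> [px|[y <-]].
  have [s sx] := numerical_span M nG.
  have l q : exists y, i Bn y = fmap G q x by apply/ip; rewrite nt_natural px linear0.
  pose y q := sval (cid (l q)); have iy q : i Bn (y q) = fmap G q x.
    by rewrite /y; case: cid.
  exists (\sum_(q <- s) q.1.1 *: fmap F q.1.2 (y q.2)).
  rewrite [RHS]sx linear_sum; apply: eq_bigr => q _.
  by rewrite linearZ_LR nt_natural iy.
have [s sy] := numerical_span M nF; rewrite (sy y) !linear_sum big1 // => q _.
rewrite !linearZ_LR 2!nt_natural; have -> := (ip (i Bn (fmap F q.2 y))).2.
  by rewrite linear0 scaler0.
by exists (fmap F q.2 y).
Qed.

(** The image of x in F(M) is the y in G(M) whose images under all f : M -> B^n are prescribed by e.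
    Such a y is written down by spanning F(M) from B^n, and maps to B^n separate G(M). *)
Lemma extend_from_Bn F G (e : lhom (F Bn) (G Bn)) : numerical n F -> numerical n G ->
  (forall (m : 'Hom(Bn, Bn)) x, e (fmap F m x) = fmap G m (e x)) ->
  exists h : nat_trans F G, forall x, h Bn x = e x.
Proof.
move=> nF nG em.
have [||||h [hr _]] := @natural_rel B F G
  (fun M x y => forall f : 'Hom(M, Bn), e (fmap F f x) = fmap G f y).
- move=> M x; have [s sx] := numerical_span M nF.
  exists (\sum_(q <- s) q.1.1 *: fmap G q.1.2 (e (fmap F q.2 x))) => f.
  rewrite {1}[x]sx !linear_sum; apply: eq_bigr => q _.
  by rewrite !linearZ_LR [fmap F f _]fmap_compE em [fmap G f _]fmap_compE.
- by move=> M a x y x' y' h h' f; rewrite !linearP /= h h'.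
- by move=> M y h; apply: separated_at_Bn nG _ => f; rewrite -h !linear0.
- by move=> M N f x y h g; rewrite !fmap_compE h.
exists h => x; have := hr Bn x \1%VF.
by rewrite !fmap_id.
Qed.

(** Separating K(N) by maps f : N -> B^n and spanning H(M) by maps g : B^n -> M replaces t by f^[n]
    t g^[n], an element of S. *)
Lemma strict_natural_at_Bn H K (h : nat_trans H K) :
  homogeneous n H -> homogeneous n K ->
  (forall (s : schur B n) x, h Bn (theta H s x) = theta K s (h Bn x)) ->
  strict_natural h.
Proof.
move=> hH hK hs; apply/(strict_naturalP hH hK) => M N t x.
have nH := homogeneous_numerical hH; have nK := homogeneous_numerical hK.
apply/eqP; rewrite -subr_eq0; apply/eqP/(separated_at_Bn nK) => f.
rewrite linearB -nt_natural -(theta_pow hH) -(theta_pow hK) -!theta_comp //.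
have [s sx] := numerical_span M nH; rewrite (sx x) !linear_sum -big_split big1 // => q _ /=.
rewrite [h M _]linearZ_LR ![theta _ _ (_ *: _)]linearZ_LR [h _ (_ *: _)]linearZ_LR.
rewrite -scalerBr [h M _]nt_natural -(theta_pow hH q.1.2) -(theta_pow hK q.1.2).
by rewrite -!theta_comp // hs subrr scaler0.
Qed.

Lemma extend_schur H K (e : lhom (H Bn) (K Bn)) :
  homogeneous n H -> homogeneous n K ->
  (forall (s : schur B n) x, e (theta H s x) = theta K s (e x)) ->
  exists h : nat_trans H K, strict_natural h /\ forall x, h Bn x = e x.
Proof.
move=> hH hK es.
have [m x|h he] := @extend_from_Bn H K e (homogeneous_numerical hH) (homogeneous_numerical hK).
  by rewrite -(theta_pow hH) -(theta_pow hK).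
exists h; split=> //.
by apply: strict_natural_at_Bn => // s x; rewrite !he.
Qed.

Section SchurModule.
Variables (X : lmodType B) (act : schur B n -> lhom X X).
Hypothesis act_linear : linear act.
Hypothesis act1 : forall x, act (gpow n \1%VF) x = x.
Hypothesis act_comp : forall s t x, act (gcomp s t) x = act s (act t x).

Fact coind_closed M a (phi psi : lhom (gam n 'Hom(M, Bn)) X) :
  (forall s t, phi (gcomp s t) = act s (phi t)) ->
  (forall s t, psi (gcomp s t) = act s (psi t)) ->
  forall s t, (a *: phi + psi) (gcomp s t) = act s ((a *: phi + psi) t).
Proof. by move=> hp hq s t; rewrite !lhomDE !lhomZE hp hq linearP. Qed.

Definition coind M : submodule (lhom (gam n 'Hom(M, Bn)) X) :=
  @Submodule B _ (fun phi : lhom (gam n 'Hom(M, Bn)) X => forall s t, phi (gcomp s t) = act s (phi t))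
    (fun s t => esym (linear0 (act s))) (@coind_closed M).

Lemma coindP M (phi : smod (coind M)) s t :
  sinc _ phi (gcomp s t) = act s (sinc _ phi t).
Proof. exact: (sincP phi). Qed.

Definition coind_precomp M N (t : gam n 'Hom(M, N))
    (phi : lhom (gam n 'Hom(M, Bn)) X) : lhom (gam n 'Hom(N, Bn)) X :=
  lcomp phi (mklin (gcomp_linear_l t)).

Fact coind_precomp_mem M N (t : gam n 'Hom(M, N)) (phi : smod (coind M)) :
  coind N (coind_precomp t (sinc _ phi)).
Proof. by move=> s r; rewrite /= gcompA coindP. Qed.

Fact coind_act_linear M N (t : gam n 'Hom(M, N)) : linear (scorestr (coind_precomp_mem t)).
Proof. by apply: scorestr_linear => a f g; apply: lhomP. Qed.

Definition coind_act M N (t : gam n 'Hom(M, N)) : lhom (smod (coind M)) (smod (coind N)) :=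
  mklin (coind_act_linear t).

Lemma coind_actE M N (t : gam n 'Hom(M, N)) phi s :
  sinc _ (coind_act t phi) s = sinc _ phi (gcomp s t).
Proof. by []. Qed.

Lemma coind_ext M (phi psi : smod (coind M)) : sinc _ phi =1 sinc _ psi -> phi = psi.
Proof. by move=> e; apply/sinc_inj/lhomP. Qed.

Fact coind_act_linear2 M N : linear (@coind_act M N).
Proof.
move=> a t t'; apply: lhomP => phi; apply: coind_ext => s.
by rewrite coind_actE gcomp_linear_r linearP.
Qed.

Fact coind_act1 M phi : coind_act (gpow n (\1%VF : 'Hom(M, M))) phi = phi.
Proof. by apply: coind_ext => s; rewrite coind_actE gcomp1r. Qed.

Fact coind_act_comp M N P (t : gam n 'Hom(N, P)) (s : gam n 'Hom(M, N)) phi :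
  coind_act (gcomp t s) phi = coind_act t (coind_act s phi).
Proof. by apply: coind_ext => r; rewrite !coind_actE gcompA. Qed.

(* The functor M |-> Hom_S(Gamma^n Hom(M, B^n), X). *)
Lemma schur_module_functor : exists (H : strictFunctor B) (i : lhom (H Bn) X),
  [/\ homogeneous n H, bijective i
    & forall s x, i (theta H s x) = act s (i x)].
Proof.
pose H := astrict coind_act_linear2 coind_act1 coind_act_comp.
have li : linear (fun phi : H Bn => sinc (coind Bn) phi (gpow n \1%VF)).
  by move=> a phi psi; rewrite linearP.
exists H, (mklin li); split=> [||s x]; first exact: astrict_homogeneous.
  have lg x : linear (fun s => act s x) by move=> a s t; rewrite act_linear.
  have gS x : coind Bn (mklin (lg x)) by move=> s t; rewrite /= act_comp.
  (* Evaluation at the identity is inverted by x |-> (s |-> s x). *)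
  exists (fun x => smk (gS x)) => [phi|x]; last by rewrite /= act1.
  by apply: coind_ext => s; rewrite sinc_mk /= -coindP gcomp1r.
have -> : theta H s x = coind_act s x by rewrite /H theta_astrict.
transitivity (sinc (coind Bn) x (gcomp (gpow n \1%VF) s)); first by [].
by rewrite gcomp1l -[s in LHS]gcomp1r coindP.
Qed.

End SchurModule.
End Evaluation.

(** * Extensions of numerical functors *)

Section Quotients.
Local Open Scope quotient_scope.
Variables (R : comNzRingType) (V : lmodType R) (S : submodule V).

Lemma smemZ a x : S x -> S (a *: x).
Proof. by move=> Sx; rewrite -[_ *: _]addr0; apply: smem_linear Sx (smem0 S). Qed.
Lemma smemD x y : S x -> S y -> S (x + y).
Proof. by move=> Sx; rewrite -[x]scale1r; apply: smem_linear. Qed.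

Definition qequiv (x y : V) : bool := `[< S (x - y) >].

Fact qequiv_refl : reflexive qequiv.
Proof. by move=> x; apply/asboolP; rewrite subrr; apply: smem0. Qed.
Fact qequiv_sym x y : qequiv x y = qequiv y x.
Proof.
by apply/asboolP/asboolP => /(smemZ (-1)); rewrite scaleN1r opprB.
Qed.
Fact qequiv_trans : transitive qequiv.
Proof.
move=> y x z /asboolP xy /asboolP yz; apply/asboolP.
by have := smemD xy yz; rewrite addrA subrK.
Qed.

Canonical qequiv_rel := EquivRel qequiv qequiv_refl qequiv_sym qequiv_trans.

Definition qmod := {eq_quot qequiv}.
HB.instance Definition _ := Choice.on qmod.

Lemma qmodP (x y : V) : \pi_qmod x = \pi_qmod y <-> S (x - y).
Proof. by split=> [/eqmodP/asboolP|Sxy] //; apply/eqmodP/asboolP. Qed.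

Lemma qmod_repr (x : V) : S (repr (\pi_qmod x) - x).
Proof. by apply/qmodP; rewrite reprK. Qed.

Definition qadd (x y : qmod) : qmod := \pi_qmod (repr x + repr y).
Definition qscale a (x : qmod) : qmod := \pi_qmod (a *: repr x).

Lemma qaddE x y : qadd (\pi_qmod x) (\pi_qmod y) = \pi_qmod (x + y).
Proof.
apply/qmodP; rewrite opprD addrACA; apply: smemD; exact: qmod_repr.
Qed.
Lemma qscaleE a x : qscale a (\pi_qmod x) = \pi_qmod (a *: x).
Proof. by apply/qmodP; rewrite -scalerBr; apply/smemZ/qmod_repr. Qed.

Lemma qmodW (P : qmod -> Prop) : (forall x, P (\pi_qmod x)) -> forall x, P x.
Proof. by move=> h x; rewrite -[x]reprK. Qed.

Fact qaddA : associative qadd.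
Proof.
by elim/qmodW => x; elim/qmodW => y; elim/qmodW => z; rewrite !qaddE addrA.
Qed.
Fact qaddC : commutative qadd.
Proof. by elim/qmodW => x; elim/qmodW => y; rewrite !qaddE addrC. Qed.
Fact qadd0 : left_id (\pi_qmod 0) qadd.
Proof. by elim/qmodW => x; rewrite !qaddE add0r. Qed.
Fact qaddN : left_inverse (\pi_qmod 0) (qscale (-1)) qadd.
Proof. by elim/qmodW => x; rewrite qscaleE qaddE scaleN1r addNr. Qed.

HB.instance Definition _ := GRing.isZmodule.Build qmod qaddA qaddC qadd0 qaddN.

Fact qscaleA a b x : qscale a (qscale b x) = qscale (a * b) x.
Proof. by elim/qmodW: x => x; rewrite !qscaleE scalerA. Qed.
Fact qscale1 : left_id 1 qscale.
Proof. by elim/qmodW => x; rewrite qscaleE scale1r. Qed.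
Fact qscaleDr : right_distributive qscale +%R.
Proof.
move=> a; elim/qmodW => x; elim/qmodW => y.
by rewrite -[_ + _]/(qadd _ _) -[RHS]/(qadd _ _) qaddE !qscaleE qaddE scalerDr.
Qed.
Fact qscaleDl x : {morph qscale^~ x : a b / a + b}.
Proof.
by elim/qmodW: x => x a b; rewrite -[RHS]/(qadd _ _) !qscaleE qaddE scalerDl.
Qed.

HB.instance Definition _ :=
  GRing.Zmodule_isLmodule.Build R qmod qscaleA qscale1 qscaleDr qscaleDl.

Fact qproj_linear : linear (\pi_qmod : V -> qmod).
Proof.
move=> a x y; rewrite -[RHS]/(qadd (qscale a _) _).
by rewrite qscaleE qaddE.
Qed.
Definition qproj : lhom V qmod := mklin qproj_linear.

Lemma qproj0 x : qproj x = 0 <-> S x.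
Proof. by rewrite -[0]/(\pi_qmod 0) /= qmodP subr0. Qed.

Lemma qproj_surj (y : qmod) : exists x, qproj x = y.
Proof. by exists (repr y); rewrite /= reprK. Qed.

Lemma qlift (W : lmodType R) (f : lhom V W) : (forall x, S x -> f x = 0) ->
  exists g : lhom qmod W, forall x, g (qproj x) = f x.
Proof.
move=> fS; have [|||g [_ gr]] := @linear_rel R qmod W
    (fun y z => exists2 x, qproj x = y & f x = z).
- by move=> y; have [x xy] := qproj_surj y; exists (f x), x.
- move=> a y z y' z' [x <- <-] [x' <- <-]; exists (a *: x + x'); by rewrite linearP.
- by move=> z [x /qproj0 Sx <-]; apply: fS.
by exists g => x; apply: gr; exists x.
Qed.

End Quotients.

(** * Sums, subfunctors and quotients of functors *)

Section FunctorConstructions.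
Variable B : binomialRingType.
Implicit Types (F G : modFunctor B) (M N P : vectType B).

Lemma natural_deviation F G (h : nat_trans F G) M N k (f : 'I_k -> 'Hom(M, N)) x :
  h N (deviation (@fmap B F M N) f x) = deviation (@fmap B G M N) f (h M x).
Proof.
rewrite /deviation.
have E (K : modFunctor B) z : (\sum_(I : {set 'I_k}) (- 1) ^+ (k - #|I|) *:
    fmap K (\sum_(i in I) f i)) z =
    \sum_(I : {set 'I_k}) (- 1) ^+ (k - #|I|) *: fmap K (\sum_(i in I) f i) z.
  have le : linear (fun g : lhom (K M) (K N) => g z) by [].
  by rewrite (lin_sum le).
rewrite !E linear_sum; apply: eq_bigr => I _.
by rewrite linearZ_LR nt_natural.
Qed.

Lemma lhom_sumE (U V : lmodType B) I r (P : pred I) (f : I -> lhom U V) x :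
  (\sum_(i <- r | P i) f i) x = \sum_(i <- r | P i) f i x.
Proof.
have le : linear (fun g : lhom U V => g x) by [].
by rewrite (lin_sum le).
Qed.

Lemma numerical_pointwise n F :
  numerical n F <->
  (forall M N (f : 'I_n.+1 -> 'Hom(M, N)) x, deviation (@fmap B F M N) f x = 0) /\
  (forall M N r (f : 'Hom(M, N)) x, fmap F (r *: f) x =
     \sum_(k < n.+1) binr r k *: deviation (@fmap B F M N) (fun _ : 'I_k => f) x).
Proof.
split=> [[d b]|[d b]]; split=> [M N f|M N r f].
- by move=> x; rewrite d.
- by move=> x; rewrite b lhom_sumE.
- by apply: lhomP => x; rewrite d.
- by apply: lhomP => x; rewrite b lhom_sumE.
Qed.

Lemma numerical_sub n F G (h : nat_trans F G) :
  (forall M, injective (h M)) -> numerical n G -> numerical n F.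
Proof.
move=> hi /numerical_pointwise [d b]; apply/numerical_pointwise; split=> [M N f x|M N r f x].
  by apply: hi; rewrite natural_deviation d linear0.
apply: hi; rewrite nt_natural b linear_sum; apply: eq_bigr => k _.
by rewrite linearZ_LR natural_deviation.
Qed.

Lemma numerical_quotient n F G (h : nat_trans F G) :
  (forall M y, exists x, h M x = y) -> numerical n F -> numerical n G.
Proof.
move=> hs /numerical_pointwise [d b]; apply/numerical_pointwise; split=> [M N f y|M N r f y].
  by have [x <-] := hs M y; rewrite -natural_deviation d linear0.
have [x <-] := hs M y; rewrite -nt_natural b linear_sum; apply: eq_bigr => k _.
by rewrite linearZ_LR natural_deviation.
Qed.

Section Sum.
Variables F G : modFunctor B.
Definition sum_ob M : lmodType B := (F M * G M)%type.
Fact sum_map_linear M N (f : 'Hom(M, N)) :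
  linear (fun x : sum_ob M => (fmap F f x.1, fmap G f x.2) : sum_ob N).
Proof. by move=> a x y; congr (_, _); rewrite linearP. Qed.
Definition sum_map M N (f : 'Hom(M, N)) : lhom (sum_ob M) (sum_ob N) :=
  mklin (sum_map_linear f).
Fact sum_map_id M : sum_map (\1%VF : 'Hom(M, M)) = lid (sum_ob M).
Proof. by apply: lhomP => -[x y]; rewrite /= !fmap_id. Qed.
Fact sum_map_comp M N P (g : 'Hom(N, P)) (f : 'Hom(M, N)) :
  sum_map (g \o f)%VF = lcomp (sum_map g) (sum_map f).
Proof. by apply: lhomP => -[x y]; rewrite /= !fmap_comp. Qed.
Definition fsum : modFunctor B := ModFunctor sum_map_id sum_map_comp.

Fact fsum_fst_linear M : linear (fun x : fsum M => x.1 : F M). Proof. by []. Qed.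
Fact fsum_snd_linear M : linear (fun x : fsum M => x.2 : G M). Proof. by []. Qed.
Definition fsum_fst : nat_trans fsum F :=
  @NatTrans B fsum F (fun M => mklin (@fsum_fst_linear M)) (fun _ _ _ _ => erefl).
Definition fsum_snd : nat_trans fsum G :=
  @NatTrans B fsum G (fun M => mklin (@fsum_snd_linear M)) (fun _ _ _ _ => erefl).

Lemma fsum_numerical n : numerical n F -> numerical n G -> numerical n fsum.
Proof.
move=> /numerical_pointwise [dF bF] /numerical_pointwise [dG bG].
have E M N k (f : 'I_k -> 'Hom(M, N)) (x : fsum M) : deviation (@fmap B fsum M N) f x =
    (deviation (@fmap B F M N) f x.1, deviation (@fmap B G M N) f x.2).
  rewrite [LHS]surjective_pairing; congr (_, _).
    exact: (natural_deviation fsum_fst).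
  exact: (natural_deviation fsum_snd).
apply/numerical_pointwise; split=> [M N f x|M N r f x]; first by rewrite E dF dG.
rewrite [LHS]surjective_pairing [RHS]surjective_pairing; congr (_, _).
  rewrite -[RHS]/(fsum_fst N _) linear_sum /= bF; apply: eq_bigr => k _.
  by rewrite /= E.
rewrite -[RHS]/(fsum_snd N _) linear_sum /= bG; apply: eq_bigr => k _.
by rewrite /= E.
Qed.
End Sum.

Section SubQuotient.
Variables (F : modFunctor B) (S : forall M, submodule (F M)).
Hypothesis S_stable : forall M N (f : 'Hom(M, N)) x, S M x -> S N (fmap F f x).

Fact sub_stable M N (f : 'Hom(M, N)) (x : smod (S M)) : S N (fmap F f (sinc _ x)).
Proof. exact/S_stable/sincP. Qed.
Fact sub_map_linear M N (f : 'Hom(M, N)) : linear (scorestr (sub_stable f)).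
Proof. by apply: scorestr_linear => a x y; rewrite !linearP. Qed.
Definition sub_map M N (f : 'Hom(M, N)) : lhom (smod (S M)) (smod (S N)) :=
  mklin (sub_map_linear f).
Fact sub_map_id M : sub_map (\1%VF : 'Hom(M, M)) = lid _.
Proof. by apply: lhomP => x; apply: sinc_inj; rewrite sinc_mk fmap_id. Qed.
Fact sub_map_comp M N P (g : 'Hom(N, P)) (f : 'Hom(M, N)) :
  sub_map (g \o f)%VF = lcomp (sub_map g) (sub_map f).
Proof. by apply: lhomP => x; apply: sinc_inj; rewrite sinc_mk fmap_comp. Qed.
Definition subfunctor : modFunctor B := ModFunctor sub_map_id sub_map_comp.
Definition sub_inc : nat_trans subfunctor F :=
  @NatTrans B subfunctor F (fun M => sinc (S M)) (fun _ _ _ _ => erefl).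

Lemma sub_inc_inj M : injective (sub_inc M).
Proof. exact: sinc_inj. Qed.

Fact quo_stable M N (f : 'Hom(M, N)) x : S M x -> lcomp (qproj (S N)) (fmap F f) x = 0.
Proof. by move=> Sx; apply/qproj0/S_stable. Qed.
Definition quo_map M N (f : 'Hom(M, N)) : lhom (qmod (S M)) (qmod (S N)) :=
  sval (cid (qlift (quo_stable f))).
Lemma quo_mapE M N (f : 'Hom(M, N)) x :
  quo_map f (qproj (S M) x) = qproj (S N) (fmap F f x).
Proof. by rewrite /quo_map; case: cid. Qed.
Fact quo_map_id M : quo_map (\1%VF : 'Hom(M, M)) = lid _.
Proof.
by apply: lhomP => y; have [x <-] := qproj_surj y; rewrite quo_mapE fmap_id.
Qed.
Fact quo_map_comp M N P (g : 'Hom(N, P)) (f : 'Hom(M, N)) :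
  quo_map (g \o f)%VF = lcomp (quo_map g) (quo_map f).
Proof.
apply: lhomP => y; have [x <-] := qproj_surj y.
by rewrite /= !quo_mapE fmap_comp.
Qed.
Definition quofunctor : modFunctor B := ModFunctor quo_map_id quo_map_comp.
Fact quo_proj_natural M N (f : 'Hom(M, N)) x :
  qproj (S N) (fmap F f x) = fmap quofunctor f (qproj (S M) x).
Proof. by rewrite [RHS]quo_mapE. Qed.
Definition quo_proj : nat_trans F quofunctor :=
  @NatTrans B F quofunctor (fun M => qproj (S M)) quo_proj_natural.

Lemma quo_proj_surj M y : exists x, quo_proj M x = y.
Proof. exact: qproj_surj. Qed.
Lemma quo_proj0 M x : quo_proj M x = 0 <-> S M x.
Proof. exact: qproj0. Qed.

End SubQuotient.
End FunctorConstructions.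

(** * Pullbacks and pushouts of extensions *)

Section NumericalExtensions.
Variables (B : binomialRingType) (n : nat).
Implicit Types (D E F G K : modFunctor B) (M N : vectType B).

Definition short_exact K E F (i : nat_trans K E) (p : nat_trans E F) : Prop :=
  [/\ forall M, injective (i M),
      forall M x, p M x = 0 <-> exists y, i M y = x
    & forall M z, exists x, p M x = z].

Notation numext F G := (@extension B (NumCat B n) F G).

Definition numext_of F G E (nE : numerical n E) (i : nat_trans G E) (p : nat_trans E F)
    (ex : short_exact i p) : numext F G :=
  @Extension B (NumCat B n) F G E nE i p I I (let: And3 ii _ _ := ex in ii)
    (let: And3 _ e _ := ex in e) (let: And3 _ _ ps := ex in ps).

Definition xmid F G (X : numext F G) : modFunctor B := emid X.
Definition xinj F G (X : numext F G) : nat_trans G (xmid X) := einj X.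
Definition xprj F G (X : numext F G) : nat_trans (xmid X) F := eprj X.

Lemma xmid_numerical F G (X : numext F G) : numerical n (xmid X).
Proof. exact: (emid_in X). Qed.

Lemma xexact F G (X : numext F G) : short_exact (xinj X) (xprj X).
Proof. split; [exact: (@einj_inj _ _ _ _ X)|exact: (@e_exact _ _ _ _ X)|exact: (@eprj_surj _ _ _ _ X)]. Qed.

Section ShortExact.
Variables (K E F : modFunctor B) (i : nat_trans K E) (p : nat_trans E F).
Hypothesis ex : short_exact i p.

Lemma se_inj M : injective (i M). Proof. by case: ex. Qed.
Lemma se_inj0 M y : i M y = 0 -> y = 0.
Proof. by move=> iy; apply: (@se_inj M); rewrite iy linear0. Qed.
Lemma se_prj_inj M y : p M (i M y) = 0.
Proof. by case: ex => _ e _; apply/e; exists y. Qed.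
Lemma se_ker M x : p M x = 0 -> exists y, i M y = x.
Proof. by case: ex => _ e _ /e. Qed.
Lemma se_surj M z : exists x, p M x = z.
Proof. by case: ex. Qed.
Lemma se_diff M x x' : p M x = p M x' -> exists y, x = x' + i M y.
Proof.
move=> e; have [|y iy] := @se_ker M (x - x'); first by rewrite linearB /= e subrr.
by exists y; rewrite iy addrC subrK.
Qed.

End ShortExact.

Lemma natural_factor D E F (q : nat_trans D E) (k : nat_trans D F) :
  (forall M y, exists x, q M x = y) -> (forall M x, q M x = 0 -> k M x = 0) ->
  exists h : nat_trans E F, forall M x, h M (q M x) = k M x.
Proof.
move=> qs qk; have [||||h [_ hr]] := @natural_rel B E F
    (fun M y z => exists2 x, q M x = y & k M x = z).
- by move=> M y; have [x xy] := qs M y; exists (k M x), x.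
- by move=> M a y z y' z' [x <- <-] [x' <- <-]; exists (a *: x + x'); rewrite linearP.
- by move=> M z [x qx <-]; apply: qk.
- by move=> M N f y z [x <- <-]; exists (fmap D f x); rewrite nt_natural.
by exists h => M x; apply: hr; exists x.
Qed.

Lemma natural_cofactor D G E (i : nat_trans G E) (k : nat_trans D E) :
  (forall M, injective (i M)) -> (forall M x, exists y, i M y = k M x) ->
  exists h : nat_trans D G, forall M x, i M (h M x) = k M x.
Proof.
move=> ii ik; have [||||h [hr _]] := @natural_rel B D G (fun M x y => i M y = k M x).
- exact: ik.
- by move=> M a y z y' z' e e'; rewrite !linearP e e'.
- by move=> M z; rewrite linear0 => iz; apply: ii; rewrite iz linear0.
- by move=> M N f y z e; rewrite !nt_natural e.
by exists h => M x; apply: hr.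
Qed.

(** Uniqueness of the pullback along psi: elements of A and A' correspond when they have the same
    images in E and in F'. *)
Lemma ext_eq_pullback F F' G E (i : nat_trans G E) (p : nat_trans E F)
    (A A' : numext F' G) (h : nat_trans (xmid A) E) (h' : nat_trans (xmid A') E)
    (psi : nat_trans F' F) :
  short_exact i p ->
  (forall M y, h M (xinj A M y) = i M y) -> (forall M x, p M (h M x) = psi M (xprj A M x)) ->
  (forall M y, h' M (xinj A' M y) = i M y) -> (forall M x, p M (h' M x) = psi M (xprj A' M x)) ->
  ext_eq A A'.
Proof.
move=> ex hi hp hi' hp'; have exA := xexact A; have exA' := xexact A'.
have [||||g [gr gu]] := @natural_rel B (xmid A) (xmid A')
    (fun M x x' => h M x = h' M x' /\ xprj A M x = xprj A' M x').
- move=> M x; have [x' px'] := se_surj exA' (xprj A M x).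
  have [|y hy] := @se_diff _ _ _ _ _ ex M (h M x) (h' M x').
    by rewrite hp hp' px'.
  exists (x' + xinj A' M y); rewrite !linearD /= hi' hy; split=> //.
  by rewrite (se_prj_inj exA') addr0.
- by move=> M a x y x' y' [e1 e2] [e1' e2']; rewrite !linearP /= e1 e2 e1' e2'.
- move=> M y; rewrite !linear0 => -[hy /esym /(se_ker exA') [z zy]].
  move: hy; rewrite -zy hi' => /esym /(se_inj0 ex) ->; exact: linear0.
- by move=> M N f x y [e1 e2]; rewrite !nt_natural e1 e2.
exists g; split=> // M x; last by have [_ <-] := gr M x.
apply: gu; split; first by rewrite hi hi'.
by rewrite (se_prj_inj exA) (se_prj_inj exA').
Qed.

(** Uniqueness of the pushout along eps: elements of A and A' correspond when one pair (e, y) from E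
    and G represents both. *)
Lemma ext_eq_pushout F G K E (i : nat_trans K E) (p : nat_trans E F)
    (A A' : numext F G) (k : nat_trans E (xmid A)) (k' : nat_trans E (xmid A'))
    (eps : nat_trans K G) :
  short_exact i p ->
  (forall M y, k M (i M y) = xinj A M (eps M y)) -> (forall M x, xprj A M (k M x) = p M x) ->
  (forall M y, k' M (i M y) = xinj A' M (eps M y)) -> (forall M x, xprj A' M (k' M x) = p M x) ->
  ext_eq A A'.
Proof.
move=> ex ki kp ki' kp'; have exA := xexact A; have exA' := xexact A'.
have [||||g [_ gu]] := @natural_rel B (xmid A) (xmid A')
    (fun M x x' => exists e y, x = k M e + xinj A M y /\ x' = k' M e + xinj A' M y).
- move=> M x; have [e pe] := se_surj ex (xprj A M x).
  have [|y hy] := @se_diff _ _ _ _ _ exA M x (k M e); first by rewrite kp pe.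
  by exists (k' M e + xinj A' M y), e, y.
- move=> M a x y x' y' [e [z [-> ->]]] [e' [z' [-> ->]]].
  exists (a *: e + e'), (a *: z + z'); rewrite !linearP /= !scalerDr.
  by split; rewrite addrACA.
(* If (e, y) represents 0 in A, then e comes from some r in K and y = - eps r; so it represents 0 in
   A' as well. *)
- move=> M x' [e [y [/esym ey ->]]].
  have pe : p M e = 0.
    by have := congr1 (xprj A M) ey; rewrite linear0 linearD /= (se_prj_inj exA) addr0 kp.
  have [r re] := se_ker ex pe; move: ey; rewrite -re ki ki' -!linearD /=.
  by move/(se_inj0 exA) => ->; rewrite linear0.
- move=> M N f x x' [e [y [-> ->]]]; exists (fmap E f e), (fmap G f y).
  by rewrite !nt_natural !linearD.
exists g; split=> // M.
  by move=> y; apply: gu; exists 0, y; rewrite !linear0 !add0r.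
move=> x; have [e pe] := se_surj ex (xprj A M x).
have [|y hy] := @se_diff _ _ _ _ _ exA M x (k M e); first by rewrite kp pe.
rewrite (gu M x (k' M e + xinj A' M y)); last by exists e, y.
by rewrite linearD /= (se_prj_inj exA') addr0 -[RHS]/(xprj A M x) -pe -kp'.
Qed.

(** The last clause provides lifts from compatible pairs; fibre products and sections of pullbacks
    are built from it. *)
Lemma ext_pullback F F' G (A : numext F G) (psi : nat_trans F' F) : numerical n F' ->
  exists (A' : numext F' G) (h : nat_trans (xmid A') (xmid A)),
    [/\ forall M y, h M (xinj A' M y) = xinj A M y,
        forall M x, xprj A M (h M x) = psi M (xprj A' M x)
      & forall M x z, xprj A M x = psi M z ->
          exists x', h M x' = x /\ xprj A' M x' = z].
Proof.
move=> nF'; have ex := xexact A.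
pose T := fsum (xmid A) F'.
have S0 M : xprj A M (0 : T M).1 = psi M (0 : T M).2 by rewrite !linear0.
have Sl M a (x y : T M) : xprj A M x.1 = psi M x.2 -> xprj A M y.1 = psi M y.2 ->
    xprj A M (a *: x + y).1 = psi M (a *: x + y).2.
  by move=> ex1 ey; rewrite !linearP /= ex1 ey.
pose S M : submodule (T M) := Submodule (S0 M) (Sl M).
have St M N (f : 'Hom(M, N)) x : S M x -> S N (fmap T f x).
  by rewrite /= !nt_natural => ->.
pose P := subfunctor St.
have nP : numerical n P.
  apply: (numerical_sub (@sub_inc_inj _ _ _ St)).
  exact: fsum_numerical (xmid_numerical A) nF'.
pose h : nat_trans P (xmid A) := ncomp (fsum_fst _ _) (sub_inc St).
pose p : nat_trans P F' := ncomp (fsum_snd _ _) (sub_inc St).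
have hp M x : xprj A M (h M x) = psi M (p M x) by apply: (sincP x).
have lift M x z : xprj A M x = psi M z -> exists x', h M x' = x /\ p M x' = z.
  by move=> xz; exists (smk (xz : S M (x, z))).
have li M : linear (fun y => (xinj A M y, 0) : T M).
  by move=> a x y; congr (_, _); rewrite /= ?linearP ?scaler0 ?addr0.
have Si M y : S M (mklin (li M) y) by rewrite /= (se_prj_inj ex) linear0.
have li' M : linear (scorestr (Si M)) by apply: scorestr_linear => a x y; rewrite linearP.
have ni M N (f : 'Hom(M, N)) y : mklin (li' N) (fmap G f y) = fmap P f (mklin (li' M) y).
  by apply: sinc_inj; rewrite /= nt_natural linear0.
pose i : nat_trans G P := @NatTrans B G P (fun M => mklin (li' M)) ni.
have pair_inj M (x x' : P M) : h M x = h M x' -> p M x = p M x' -> x = x'.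
  move=> e1 e2; apply: sinc_inj; rewrite [LHS]surjective_pairing [RHS]surjective_pairing.
  by congr (_, _).
have exP : short_exact i p.
  split=> [M y y' e|M x|M z].
  - by apply: (se_inj ex); have := congr1 (h M) e.
  - split=> [px|[y <-] //]; have [|y yx] := @se_ker _ _ _ _ _ ex M (h M x).
      by rewrite hp px linear0.
    by exists y; apply: pair_inj.
  have [x xz] := se_surj ex (psi M z).
  by have [x' [_ <-]] := lift M x z xz; exists x'.
by exists (numext_of nP exP), h.
Qed.

Lemma ext_pushout F G K E (i : nat_trans K E) (p : nat_trans E F) (eps : nat_trans K G) :
  short_exact i p -> numerical n E -> numerical n G ->
  exists (A : numext F G) (k : nat_trans E (xmid A)),
    (forall M y, k M (i M y) = xinj A M (eps M y)) /\
    (forall M x, xprj A M (k M x) = p M x).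
Proof.
move=> ex nE nG; pose T := fsum E G.
have S0 M : exists r, (0 : T M) = (i M r, - eps M r).
  by exists 0; rewrite !linear0 ?oppr0.
have Sl M a (x y : T M) : (exists r, x = (i M r, - eps M r)) ->
   (exists r, y = (i M r, - eps M r)) -> exists r, a *: x + y = (i M r, - eps M r).
  move=> [r ->] [s ->]; exists (a *: r + s); rewrite !linearP /=.
  by congr (_, _); rewrite scalerN opprD.
pose S M : submodule (T M) := Submodule (S0 M) (Sl M).
have St M N (f : 'Hom(M, N)) x : S M x -> S N (fmap T f x).
  by move=> [r ->]; exists (fmap K f r); congr (_, _); rewrite /= ?linearN nt_natural.
pose P := quofunctor St; pose q : nat_trans T P := quo_proj St.
have nP : numerical n P.
  exact: (numerical_quotient (h := q) (@quo_proj_surj _ _ _ St) (fsum_numerical nE nG)).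
have [|M x /quo_proj0 [r ->]|pp ppq] :=
    @natural_factor T P F q (ncomp p (fsum_fst E G)).
- exact: quo_proj_surj.
- exact: (se_prj_inj ex).
have lk M : linear (fun x => (x, 0) : T M).
  by move=> a x y; congr (_, _); rewrite /= ?scaler0 ?addr0.
have nk M N (f : 'Hom(M, N)) x : mklin (lk N) (fmap E f x) = fmap T f (mklin (lk M) x).
  by congr (_, _); rewrite /= linear0.
have lj M : linear (fun y => (0, y) : T M).
  by move=> a x y; congr (_, _); rewrite /= ?scaler0 ?addr0.
have nj M N (f : 'Hom(M, N)) y : mklin (lj N) (fmap G f y) = fmap T f (mklin (lj M) y).
  by congr (_, _); rewrite /= linear0.
pose k : nat_trans E P := ncomp q (@NatTrans B E T (fun M => mklin (lk M)) nk).
pose j : nat_trans G P := ncomp q (@NatTrans B G T (fun M => mklin (lj M)) nj).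
have kj M (x : T M) : q M x = k M x.1 + j M x.2.
  rewrite -[RHS]/(q M (x.1, 0) + q M (0, x.2)) -linearD; congr (q M _).
  by rewrite [LHS]surjective_pairing; congr (_, _); rewrite /= ?addr0 ?add0r.
have ki M r : k M (i M r) = j M (eps M r).
  apply/eqP; rewrite -subr_eq0 -linearN -[k _ _ + _](kj M (i M r, - eps M r)).
  by apply/eqP/quo_proj0; exists r.
have pk M x : pp M (k M x) = p M x by rewrite ppq.
have pj M y : pp M (j M y) = 0 by rewrite ppq /= linear0.
have exP : short_exact j pp.
  split=> [M y y' e|M z|M z].
  - have /quo_proj0 [r] : q M (0, y - y') = 0.
      by rewrite kj -[LHS]/(k M 0 + j M (y - y')) linear0 add0r linearB e subrr.
    case=> /esym /(se_inj0 ex) -> /eqP; rewrite linear0 oppr0 subr_eq0.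
    by move/eqP.
  - split=> [|[y <-] //]; have [x <-] := quo_proj_surj z.
    rewrite -/q ppq => px; have [r rx] := se_ker ex (px : p M x.1 = 0).
    by exists (eps M r + x.2); rewrite linearD kj -rx ki.
  by have [x <-] := se_surj ex z; exists (k M x).
by exists (numext_of nP exP), k.
Qed.

End NumericalExtensions.

(** * Baer sums and linear combinations of extensions *)

Section BaerSum.
Variables (B : binomialRingType) (n : nat).
Implicit Types (D E F G K P : modFunctor B) (M N : vectType B).
Notation numext F G := (@extension B (NumCat B n) F G).

Definition is_fiber F G (A1 A2 : numext F G) P (p1 : nat_trans P (xmid A1))
    (p2 : nat_trans P (xmid A2)) : Prop :=
  [/\ numerical n P, forall M x, xprj A1 M (p1 M x) = xprj A2 M (p2 M x)
    & forall M x1 x2, xprj A1 M x1 = xprj A2 M x2 ->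
        exists! x, p1 M x = x1 /\ p2 M x = x2].

Lemma fiber_product F G (A1 A2 : numext F G) :
  exists P (p1 : nat_trans P (xmid A1)) (p2 : nat_trans P (xmid A2)), is_fiber p1 p2.
Proof.
have [A [h [hi hp lift]]] := ext_pullback A1 (xprj A2) (xmid_numerical A2).
exists (xmid A), h, (xprj A); split=> // [|M x1 x2 /lift [x [hx px]]].
  exact: xmid_numerical.
exists x; split=> // y [hy py].
have [|g yg] := @se_diff _ _ _ _ _ _ (xexact A) M x y; first by rewrite px py.
rewrite yg; suff -> : g = 0 by rewrite linear0 addr0.
apply: (se_inj0 (xexact A1)); rewrite -hi; apply: (addrI (h M y)).
by rewrite -linearD -yg hx addr0 hy.
Qed.

Section Fiber.
Variables (F G : modFunctor B) (A1 A2 : numext F G) (P : modFunctor B).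
Variables (p1 : nat_trans P (xmid A1)) (p2 : nat_trans P (xmid A2)).
Hypothesis fP : is_fiber p1 p2.

Lemma fiber_eq M x : xprj A1 M (p1 M x) = xprj A2 M (p2 M x).
Proof. by case: fP. Qed.
Lemma fiber_lift M x1 x2 : xprj A1 M x1 = xprj A2 M x2 ->
  exists x, p1 M x = x1 /\ p2 M x = x2.
Proof. by case: fP => _ _ /[apply] -[x [e _]]; exists x. Qed.
Lemma fiber_ext M x y : p1 M x = p1 M y -> p2 M x = p2 M y -> x = y.
Proof.
move=> e1 e2; case: fP => _ _ /(_ M (p1 M y) (p2 M y) (fiber_eq y)) [z [_ zu]].
by rewrite -(zu x) // -(zu y).
Qed.

Lemma fiber_exact : exists i : nat_trans (fsum G G) P,
  [/\ forall M y, p1 M (i M y) = xinj A1 M y.1,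
      forall M y, p2 M (i M y) = xinj A2 M y.2
    & short_exact i (ncomp (xprj A1) p1)].
Proof.
have ex1 := xexact A1; have ex2 := xexact A2.
have [||||i [ir _]] := @natural_rel B (fsum G G) P
  (fun M y x => p1 M x = xinj A1 M y.1 /\ p2 M x = xinj A2 M y.2).
- move=> M y; have [|x [e1 e2]] := @fiber_lift M (xinj A1 M y.1) (xinj A2 M y.2).
    by rewrite (se_prj_inj ex1) (se_prj_inj ex2).
  by exists x.
- by move=> M a y x y' x' [e1 e2] [e1' e2']; rewrite !linearP /= e1 e2 e1' e2'.
- by move=> M x [e1 e2]; apply: fiber_ext; rewrite ?e1 ?e2 !linear0.
- by move=> M N f y x [e1 e2]; rewrite !nt_natural e1 e2 -!nt_natural.
exists i; split=> [M y|M y|]; try by case: (ir M y).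
split=> [M y y' e|M x|M z].
- have [e1 e2] := ir M y; have [e1' e2'] := ir M y'.
  rewrite [y]surjective_pairing [y']surjective_pairing; congr (_, _).
    by apply: (se_inj ex1); rewrite -e1 -e1' e.
  by apply: (se_inj ex2); rewrite -e2 -e2' e.
- split=> [px|[y <-]]; last by have [e1 _] := ir M y; rewrite /= e1 (se_prj_inj ex1).
  have [y1 e1] := se_ker ex1 px.
  have [|y2 e2] := @se_ker _ _ _ _ _ _ ex2 M (p2 M x); first by rewrite -fiber_eq.
  exists (y1, y2); have [e1' e2'] := ir M (y1, y2).
  by apply: fiber_ext; rewrite ?e1' ?e2' /=.
have [x1 e1] := se_surj ex1 z; have [x2 e2] := se_surj ex2 z.
have [|x [ex _]] := @fiber_lift M x1 x2; first by rewrite e1 e2.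
by exists x; rewrite /= ex.
Qed.

Lemma fiber_surj M z : exists x, xprj A1 M (p1 M x) = z.
Proof. by have [i [_ _ ex]] := fiber_exact; apply: (se_surj ex). Qed.

End Fiber.

(* The combination a [A1] + [A2] of extension classes. *)
Lemma ext_lin F G (A1 A2 : numext F G) (a : B) : numerical n G ->
  exists P (p1 : nat_trans P (xmid A1)) (p2 : nat_trans P (xmid A2))
    (A : numext F G) (q : nat_trans P (xmid A)),
  [/\ is_fiber p1 p2, forall M x, xprj A M (q M x) = xprj A1 M (p1 M x)
    & forall M x y1 y2, p1 M x = xinj A1 M y1 -> p2 M x = xinj A2 M y2 ->
        q M x = xinj A M (a *: y1 + y2)].
Proof.
move=> nG; have [P [p1 [p2 fP]]] := fiber_product A1 A2.
have [i [i1 i2 ex]] := fiber_exact fP.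
have le M : linear (fun y : fsum G G M => a *: y.1 + y.2 : G M).
  move=> b y y' /=; rewrite scalerDr addrACA !scalerDr !scalerA.
  by rewrite [a * b]mulrC.
have ne M N (f : 'Hom(M, N)) y : mklin (le N) (fmap (fsum G G) f y) = fmap G f (mklin (le M) y).
  by rewrite /= linearP.
have nP : numerical n P by case: fP.
have [A [q [qi qp]]] := ext_pushout (@NatTrans B (fsum G G) G (fun M => mklin (le M)) ne) ex nP nG.
exists P, p1, p2, A, q; split=> // M x y1 y2 e1 e2.
have -> : x = i M (y1, y2) by apply: (fiber_ext fP); rewrite ?i1 ?i2 /=.
by rewrite qi.
Qed.

(** A Baer sum can be recognized on any D that maps to the fibre product P and still covers F: then
    P is generated by the images of D and of G (+) G, and d determines the map from P. *)
Lemma ext_add_from F G (A1 A2 A : numext F G) D (d1 : nat_trans D (xmid A1))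
    (d2 : nat_trans D (xmid A2)) (d : nat_trans D (xmid A)) :
  (forall M x, xprj A2 M (d2 M x) = xprj A1 M (d1 M x)) ->
  (forall M x, xprj A M (d M x) = xprj A1 M (d1 M x)) ->
  (forall M z, exists x, xprj A1 M (d1 M x) = z) ->
  (forall M x y1 y2, d1 M x = xinj A1 M y1 -> d2 M x = xinj A2 M y2 ->
     d M x = xinj A M (y1 + y2)) ->
  ext_add A1 A2 A.
Proof.
move=> d12 d1d ds dadd; have [P [p1 [p2 fP]]] := fiber_product A1 A2.
have ex1 := xexact A1; have ex2 := xexact A2; have ex := xexact A.
have [||||q [qr qu]] := @natural_rel B P (xmid A) (fun M x z => exists w g1 g2,
  [/\ p1 M x = d1 M w + xinj A1 M g1, p2 M x = d2 M w + xinj A2 M g2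
    & z = d M w + xinj A M (g1 + g2)]).
- move=> M x; have [w wx] := ds M (xprj A1 M (p1 M x)).
  have [g1 e1] := se_diff ex1 (esym wx).
  have [|g2 e2] := @se_diff _ _ _ _ _ _ ex2 M (p2 M x) (d2 M w).
    by rewrite -(fiber_eq fP) -wx d12.
  by exists (d M w + xinj A M (g1 + g2)), w, g1, g2.
- move=> M a x z x' z' [w [g1 [g2 [e1 e2 ->]]]] [w' [g1' [g2' [e1' e2' ->]]]].
  exists (a *: w + w'), (a *: g1 + g1'), (a *: g2 + g2').
  rewrite !linearP /= e1 e1' e2 e2' !scalerDr; split; rewrite addrACA //.
  by rewrite [X in _ = _ + xinj A M X]addrACA -scalerDr linearP.
- move=> M z [w [g1 [g2 [/esym e1 /esym e2 ->]]]].
  rewrite !linear0 in e1 e2; move/eqP: e1; rewrite addr_eq0 -linearN => /eqP e1.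
  move/eqP: e2; rewrite addr_eq0 -linearN => /eqP e2.
  by rewrite (dadd _ _ _ _ e1 e2) -linearD -opprD addNr linear0.
- move=> M N f x z [w [g1 [g2 [e1 e2 ->]]]].
  exists (fmap D f w), (fmap G f g1), (fmap G f g2).
  by rewrite !nt_natural e1 e2 -linearD !linearD !nt_natural.
exists P, p1, p2, q; split; first by split=> //; case: fP.
split=> [M x|M x1 x2|M x|M x y1 y2 e1 e2].
- exact: (fiber_eq fP).
- by case: fP => _ _; apply.
- have [w [g1 [g2 [e1 e2 ->]]]] := qr M x.
  rewrite -[LHS]/(xprj A M _) -[RHS]/(xprj A1 M _) e1 !linearD /=.
  by rewrite !(se_prj_inj ex) (se_prj_inj ex1) !addr0 d1d.
have [w [g1 [g2 [e1' e2' ->]]]] := qr M x.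
have {}e1 : d1 M w = xinj A1 M (y1 - g1).
  by rewrite linearB /= -[xinj _ _ y1]e1 e1' addrK.
have {}e2 : d2 M w = xinj A2 M (y2 - g2).
  by rewrite linearB /= -[xinj _ _ y2]e2 e2' addrK.
by rewrite (dadd _ _ _ _ e1 e2) -linearD [y1 - g1 + _]addrACA -opprD subrK.
Qed.

Section AddMaps.
Variables (F' F G : modFunctor B) (A1 A2 A : numext F' G).
Hypothesis addA : ext_add A1 A2 A.

Lemma ext_addE : exists P (p1 : nat_trans P (xmid A1)) (p2 : nat_trans P (xmid A2))
    (q : nat_trans P (xmid A)),
  [/\ is_fiber p1 p2, forall M x, xprj A M (q M x) = xprj A1 M (p1 M x)
    & forall M x y1 y2, p1 M x = xinj A1 M y1 -> p2 M x = xinj A2 M y2 ->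
        q M x = xinj A M (y1 + y2)].
Proof.
by case: addA => P [p1 [p2 [q [[nP _ _ _] [e u qp qi]]]]]; exists P, p1, p2, q.
Qed.

Lemma ext_add_surj P (p1 : nat_trans P (xmid A1)) (p2 : nat_trans P (xmid A2))
    (q : nat_trans P (xmid A)) :
  is_fiber p1 p2 -> (forall M x, xprj A M (q M x) = xprj A1 M (p1 M x)) ->
  (forall M x y1 y2, p1 M x = xinj A1 M y1 -> p2 M x = xinj A2 M y2 ->
     q M x = xinj A M (y1 + y2)) ->
  forall M z, exists x, q M x = z.
Proof.
move=> fP qp qi M z; have ex := xexact A; have ex2 := xexact A2.
have [w wz] := fiber_surj fP (xprj A M z).
have [|g zg] := @se_diff _ _ _ _ _ _ ex M z (q M w); first by rewrite qp wz.
have [|w' [e1 e2]] := @fiber_lift _ _ _ _ _ _ _ fP M 0 (xinj A2 M g).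
  by rewrite linear0 (se_prj_inj ex2).
exists (w + w'); rewrite linearD zg; congr (_ + _).
by rewrite (qi _ _ 0 g) ?add0r // e1 linear0.
Qed.

(* Maps from A1 and A2 to one extension add up over the sum of the maps that they
   induce on the quotients. *)
Lemma ext_add_map E (i : nat_trans G E) (p : nat_trans E F)
    (psi1 psi2 psi : nat_trans F' F)
    (h1 : nat_trans (xmid A1) E) (h2 : nat_trans (xmid A2) E) :
  (forall M x, psi M x = psi1 M x + psi2 M x) ->
  (forall M y, h1 M (xinj A1 M y) = i M y) -> (forall M x, p M (h1 M x) = psi1 M (xprj A1 M x)) ->
  (forall M y, h2 M (xinj A2 M y) = i M y) -> (forall M x, p M (h2 M x) = psi2 M (xprj A2 M x)) ->
  exists h : nat_trans (xmid A) E,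
    (forall M y, h M (xinj A M y) = i M y) /\ (forall M x, p M (h M x) = psi M (xprj A M x)).
Proof.
move=> psiE i1 q1 i2 q2; have [P [p1 [p2 [q [fP qp qi]]]]] := ext_addE.
have ex := xexact A; have ex1 := xexact A1; have ex2 := xexact A2.
have qs := ext_add_surj fP qp qi.
have lk M : linear (fun x => h1 M (p1 M x) + h2 M (p2 M x)).
  by move=> a x y; rewrite !linearP addrACA -scalerDr.
have nk M N (f : 'Hom(M, N)) x : mklin (lk N) (fmap P f x) = fmap E f (mklin (lk M) x).
  by rewrite /= !nt_natural linearD.
pose k : nat_trans P E := @NatTrans B P E (fun M => mklin (lk M)) nk.
have ki M x : q M x = 0 -> k M x = 0.
  move=> qx; have p1x : xprj A1 M (p1 M x) = 0 by rewrite -qp qx linear0.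
  have [y1 e1] := se_ker ex1 p1x.
  have [|y2 e2] := @se_ker _ _ _ _ _ _ ex2 M (p2 M x); first by rewrite -(fiber_eq fP).
  move: qx; rewrite (qi _ _ _ _ (esym e1) (esym e2)) => /(se_inj0 ex) y12.
  by rewrite /= -e1 -e2 i1 i2 -linearD y12 linear0.
have [h hq] := natural_factor qs ki.
exists h; split=> [M y|M z].
  have [|w [e1 e2]] := @fiber_lift _ _ _ _ _ _ _ fP M 0 (xinj A2 M y).
    by rewrite linear0 (se_prj_inj ex2).
  have <- : q M w = xinj A M y by rewrite (qi _ _ 0 y) ?add0r // e1 linear0.
  by rewrite hq /= e1 e2 i2 linear0 add0r.
have [x <-] := qs M z.
by rewrite hq /= linearD /= q1 q2 psiE qp -(fiber_eq fP).
Qed.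

(** Additivity in the other variable: in [ext_add_map] the target is fixed and psi is a sum, here
    psi is fixed and the target is a Baer sum. *)
Lemma ext_add_map2 (E1 E2 E : numext F G) (psi : nat_trans F' F)
    (h1 : nat_trans (xmid A1) (xmid E1)) (h2 : nat_trans (xmid A2) (xmid E2)) :
  ext_add E1 E2 E ->
  (forall M y, h1 M (xinj A1 M y) = xinj E1 M y) ->
  (forall M x, xprj E1 M (h1 M x) = psi M (xprj A1 M x)) ->
  (forall M y, h2 M (xinj A2 M y) = xinj E2 M y) ->
  (forall M x, xprj E2 M (h2 M x) = psi M (xprj A2 M x)) ->
  exists h : nat_trans (xmid A) (xmid E),
    (forall M y, h M (xinj A M y) = xinj E M y) /\
    (forall M x, xprj E M (h M x) = psi M (xprj A M x)).
Proof.
move=> addE i1 q1 i2 q2; have [P [p1 [p2 [q [fP qp qi]]]]] := ext_addE.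
have [P' [p1' [p2' [q' [[nP' _ _ _] [e' u' qp' qi']]]]]] := addE.
have fP' : @is_fiber F G E1 E2 P' p1' p2' by split.
have ex := xexact A; have ex1 := xexact A1; have ex2 := xexact A2.
have qs := ext_add_surj fP qp qi.
have [||||h [_ hr]] := @natural_rel B (xmid A) (xmid E) (fun M z z' => exists w w',
  [/\ z = q M w, p1' M w' = h1 M (p1 M w), p2' M w' = h2 M (p2 M w) & z' = q' M w']).
- move=> M z; have [w <-] := qs M z.
  have [|w' [e1 e2]] := @fiber_lift _ _ _ _ _ _ _ fP' M (h1 M (p1 M w)) (h2 M (p2 M w)).
    by rewrite q1 q2 (fiber_eq fP).
  by exists (q' M w'), w, w'.
- move=> M a z z' y y' [w [w' [-> e1 e2 ->]]] [v [v' [-> f1 f2 ->]]].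
  by exists (a *: w + v), (a *: w' + v'); rewrite !linearP /= e1 e2 f1 f2.
- move=> M z' [w [w' [/esym qw e1 e2 ->]]].
  have p1w : xprj A1 M (p1 M w) = 0 by rewrite -qp qw linear0.
  have [y1 w1] := se_ker ex1 p1w.
  have [|y2 w2] := @se_ker _ _ _ _ _ _ ex2 M (p2 M w); first by rewrite -(fiber_eq fP).
  move: qw; rewrite (qi _ _ _ _ (esym w1) (esym w2)) => /(se_inj0 ex) y12.
  rewrite (qi' _ _ y1 y2) ?y12 ?linear0 //.
    by rewrite e1 -w1 i1.
  by rewrite e2 -w2 i2.
- move=> M N f z z' [w [w' [-> e1 e2 ->]]]; exists (fmap P f w), (fmap P' f w').
  by rewrite !nt_natural e1 e2.
exists h; split=> [M y|M z].
  have [|w [e1 e2]] := @fiber_lift _ _ _ _ _ _ _ fP M 0 (xinj A2 M y).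
    by rewrite linear0 (se_prj_inj ex2).
  have [|w' [f1 f2]] := @fiber_lift _ _ _ _ _ _ _ fP' M 0 (xinj E2 M y).
    by rewrite linear0 (se_prj_inj (xexact E2)).
  apply: hr; exists w, w'; split.
  - by rewrite (qi _ _ 0 y) ?add0r // e1 linear0.
  - by rewrite f1 e1 linear0.
  - by rewrite f2 e2 i2.
  - by rewrite (qi' _ _ 0 y) ?add0r // f1 linear0.
have [w <-] := qs M z.
have [|w' [f1 f2]] := @fiber_lift _ _ _ _ _ _ _ fP' M (h1 M (p1 M w)) (h2 M (p2 M w)).
  by rewrite q1 q2 (fiber_eq fP).
rewrite (hr M _ (q' M w')); last by exists w, w'.
by rewrite -[LHS]/(eprj E M _) qp' f1 -[LHS]/(xprj E1 M _) q1 qp.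
Qed.

End AddMaps.
End BaerSum.

(** * Extensions of Q by cocycles *)

Section Cocycles.
Variables (B : binomialRingType) (n : nat) (G : modFunctor B).
Hypothesis nG : numerical n G.
Implicit Types (M N : vectType B).
Notation numext F G := (@extension B (NumCat B n) F G).
Notation Bn := ('cV[B]_n : vectType B).
Notation Q := (Q B n).
Notation S := (schur B n).

Let nQ : numerical n Q := @Q_numerical B n.

Lemma ract_linear M (s : S) : linear (fun t : Q M => Qact t s).
Proof. exact: gcomp_linear_l. Qed.
Fact ract_natural (s : S) M N (f : 'Hom(M, N)) (t : Q M) :
  mklin (@ract_linear N s) (fmap Q f t) = fmap Q f (mklin (@ract_linear M s) t).
Proof. by rewrite !Qmap_gcomp; apply: gcompA. Qed.
Definition ract (s : S) : nat_trans Q Q :=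
  @NatTrans B Q Q (fun M => mklin (@ract_linear M s)) (@ract_natural s).
Lemma ractE (s : S) M (t : Q M) : ract s M t = gcomp t s.
Proof. by []. Qed.

(* A finite formal sum of terms b [m] s with m an endomorphism of B^n; these are
   all the relations that the module operations of the value at B^n impose. *)
Definition fsums := seq (B * 'Hom(Bn, Bn) * Q Bn).

Definition fval (F : modFunctor B) (sigma : Q Bn -> F Bn) (w : fsums) : F Bn :=
  \sum_(q <- w) q.1.1 *: fmap F q.1.2 (sigma q.2).

Definition fimg (w : fsums) : Q Bn := fval (F := Q) id w.

Definition fshift (s : S) (w : fsums) : fsums :=
  [seq (q.1, ract s Bn q.2) | q <- w].

Lemma fimg_shift s w : fimg (fshift s w) = ract s Bn (fimg w).
Proof.
rewrite /fimg /fval big_map linear_sum; apply: eq_bigr => q _.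
by rewrite linearZ_LR nt_natural.
Qed.

Lemma fval_shift (F : modFunctor B) (sigma : Q Bn -> F Bn) s w :
  fval sigma (fshift s w) = fval (fun t => sigma (ract s Bn t)) w.
Proof. by rewrite /fval big_map. Qed.

Definition coboundary (tau : Q Bn -> G Bn) (w : fsums) : G Bn :=
  fval tau w - tau (fimg w).

(* sigma is a set-theoretic section at B^n of the extension X of Q by G, and kappa
   measures its failure to respect the module operations. *)
Definition has_cocycle (X : numext Q G) (sigma : Q Bn -> xmid X Bn) (kappa : fsums -> G Bn) :=
  (forall t, xprj X Bn (sigma t) = t) /\
  forall w, fval sigma w = sigma (fimg w) + xinj X Bn (kappa w).

Lemma fval_prj (X : numext Q G) (sigma : Q Bn -> xmid X Bn) w :
  (forall t, xprj X Bn (sigma t) = t) -> xprj X Bn (fval sigma w) = fimg w.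
Proof.
move=> st; rewrite linear_sum; apply: eq_bigr => q _.
by rewrite linearZ_LR nt_natural st.
Qed.

Lemma cocycle_of_section (X : numext Q G) (sigma : Q Bn -> xmid X Bn) :
  (forall t, xprj X Bn (sigma t) = t) -> exists kappa, has_cocycle sigma kappa.
Proof.
move=> st.
have l w : exists y, fval sigma w = sigma (fimg w) + xinj X Bn y.
  by apply: (se_diff (xexact X)); rewrite fval_prj.
by exists (fun w => sval (cid (l w))); split=> // w; case: cid.
Qed.

Lemma section_exists (X : numext Q G) :
  exists sigma : Q Bn -> xmid X Bn, forall t, xprj X Bn (sigma t) = t.
Proof.
by exists (fun t => sval (cid (se_surj (xexact X) t))) => t; case: cid.
Qed.

Lemma fvalD (F K : modFunctor B) (sigma : Q Bn -> F Bn) (tau : Q Bn -> K Bn)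
    (h : nat_trans K F) w :
  fval (fun t => sigma t + h Bn (tau t)) w = fval sigma w + h Bn (fval tau w).
Proof.
rewrite /fval linear_sum -big_split; apply: eq_bigr => q _ /=.
by rewrite linearD scalerDr linearZ_LR nt_natural.
Qed.

Lemma cocycle_change (X : numext Q G) (sigma : Q Bn -> xmid X Bn) kappa tau :
  has_cocycle sigma kappa ->
  has_cocycle (fun t => sigma t + xinj X Bn (tau t)) (fun w => kappa w + coboundary tau w).
Proof.
move=> [st sk]; split=> [t|w].
  by rewrite linearD /= st (se_prj_inj (xexact X)) addr0.
rewrite fvalD sk -!addrA -!linearD; congr (_ + xinj X Bn _).
by rewrite /coboundary addrCA [tau _ + _]addrC subrK.
Qed.

Lemma cocycle_uniq (X : numext Q G) (sigma : Q Bn -> xmid X Bn) kappa kappa' :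
  has_cocycle sigma kappa -> has_cocycle sigma kappa' -> kappa = kappa'.
Proof.
move=> [_ k] [_ k']; apply/funext => w; apply: (se_inj (xexact X)).
by apply: (addrI (sigma (fimg w))); rewrite -k -k'.
Qed.

Lemma cocycle_diff (X : numext Q G) (sigma sigma' : Q Bn -> xmid X Bn) kappa kappa' :
  has_cocycle sigma kappa -> has_cocycle sigma' kappa' ->
  exists tau, kappa' = (fun w => kappa w + coboundary tau w).
Proof.
move=> h h'.
have l t : exists y, sigma' t = sigma t + xinj X Bn y.
  by apply: (se_diff (xexact X)); rewrite h.1 h'.1.
have [tau /funext e] := boolp.choice l; exists tau; apply: cocycle_uniq h' _.
by rewrite e; apply: cocycle_change.
Qed.

Lemma cocycle_pushforward (X X' : numext Q G) (h : nat_trans (xmid X) (xmid X'))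
    (sigma : Q Bn -> xmid X Bn) kappa :
  (forall M y, h M (xinj X M y) = xinj X' M y) ->
  (forall M x, xprj X' M (h M x) = xprj X M x) ->
  has_cocycle sigma kappa -> has_cocycle (fun t => h Bn (sigma t)) kappa.
Proof.
move=> hi hp [st sk]; split=> [t|w]; first by rewrite hp st.
rewrite -hi -linearD -sk linear_sum; apply: eq_bigr => q _.
by rewrite linearZ_LR nt_natural.
Qed.

(** Sections s1 and s2 lie over the same points of Q, so they combine to a section of the fibre
    product, whose image under q has the required cocycle. *)
Lemma cocycle_lin_from (X1 X2 X : numext Q G) s1 s2 k1 k2 (a : B) P
    (p1 : nat_trans P (xmid X1)) (p2 : nat_trans P (xmid X2)) (q : nat_trans P (xmid X)) :
  is_fiber p1 p2 -> (forall M x, xprj X M (q M x) = xprj X1 M (p1 M x)) ->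
  (forall M x y1 y2, p1 M x = xinj X1 M y1 -> p2 M x = xinj X2 M y2 ->
     q M x = xinj X M (a *: y1 + y2)) ->
  @has_cocycle X1 s1 k1 -> @has_cocycle X2 s2 k2 ->
  exists s, @has_cocycle X s (fun w => a *: k1 w + k2 w).
Proof.
move=> fP qp qi [s1t s1k] [s2t s2k].
have l t : exists x, p1 Bn x = s1 t /\ p2 Bn x = s2 t.
  by apply: (fiber_lift fP); rewrite s1t s2t.
pose rho t := sval (cid (l t)).
have r1 t : p1 Bn (rho t) = s1 t by rewrite /rho; case: cid => x [].
have r2 t : p2 Bn (rho t) = s2 t by rewrite /rho; case: cid => x [].
have fv (K : modFunctor B) (h : nat_trans P K) w : h Bn (fval rho w) = fval (fun t => h Bn (rho t)) w.
  by rewrite linear_sum; apply: eq_bigr => e _; rewrite linearZ_LR nt_natural.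
exists (fun t => q Bn (rho t)); split=> [t|w]; first by rewrite qp r1 s1t.
rewrite -fv; apply/eqP; rewrite addrC -subr_eq -linearB; apply/eqP.
have ext1 (K : modFunctor B) (f g : Q Bn -> K Bn) : f =1 g -> fval (F := K) f w = fval g w.
  by move=> /funext ->.
apply: qi; rewrite linearB fv ?r1 ?r2.
  by rewrite (ext1 _ _ _ r1) s1k addrC addKr.
by rewrite (ext1 _ _ _ r2) s2k addrC addKr.
Qed.

Lemma cocycle_lin (X1 X2 : numext Q G) s1 s2 k1 k2 (a : B) :
  @has_cocycle X1 s1 k1 -> @has_cocycle X2 s2 k2 ->
  exists (X : numext Q G) s, @has_cocycle X s (fun w => a *: k1 w + k2 w).
Proof.
move=> h1 h2; have [P [p1 [p2 [X [q [fP qp qi]]]]]] := ext_lin X1 X2 a nG.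
by exists X; apply: cocycle_lin_from fP qp qi h1 h2.
Qed.

Lemma cocycle0 : exists (X : numext Q G) s, @has_cocycle X s (fun=> 0).
Proof.
pose T := fsum G Q.
have li M : linear (fun y : G M => (y, 0) : T M).
  by move=> a x y; congr (_, _); rewrite /= scaler0 addr0.
have ni M N (f : 'Hom(M, N)) y : mklin (li N) (fmap G f y) = fmap T f (mklin (li M) y).
  by congr (_, _); rewrite linear0.
pose i : nat_trans G T := @NatTrans B G T (fun M => mklin (li M)) ni.
have ex : short_exact i (fsum_snd G Q).
  split=> [M y y' [] //|M x|M z]; last by exists (0, z).
  split=> [|[y <-] //]; case: x => y z /= ->; by exists y.
pose s (t : Q Bn) : T Bn := (0, t).
exists (numext_of (fsum_numerical nG nQ) ex), s; split=> // w.
rewrite linear0 addr0 [LHS]surjective_pairing; congr (_, _).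
  rewrite -[LHS]/(fsum_fst G Q Bn _) linear_sum big1 // => q _.
  by rewrite linearZ_LR nt_natural /= linear0 scaler0.
rewrite -[LHS]/(fsum_snd G Q Bn _) linear_sum; apply: eq_bigr => q _.
by rewrite linearZ_LR nt_natural.
Qed.

(** The extension is pulled back along right multiplication by s, and its section is chosen above
    sigma composed with that multiplication. *)
Lemma cocycle_shift (X : numext Q G) sigma kappa (s : S) :
  @has_cocycle X sigma kappa ->
  exists (X' : numext Q G) sigma', @has_cocycle X' sigma' (fun w => kappa (fshift s w)).
Proof.
move=> [st sk]; have [X' [h [hi hp lift]]] := ext_pullback X (ract s) nQ.
have l t : exists x, h Bn x = sigma (ract s Bn t) /\ xprj X' Bn x = t.
  by apply: lift; rewrite st.
pose sigma' t := sval (cid (l t)).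
have hs t : h Bn (sigma' t) = sigma (ract s Bn t) by rewrite /sigma'; case: cid => x [].
have ps t : xprj X' Bn (sigma' t) = t by rewrite /sigma'; case: cid => x [].
have [k [_ k']] := cocycle_of_section ps.
exists X', sigma'; split=> // w.
suff <- : k w = kappa (fshift s w) by [].
apply: (se_inj (xexact X)); apply: (addrI (sigma (fimg (fshift s w)))).
rewrite -sk fval_shift fimg_shift -hs -hi -linearD -k' linear_sum.
by apply: eq_bigr => q _; rewrite linearZ_LR nt_natural hs.
Qed.

(* An extension is determined by its cocycle, compatibly with the right action. *)
Lemma cocycle_compare (X X' : numext Q G) sigma sigma' kappa kappa' (s : S) :
  @has_cocycle X sigma kappa -> @has_cocycle X' sigma' kappa' ->
  (forall w, kappa' w = kappa (fshift s w)) -> pullback_along s X X'.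
Proof.
move=> [st sk] [st' sk'] kk; have ex := xexact X; have ex' := xexact X'.
have val2 (F : modFunctor B) (f : Q Bn -> F Bn) a t t' :
    fval f [:: (a, \1%VF, t); (1, \1%VF, t')] = a *: f t + f t'.
  by rewrite /fval !big_cons big_nil addr0 /= !fmap_id scale1r.
have val1 (F : modFunctor B) (f : Q Bn -> F Bn) m t : fval f [:: (1, m, t)] = fmap F m (f t).
  by rewrite /fval big_seq1 scale1r.
pose r (x' : xmid X' Bn) (x : xmid X Bn) := exists t y,
  x' = sigma' t + xinj X' Bn y /\ x = sigma (ract s Bn t) + xinj X Bn y.
(* The relation holds for whole formal sums because the cocycles agree on w. A two-term w then gives
   linearity of r, a one-term w its compatibility with endomorphisms of B^n. *)
have step w y : r (fval sigma' w + xinj X' Bn y)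
    (fval (fun t => sigma (ract s Bn t)) w + xinj X Bn y).
  exists (fimg w), (kappa' w + y); rewrite sk' -fval_shift sk kk fimg_shift.
  by rewrite !linearD !addrA.
have [|||e [er eu]] := @linear_rel B (xmid X' Bn) (xmid X Bn) r.
- move=> x'; have [|y xy] := @se_diff _ _ _ _ _ _ ex' Bn x' (sigma' (xprj X' Bn x')).
    by rewrite st'.
  by exists (sigma (ract s Bn (xprj X' Bn x')) + xinj X Bn y), (xprj X' Bn x'), y.
- move=> a x' x z' z [t [y [-> ->]]] [t' [y' [-> ->]]].
  have := step [:: (a, \1%VF, t); (1, \1%VF, t')] (a *: y + y').
  by rewrite !val2 !scalerDr !linearP [X in r X]addrACA [X in r _ X]addrACA.
- move=> x [t [y [/esym e0 ->]]].
  have t0 : t = 0.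
    by have := congr1 (xprj X' Bn) e0; rewrite linear0 linearD /= st' (se_prj_inj ex') addr0.
  (* A section need not send 0 to 0; the cocycle at the empty formal sum records its value there. *)
  have := sk' [::]; rewrite /fimg /fval !big_nil.
  rewrite -[X in X = _ -> _]e0 t0 => /(addrI (sigma' 0)) /(se_inj ex') ->.
  by rewrite linear0 kk; have := sk [::]; rewrite /fimg /fval !big_nil => <-.
have em (m : 'Hom(Bn, Bn)) x : e (fmap (xmid X') m x) = fmap (xmid X) m (e x).
  apply: eu; have [t [y [-> ->]]] := er x; rewrite !linearD -!nt_natural.
  by have := step [:: (1, m, t)] (fmap G m y); rewrite !val1.
have [h he] := extend_from_Bn (xmid_numerical X') (xmid_numerical X) em.
have hi : forall M y, ncomp h (xinj X') M y = xinj X M y.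
  apply: natural_ext nG _ => y; rewrite /= he; apply: eu.
  by have := step [::] y; rewrite /fval !big_nil !add0r.
have hp : forall M x, ncomp (xprj X) h M x = ncomp (ract s) (xprj X') M x.
  apply: natural_ext (xmid_numerical X') _ => x.
  rewrite -[LHS]/(xprj X Bn (h Bn x)) he; have [t [y [xE ->]]] := er x; rewrite xE.
  rewrite -[RHS]/(ract s Bn (xprj X' Bn _)) [xprj X Bn _]linearD [xprj X' Bn _]linearD.
  by rewrite st (se_prj_inj ex) st' (se_prj_inj ex') !addr0.
by exists h; split=> M x; [apply: hi|apply: hp].
Qed.

Lemma ract1 M (t : Q M) : ract (gpow n \1%VF) M t = t.
Proof. exact: gcomp1r. Qed.

Lemma fshift1 w : fshift (gpow n \1%VF) w = w.
Proof. by apply: map_id_in => -[[a m] t] _ /=; rewrite -[Qact _ _]/(ract _ _ _) ract1. Qed.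

Lemma fshift_comp s t w : fshift (gcomp s t) w = fshift t (fshift s w).
Proof.
rewrite /fshift -map_comp; apply: eq_map => -[[a m] u] /=.
by congr (_, _); rewrite -[LHS]gcompA.
Qed.

Lemma cocycle_ext_eq (X X' : numext Q G) sigma sigma' kappa :
  @has_cocycle X sigma kappa -> @has_cocycle X' sigma' kappa -> ext_eq X X'.
Proof.
move=> h h'; have [|g [gi gp]] := cocycle_compare (s := gpow n \1%VF) h' h.
  by move=> w; rewrite fshift1.
by exists g; split=> // M x; rewrite gp; apply: ract1.
Qed.

(** Being realized by an extension is taken as the definition. No cocycle identities are needed,
    only closure under the operations. *)
Definition is_cocycle (kappa : fsums -> G Bn) := exists (X : numext Q G) sigma,
  @has_cocycle X sigma kappa.

Fact is_cocycle_linear a k1 k2 : is_cocycle k1 -> is_cocycle k2 -> is_cocycle (a *: k1 + k2).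
Proof. by move=> [X1 [s1 h1]] [X2 [s2 h2]]; apply: cocycle_lin h1 h2. Qed.

Definition cocycles : submodule (fsums -> G Bn) :=
  Submodule (cocycle0 : is_cocycle 0) is_cocycle_linear.

Fact coboundary0 : exists tau, sinc cocycles 0 = coboundary tau.
Proof.
exists (fun=> 0); apply/funext => w; rewrite /coboundary subr0 /fval big1 // => q _.
by rewrite linear0 scaler0.
Qed.

Lemma coboundaryP a tau1 tau2 : coboundary (fun t => a *: tau1 t + tau2 t) =
  (fun w => a *: coboundary tau1 w + coboundary tau2 w).
Proof.
apply/funext => w; rewrite /coboundary scalerBr addrACA -opprD; congr (_ - _).
rewrite /fval scaler_sumr -big_split; apply: eq_bigr => q _ /=.
by rewrite linearP scalerDr !scalerA mulrC.
Qed.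

Fact coboundary_linear a k1 k2 :
  (exists tau, sinc cocycles k1 = coboundary tau) ->
  (exists tau, sinc cocycles k2 = coboundary tau) ->
  exists tau, sinc cocycles (a *: k1 + k2) = coboundary tau.
Proof.
move=> [t1 e1] [t2 e2]; exists (fun t => a *: t1 t + t2 t).
by rewrite coboundaryP linearP e1 e2.
Qed.

Definition coboundaries : submodule (smod cocycles) :=
  Submodule coboundary0 coboundary_linear.

Definition H1 := qmod coboundaries.

Definition cls : lhom (smod cocycles) H1 := qproj coboundaries.

Lemma clsP (k k' : smod cocycles) : cls k = cls k' <->
  exists tau, sinc _ k = (fun w => sinc _ k' w + coboundary tau w).
Proof.
split=> [e|[tau e]].
  have /qproj0[tau et] : cls (k - k') = 0 by rewrite linearB e subrr.
  exists tau; rewrite -et; apply/funext => w; rewrite linearB.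
  by rewrite -[X in _ = _ + X]/(sinc _ k w - sinc _ k' w) addrC subrK.
apply/eqP; rewrite -subr_eq0 -linearB; apply/eqP/qproj0; exists tau.
rewrite linearB e; apply/funext => w.
by rewrite -[LHS]/(sinc _ k' w + coboundary tau w - sinc _ k' w) addrC addKr.
Qed.

Fact shift_mem s (k : smod cocycles) : cocycles (sinc _ k \o fshift s).
Proof. by have [X [sigma h]] := sincP k; apply: cocycle_shift h. Qed.
Fact shift_linear s : linear (scorestr (shift_mem s)).
Proof. exact: scorestr_linear. Qed.
Definition shift s : lhom (smod cocycles) (smod cocycles) := mklin (shift_linear s).
Lemma shiftE s k w : sinc _ (shift s k) w = sinc _ k (fshift s w).
Proof. by []. Qed.

Fact shift_coboundary s (k : smod cocycles) : coboundaries k -> lcomp cls (shift s) k = 0.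
Proof.
move=> [tau e]; apply/qproj0; exists (fun t => tau (ract s Bn t)).
apply/funext => w; rewrite shiftE e /coboundary.
by rewrite fval_shift fimg_shift.
Qed.

Definition H1act (s : S) : lhom H1 H1 := sval (cid (qlift (@shift_coboundary s))).
Lemma H1actE s k : H1act s (cls k) = cls (shift s k).
Proof. by rewrite /H1act; case: cid. Qed.

Lemma clsW (P : H1 -> Prop) : (forall k, P (cls k)) -> forall c, P c.
Proof. by move=> h c; have [k <-] := qproj_surj c. Qed.

(** On cocycles the shift is not linear in s, since sigma is not linear. The failure tau of sigma
    along t (a s + s') gives the coboundary by which the two sides differ. *)
Lemma H1act_linear : linear H1act.
Proof.
move=> a s s'; apply: lhomP; elim/clsW => k.
rewrite -[RHS]/(a *: H1act s (cls k) + H1act s' (cls k)) !H1actE -linearP.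
apply/clsP; have [X [sigma [st sk]]] := sincP k; have ex := xexact X.
have l t : exists y, sigma (ract (a *: s + s') Bn t) =
    a *: sigma (ract s Bn t) + sigma (ract s' Bn t) + xinj X Bn y.
  apply: (se_diff ex); rewrite linearP /= !st.
  exact: gcomp_linear_r.
pose tau t := sval (cid (l t)).
have tauE t : sigma (ract (a *: s + s') Bn t) =
    (a *: sigma (ract s Bn t) + sigma (ract s' Bn t)) + xinj X Bn (tau t).
  by rewrite /tau; case: cid.
exists tau; apply/funext => w; rewrite linearP shiftE.
rewrite -[_ w in RHS]/(a *: sinc _ k (fshift s w) + sinc _ k (fshift s' w)).
apply: (se_inj ex); rewrite /coboundary !linearD linearN linearZ_LR.
have E u : xinj X Bn (sinc _ k (fshift u w)) =
    fval (fun t => sigma (ract u Bn t)) w - sigma (ract u Bn (fimg w)).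
  by rewrite -fval_shift sk fimg_shift addrC addKr.
rewrite !E tauE scalerBr.
have -> : fval (fun t => sigma (ract (a *: s + s') Bn t)) w =
   a *: fval (fun t => sigma (ract s Bn t)) w + fval (fun t => sigma (ract s' Bn t)) w +
   xinj X Bn (fval tau w).
  rewrite /fval scaler_sumr [xinj X Bn _]linear_sum -!big_split; apply: eq_bigr => q _ /=.
  rewrite tauE [fmap _ _ _]linearD [fmap _ _ (_ + _)]linearP !scalerDr.
  by rewrite [xinj X _ _ in RHS]linearZ_LR [xinj X _ (fmap _ _ _)]nt_natural !scalerA [a * _]mulrC.
by rewrite [X in _ = X + _]addrACA -opprD [RHS]addrACA -opprD.
Qed.

Lemma H1act1 c : H1act (gpow n \1%VF) c = c.
Proof.
elim/clsW: c => k; rewrite H1actE; congr (cls _); apply/sinc_inj/funext => w.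
by rewrite shiftE fshift1.
Qed.

Lemma H1act_comp s t c : H1act (gcomp s t) c = H1act s (H1act t c).
Proof.
elim/clsW: c => k; rewrite !H1actE; congr (cls _); apply/sinc_inj/funext => w.
by rewrite !shiftE fshift_comp.
Qed.

(** One extension is chosen per class and serves all cocycles of the class, since adding a
    coboundary only changes the section. *)
Lemma H1_ext : exists X : H1 -> numext Q G,
  forall c (k : smod cocycles), cls k = c -> exists sigma, @has_cocycle (X c) sigma (sinc _ k).
Proof.
have l c : exists X : numext Q G, forall k : smod cocycles, cls k = c ->
    exists sigma, @has_cocycle X sigma (sinc _ k).
  elim/clsW: c => k0; have [X [sigma h]] := sincP k0.
  exists X => k /clsP [tau ->]; exists (fun t => sigma t + xinj X Bn (tau t)).
  exact: cocycle_change.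
by have [X XP] := boolp.choice l; exists X.
Qed.

Lemma ExtQ_exists : inhabited (ExtQ n G).
Proof.
have [H [i [hH [j ij ji] iact]]] := schur_module_functor H1act_linear H1act1 H1act_comp.
have [X XP] := H1_ext; constructor.
apply: (@MkExtQ B n G H hH (@theta B n H Bn Bn) (theta_schur hH) (fun x => X (i x))).
- move=> x y [h [_ hi hp]]; apply: (can_inj ij).
  have [k kx] := qproj_surj (i x); have [k' ky] := qproj_surj (i y).
  rewrite -kx -ky; apply/esym/clsP.
  have [s hs] := XP _ _ kx; have [s' hs'] := XP _ _ ky.
  exact: cocycle_diff (cocycle_pushforward hi hp hs) hs'.
- move=> A; have [s /cocycle_of_section[k hk]] := section_exists A.
  have kc : cocycles k by exists A, s.
  exists (j (cls (smk kc))); have [|s' hs'] := XP (i (j (cls (smk kc)))) (smk kc).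
    by rewrite ji.
  exact: cocycle_ext_eq hs' hk.
- move=> x y; have [k kx] := qproj_surj (i x); have [k' ky] := qproj_surj (i y).
  have [s hs] := XP _ _ kx; have [s' hs'] := XP _ _ ky.
  have [|s'' hs''] := XP (i (x + y)) (k + k'); first by rewrite linearD [RHS]linearD kx ky.
  (* With coefficient 1 this is a Baer sum A; having the cocycle k + k', it can be replaced by the
     chosen extension of the class of x + y. *)
  have [P [p1 [p2 [A [q [fP qp qi]]]]]] := ext_lin (X (i x)) (X (i y)) 1 nG.
  have [t ht] := cocycle_lin_from fP qp qi hs hs'.
  have kk : (fun w => 1 *: sinc _ k w + sinc _ k' w) = sinc cocycles (k + k').
    by apply/funext => w; rewrite scale1r linearD.
  rewrite kk in ht; have [h [_ hi hp]] := cocycle_ext_eq ht hs''.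
  apply: (ext_add_from (d1 := p1) (d2 := p2) (d := ncomp h q)).
  - by move=> M z; rewrite (fiber_eq fP).
  - by move=> M z; rewrite /= -qp; apply: hp.
  - exact: (fiber_surj fP).
  - by move=> M z y1 y2 e1 e2; rewrite /= (qi _ _ _ _ e1 e2) hi scale1r.
move=> s x; have [k kx] := qproj_surj (i x); have [sg hs] := XP _ _ kx.
have [|sg' hs'] := XP (i (theta H s x)) (shift s k).
  by rewrite iact -kx H1actE.
exact: cocycle_compare hs hs' _.
Qed.

End Cocycles.

(** * The exact sequence *)

Section Coreflection.
Variables (B : binomialRingType) (n : nat).
Implicit Types (F G : modFunctor B) (M N : vectType B) (H K : strictFunctor B).
Notation Bn := ('cV[B]_n : vectType B).
Notation Q := (Q B n).
Notation S := (schur B n).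
Let nQ : numerical n Q := @Q_numerical B n.
Let one : Q Bn := gpow n \1%VF.

Lemma nat_transP F G (h h' : nat_trans F G) : (forall M x, h M x = h' M x) -> h = h'.
Proof.
case: h h' => [h hn] [h' hn'] /= e; have ee : h = h'.
  by apply: functional_extensionality_dep => M; apply: lhomP => x; apply: e.
by rewrite ee in hn e *; congr NatTrans; apply: Prop_irrelevance.
Qed.

Section Yoneda.
Variables (H : strictFunctor B) (hH : homogeneous n H).

Lemma yoneda_linear (x : H Bn) M : linear (fun t : Q M => theta H t x).
Proof. by move=> a t t'; rewrite theta_linear. Qed.
Lemma yoneda_natural (x : H Bn) M N (f : 'Hom(M, N)) (t : Q M) :
  mklin (@yoneda_linear x N) (fmap Q f t) = fmap H f (mklin (@yoneda_linear x M) t).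
Proof. by rewrite Qmap_gcomp /= theta_comp // theta_pow. Qed.
Definition yoneda (x : H Bn) : nat_trans Q H :=
  @NatTrans B Q H (fun M => mklin (@yoneda_linear x M)) (@yoneda_natural x).

Lemma yonedaE x M (t : Q M) : yoneda x M t = theta H t x.
Proof. by []. Qed.

End Yoneda.

Lemma theta_scale1 H (hH : homogeneous n H) a (x : H Bn) : theta H (a *: one) x = a *: x.
Proof. by rewrite (linZ (@theta_linear B n H Bn Bn)) lhomZE theta1. Qed.

Lemma Q_fmap1 (m : 'Hom(Bn, Bn)) : fmap Q m one = gpow n m.
Proof. by rewrite Qmap_gcomp gcomp1r. Qed.

Lemma Q_fmapE M (m : 'Hom(Bn, M)) (t : Q Bn) : fmap Q m t = gcomp (gpow n m) t.
Proof. exact: Qmap_gcomp. Qed.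

(* eps exhibits R as the coreflection of G: natural maps Q -> G are the
   t |-> eps (t y) for unique y in R(B^n). *)
Definition coreflection (R : strictFunctor B) G (eps : nat_trans R G) : Prop :=
  (forall y : R Bn, (forall t : Q Bn, eps Bn (theta R t y) = 0) -> y = 0) /\
  (forall phi : nat_trans Q G, exists y : R Bn, forall M t, phi M t = eps M (theta R t y)).

(** At B^n, eps evaluates the natural map of y at the identity of Q(B^n). The value at another s is
    recovered from the action, as s is the identity multiplied by s on the right. *)
Lemma NatQ_coreflection G (R : NatQ n G) : numerical n G ->
  exists eps : nat_trans R G, coreflection eps.
Proof.
move=> nG; pose iso := @nq_iso B n G R; have hR : homogeneous n R := nq_homogeneous R.
have acE : nq_act R =1 @theta B n R Bn Bn := schur_theta hR (nq_actP R).
have sch (s : S) x M (t : Q M) : iso (theta R s x) M t = iso x M (gcomp t s).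
  by rewrite -acE /iso nq_schur.
(* The record asserts additivity only; homogeneity follows because the scalar a acts as the element
   a 1 of S. *)
have le : linear (fun y : R Bn => iso y Bn one).
  move=> a x y; rewrite /iso nq_add -/iso -(theta_scale1 hR) sch; congr (_ + _).
  by rewrite (linZ (@gcomp_linear_r B n Bn Bn Bn one)) gcomp1r linearZ_LR.
have [m x|eps epsE] := extend_from_Bn (e := mklin le) (homogeneous_numerical hR) nG.
  by rewrite /= -(theta_pow hR) sch gcomp1l -nt_natural Q_fmap1.
have isoE y M t : iso y M t = eps M (theta R t y).
  apply: (natural_ext (h' := ncomp eps (yoneda hR y)) nQ) => s.
  by rewrite /= epsE /= sch gcomp1l.
exists eps; split=> [y e|phi].
  apply: (bij_inj (nq_bij R)); apply: nat_transP => M t.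
  transitivity (eps M (theta R t (0 : R Bn))); last by rewrite isoE.
  rewrite linear0 linear0 isoE; apply: (separated_at_Bn nG) => f.
  by rewrite -nt_natural -(theta_pow hR) -theta_comp.
have [i ij ji] := nq_bij R; exists (i phi) => M t.
by rewrite -isoE /iso ji.
Qed.

(** Natural maps Q -> G are determined at B^n, where they are the linear maps commuting with
    endomorphisms; S acts on these through right multiplication on Q. *)
Lemma NatQ_exists G : numerical n G -> inhabited (NatQ n G).
Proof.
move=> nG.
pose T := lhom (Q Bn) (G Bn).
pose eqv (l : T) := forall (m : 'Hom(Bn, Bn)) t, l (fmap Q m t) = fmap G m (l t).
have e0 : eqv 0 by move=> m t; rewrite !lhom0E linear0.
have el a (l l' : T) : eqv l -> eqv l' -> eqv (a *: l + l').
  by move=> h h' m t; rewrite !lhomDE !lhomZE h h' linearP.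
pose X : submodule T := Submodule e0 el.
have am s (l : smod X) : X (lcomp (sinc X l) (ract s Bn)).
  by move=> m t; rewrite /= -[Qact _ _]/(ract s Bn _) nt_natural; apply: (sincP l).
have al s : linear (scorestr (am s)).
  by apply: scorestr_linear => a l l'; apply: lhomP.
pose act s : lhom (smod X) (smod X) := mklin (al s).
have actE s l t : sinc X (act s l) t = sinc X l (ract s Bn t) by [].
have ext (l l' : smod X) : sinc X l =1 sinc X l' -> l = l'.
  by move=> e; apply/sinc_inj/lhomP.
have actl : linear act.
  move=> a s s'; apply: lhomP => l; apply: ext => t.
  rewrite actE ractE gcomp_linear_r linearP.
  by [].
have act1 l : act (gpow n \1%VF) l = l by apply: ext => t; rewrite actE ract1.
have actM s t l : act (gcomp s t) l = act s (act t l).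
  by apply: ext => u; rewrite !actE !ractE gcompA.
have [H [i [hH [j ij ji] iact]]] := schur_module_functor actl act1 actM.
have isoP (x : H Bn) : exists h : nat_trans Q G, forall t, h Bn t = sinc X (i x) t.
  apply: (extend_from_Bn nQ nG); exact: (sincP (i x)).
have [iso isoE] := boolp.choice isoP.
constructor; apply: (@MkNatQ B n G H hH (@theta B n H Bn Bn) (theta_schur hH) iso).
- have hX (h : nat_trans Q G) : X (h Bn) by move=> m t; apply: nt_natural.
  exists (fun h => j (smk (hX h))) => [x|h].
    apply: (can_inj ij); rewrite ji; apply: ext => t.
    by rewrite sinc_mk isoE.
  apply: nat_transP; apply: natural_ext nQ _ => t.
  by rewrite isoE ji sinc_mk.
- move=> x y M t.
  have ls N : linear (fun t : Q N => iso x N t + iso y N t).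
    by move=> a u v; rewrite !linearP addrACA -scalerDr.
  have ns N (P : vectType B) (f : 'Hom(N, P)) u : mklin (ls P) (fmap Q f u) = fmap G f (mklin (ls N) u).
    by rewrite /= !nt_natural linearD.
  apply: (natural_ext (h' := @NatTrans B Q G (fun N => mklin (ls N)) ns) nQ) => u.
  by rewrite /= !isoE linearD.
move=> s x M t.
apply: (natural_ext (h' := ncomp (iso x) (ract s)) nQ) => u.
by rewrite isoE iact actE /= isoE.
Qed.

(* n! t is a combination of powers f^[n], on which phi is determined by
   naturality. *)
Lemma torsion_free_coreflection (G : strictFunctor B) : homogeneous n G ->
  functor_torsion_free G -> coreflection (nid G).
Proof.
move=> hG tG; split=> [y|phi]; first by move/(_ one); rewrite /= theta1.
exists (phi Bn one) => M.
apply: (gam_ext (U := G M)) => [|||f].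
- by move=> a t t'; rewrite linearP.
- by move=> a t t'; rewrite /= theta_linear.
- by move=> x k; apply: tG.
rewrite /= theta_pow // -nt_natural; congr (phi M _).
by rewrite Q_fmapE gcomp1r.
Qed.

End Coreflection.

(** * The pushout map, the connecting map and exactness *)

Section ExactSequence.
Variables (B : binomialRingType) (n : nat).
Implicit Types (M N : vectType B).
Notation Bn := ('cV[B]_n : vectType B).
Notation Q := (Q B n).
Notation S := (schur B n).
Let nQ : numerical n Q := @Q_numerical B n.
Let one : Q Bn := gpow n \1%VF.

Variables (F : strictFunctor B) (hF : homogeneous n F).
Variables (G : modFunctor B) (nG : numerical n G).
Variables (R : strictFunctor B) (hR : homogeneous n R).
Variable eps : nat_trans R G.
Hypothesis epsR : coreflection n eps.
Variable X : ExtQ n G.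

Notation numext F G := (@extension B (NumCat B n) F G).
Notation homext F G := (@extension B (HomCat B n) F G).

Let nF : numerical n F := homogeneous_numerical hF.
Let nR : numerical n R := homogeneous_numerical hR.

Definition hmid (E : homext F R) : strictFunctor B := emid E.
Definition hinj (E : homext F R) : nat_trans R (hmid E) := einj E.
Definition hprj (E : homext F R) : nat_trans (hmid E) F := eprj E.

Lemma hmid_homogeneous (E : homext F R) : homogeneous n (hmid E).
Proof. exact: (emid_in E). Qed.
Lemma hmid_numerical (E : homext F R) : numerical n (hmid E).
Proof. exact/homogeneous_numerical/hmid_homogeneous. Qed.
Lemma hexact (E : homext F R) : short_exact (hinj E) (hprj E).
Proof.
split; [exact: (@einj_inj _ _ _ _ E)|exact: (@e_exact _ _ _ _ E)|].
exact: (@eprj_surj _ _ _ _ E).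
Qed.
Lemma hinj_theta (E : homext F R) M N (t : gam n 'Hom(M, N)) y :
  hinj E N (theta R t y) = theta (hmid E) t (hinj E M y).
Proof. exact: ((strict_naturalP hR (hmid_homogeneous E) (hinj E)).1 (einj_hom E)). Qed.
Lemma hprj_theta (E : homext F R) M N (t : gam n 'Hom(M, N)) x :
  hprj E N (theta (hmid E) t x) = theta F t (hprj E M x).
Proof. exact: ((strict_naturalP (hmid_homogeneous E) hF (hprj E)).1 (eprj_hom E)). Qed.

(** The existence of k already characterizes A as the pushout of E along eps, by
    [ext_eq_pushout]. *)
Definition is_pushout (E : homext F R) (A : numext F G) : Prop :=
  exists k : nat_trans (hmid E) (xmid A),
    (forall M y, k M (hinj E M y) = xinj A M (eps M y)) /\
    (forall M x, xprj A M (k M x) = hprj E M x).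

Lemma pushout_exists E : exists A, is_pushout E A.
Proof.
have [A [k [ki kp]]] := ext_pushout eps (hexact E) (hmid_numerical E) nG.
by exists A, k.
Qed.

Lemma pushout_uniq E A A' : is_pushout E A -> is_pushout E A' -> ext_eq A A'.
Proof.
move=> [k [ki kp]] [k' [ki' kp']].
exact: ext_eq_pushout (hexact E) ki kp ki' kp'.
Qed.

Lemma pushout_eq E E' A : ext_eq E E' -> is_pushout E' A -> is_pushout E A.
Proof.
move=> [h [_ hi hp]] [k [ki kp]]; exists (ncomp k h); split=> M x /=.
  by rewrite hi; apply: ki.
by rewrite kp; apply: hp.
Qed.

Lemma pushout_ext_eq E A A' : is_pushout E A -> ext_eq A A' -> is_pushout E A'.
Proof.
move=> [k [ki kp]] [h [_ hi hp]]; exists (ncomp h k); split=> M x /=.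
  by rewrite ki; apply: hi.
by rewrite -kp; apply: hp.
Qed.

Lemma pushout_add E1 E2 E A1 A2 A : ext_add E1 E2 E ->
  is_pushout E1 A1 -> is_pushout E2 A2 -> is_pushout E A -> ext_add A1 A2 A.
Proof.
move=> [P [p1 [p2 [q [_ [pp u qp qi]]]]]] [k1 [ki1 kp1]] [k2 [ki2 kp2]] [k [ki kp]].
pose P' : modFunctor B := P.
pose p1' : nat_trans P' (hmid E1) := p1.
pose p2' : nat_trans P' (hmid E2) := p2.
pose q' : nat_trans P' (hmid E) := q.
have pp' M x : hprj E1 M (p1' M x) = hprj E2 M (p2' M x) := pp M x.
apply: (@ext_add_from B n F G A1 A2 A P' (ncomp k1 p1') (ncomp k2 p2') (ncomp k q')).
- by move=> M x /=; rewrite kp1 kp2 pp'.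
- by move=> M x /=; rewrite kp kp1; apply: qp.
- move=> M z; have [x1 e1] := se_surj (hexact E1) z.
  have [x2 e2] := se_surj (hexact E2) z.
  have [|x [[ex _] _]] := u M x1 x2; first by rewrite -[LHS]/(hprj E1 M x1) e1.
  by exists x; rewrite /= kp1 -e1; congr (hprj E1 M _).
move=> M x y1 y2 /= e1 e2.
have [|r1 f1] := @se_ker _ _ _ _ _ _ (hexact E1) M (p1' M x).
  by rewrite -kp1 e1 (se_prj_inj (xexact A1)).
have [|r2 f2] := @se_ker _ _ _ _ _ _ (hexact E2) M (p2' M x).
  by rewrite -kp2 e2 (se_prj_inj (xexact A2)).
have -> : q' M x = hinj E M (r1 + r2) by apply: qi.
rewrite ki linearD; congr (xinj A M (_ + _)).
  by apply: (se_inj (xexact A1)); rewrite -ki1 f1 e1.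
by apply: (se_inj (xexact A2)); rewrite -ki2 f2 e2.
Qed.

(** x1 and x2 correspond when they agree in F and induce the same natural map Q -> A2. Uniqueness in
    the coreflection makes this relation a graph, and its stability under S makes the comparison map
    strict. *)
Lemma pushout_inj E1 E2 A1 A2 :
  is_pushout E1 A1 -> is_pushout E2 A2 -> ext_eq A1 A2 -> ext_eq E1 E2.
Proof.
move=> h1 [k2 [ki2 kp2]] eA; have [k1 [ki1 kp1]] := pushout_ext_eq h1 eA.
have ex1 := hexact E1; have ex2 := hexact E2; have exA := xexact A2.
have hE1 := hmid_homogeneous E1; have hE2 := hmid_homogeneous E2.
pose r (x1 : hmid E1 Bn) (x2 : hmid E2 Bn) := hprj E1 Bn x1 = hprj E2 Bn x2 /\
  forall M (t : Q M), k1 M (theta (hmid E1) t x1) = k2 M (theta (hmid E2) t x2).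
have [|||e [er eu]] := @linear_rel B (hmid E1 Bn) (hmid E2 Bn) r.
- move=> x1; have [x2 px] := se_surj ex2 (hprj E1 Bn x1).
  (* For any x2 above the same z the two maps Q -> A2 lift the same map to F, so they differ by a
     map Q -> G. That map comes from some y in R(B^n), which corrects x2. *)
  have ld M : linear (fun t : Q M => k1 M (theta (hmid E1) t x1) - k2 M (theta (hmid E2) t x2)).
    by move=> a t t'; rewrite !theta_linear [k1 M _]linearP [k2 M _]linearP scalerBr [RHS]addrACA -opprD.
  have nd M N (f : 'Hom(M, N)) t :
      mklin (ld N) (fmap Q f t) = fmap (xmid A2) f (mklin (ld M) t).
    rewrite /= -[gmap _ _]/(fmap Q f t) Qmap_gcomp !theta_comp // !theta_pow //.
    by rewrite !nt_natural linearB.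
  pose d : nat_trans Q (xmid A2) := @NatTrans B Q (xmid A2) (fun M => mklin (ld M)) nd.
  have [|phi phiE] := natural_cofactor (k := d) (se_inj exA).
    move=> M t; apply: (se_ker exA).
    by rewrite /= linearB /= kp1 kp2 !hprj_theta px subrr.
  have [y yE] := epsR.2 phi.
  exists (x2 + hinj E2 Bn y); split.
    by rewrite linearD /= px (se_prj_inj ex2) addr0.
  move=> M t; rewrite linearD -hinj_theta linearD /= ki2 -yE phiE /=.
  by rewrite addrC subrK.
- move=> a x1 x2 y1 y2 [p1 q1] [p2 q2]; split; first by rewrite !linearP /= p1 p2.
  by move=> M t; rewrite !linearP /= q1 q2.
- move=> x2 [px qx]; rewrite linear0 in px.
  have [y yx] := se_ker ex2 (esym px); rewrite -yx; suff -> : y = 0 by rewrite linear0.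
  apply: epsR.1 => t; apply: (se_inj0 exA); rewrite -ki2 hinj_theta yx.
  by rewrite -qx !linear0.
have es (s : S) x : e (theta (hmid E1) s x) = theta (hmid E2) s (e x).
  apply: eu; have [px qx] := er x; split; first by rewrite !hprj_theta px.
  by move=> M t; rewrite -!theta_comp // qx.
have [h [hs he]] := extend_schur hE1 hE2 es.
exists h; split=> //.
  apply: (natural_ext (h := ncomp h (hinj E1)) (h' := hinj E2) nR) => y.
  rewrite /= he; apply: eu; split; first by rewrite (se_prj_inj ex1) (se_prj_inj ex2).
  by move=> M t; rewrite -!hinj_theta ki1 ki2.
move=> M x; symmetry; apply: (natural_ext (h := hprj E1) (h' := ncomp (hprj E2) h)).
  exact: hmid_numerical.
by move=> y; rewrite /= he; have [] := er y.
Qed.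

(* C is the pullback of A along the map Q -> F that corresponds to z. *)
Definition is_over (A : numext F G) (z : F Bn) (C : numext Q G) : Prop :=
  exists k : nat_trans (xmid C) (xmid A),
    (forall M y, k M (xinj C M y) = xinj A M y) /\
    (forall M x, xprj A M (k M x) = theta F (xprj C M x) z).

Let cl (x : xq X Bn) : numext Q G := xq_iso x.
Let hX : homogeneous n X := xq_homogeneous X.

Lemma over_exists A z : exists x, is_over A z (cl x).
Proof.
have [C [k [ki kp _]]] := ext_pullback A (yoneda hF z) nQ.
have [x [h [_ hi hp]]] := xq_surj X C.
exists x, (ncomp k h); split=> M y /=; first by rewrite -ki; congr (k M _); apply: hi.
by rewrite kp yonedaE; congr (theta F _ z); apply: hp.
Qed.

Lemma over_uniq A z x x' : is_over A z (cl x) -> is_over A z (cl x') -> x = x'.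
Proof.
move=> [k [ki kp]] [k' [ki' kp']]; apply: xq_inj.
exact: (ext_eq_pullback (psi := yoneda hF z) (xexact A) ki kp ki' kp').
Qed.

Lemma over_add A z z' x x' : is_over A z (cl x) -> is_over A z' (cl x') ->
  is_over A (z + z') (cl (x + x')).
Proof.
move=> [k [ki kp]] [k' [ki' kp']].
apply: (ext_add_map (xq_add x x') (psi := yoneda hF (z + z')) (i := xinj A)
  (psi1 := yoneda hF z) (psi2 := yoneda hF z') _ ki kp ki' kp').
by move=> M t; rewrite !yonedaE linearD.
Qed.

Lemma over_theta A z x (s : S) : is_over A z (cl x) ->
  is_over A (theta F s z) (cl (theta X s x)).
Proof.
move=> [k [ki kp]]; rewrite -(schur_theta hX (xq_actP X)).
have [h [hi hp]] := xq_schur s x.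
exists (ncomp k h); split=> M y /=; first by rewrite -ki; congr (k M _); apply: hi.
by rewrite kp -theta_comp //; congr (theta F _ z); apply: hp.
Qed.

Lemma over_scale A z x a : is_over A z (cl x) -> is_over A (a *: z) (cl (a *: x)).
Proof. by move/(over_theta (a *: one)); rewrite !theta_scale1. Qed.

Lemma over_ext_eq A A' z x : ext_eq A A' -> is_over A z (cl x) -> is_over A' z (cl x).
Proof.
move=> [h [_ hi hp]] [k [ki kp]]; exists (ncomp h k); split=> M y /=.
  by rewrite ki; apply: hi.
by rewrite -kp; apply: hp.
Qed.

Lemma over_add_ext A1 A2 A z x1 x2 : ext_add A1 A2 A ->
  is_over A1 z (cl x1) -> is_over A2 z (cl x2) -> is_over A z (cl (x1 + x2)).
Proof.
move=> addA [k [ki kp]] [k' [ki' kp']].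
exact: (ext_add_map2 (xq_add x1 x2) (psi := yoneda hF z) addA ki kp ki' kp').
Qed.

(** That [xq_iso] sends 0 to a split extension is extracted from the action of 0 in S: it gives an
    endomorphism h of this extension over the zero map of Q, which restricts to the identity on G
    and so factors through a retraction r onto G. *)
Lemma over0 A z : is_over A z (cl 0) <->
  exists l : nat_trans Q (xmid A), forall M t, xprj A M (l M t) = theta F t z.
Proof.
have [h [hi hp]] := xq_schur (0 : S) (0 : X Bn).
rewrite linear0 in h hi hp.
have [|r rE] := natural_cofactor (i := xinj (cl 0)) (k := h) (se_inj (xexact (cl 0))).
  move=> M x; apply: (se_ker (xexact (cl 0))).
  apply: (etrans (hp M x)).
  exact: (lin0 (@gcomp_linear_r B n Bn Bn M _)).
have rinj M y : r M (xinj (cl 0) M y) = y.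
  by apply: (se_inj (xexact (cl 0))); rewrite rE; apply: hi.
split=> [[k [ki kp]]|[l lE]].
  have [s sE] : exists s : nat_trans Q (xmid (cl 0)), forall M t, xprj (cl 0) M (s M t) = t.
    have [||||s [sr _]] := @natural_rel B Q (xmid (cl 0))
        (fun M t x => xprj (cl 0) M x = t /\ r M x = 0).
    - move=> M t; have [x xt] := se_surj (xexact (cl 0)) t.
      exists (x - xinj (cl 0) M (r M x)); rewrite !linearB /= rinj subrr.
      by rewrite (se_prj_inj (xexact (cl 0))) subr0.
    - by move=> M a t x t' x' [p q] [p' q']; rewrite !linearP /= p q p' q' scaler0 addr0.
    - move=> M x [/(se_ker (xexact (cl 0)))[y <-]]; rewrite rinj => ->.
      exact: linear0.
    - by move=> M N f t x [p q]; rewrite !nt_natural p q linear0.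
    by exists s => M t; have [] := sr M t.
  by exists (ncomp k s) => M t; rewrite /= kp sE.
have lk M : linear (fun x => l M (xprj (cl 0) M x) + xinj A M (r M x)).
  by move=> a x y; rewrite !linearP addrACA -scalerDr.
have nk M N (f : 'Hom(M, N)) x :
    mklin (lk N) (fmap (xmid (cl 0)) f x) = fmap (xmid A) f (mklin (lk M) x).
  by rewrite /= !nt_natural linearD.
exists (@NatTrans B (xmid (cl 0)) (xmid A) (fun M => mklin (lk M)) nk); split=> M x /=.
  by rewrite (se_prj_inj (xexact (cl 0))) linear0 add0r rinj.
by rewrite linearD /= lE (se_prj_inj (xexact A)) addr0.
Qed.

Lemma connecting_exists A : exists g : {h : nat_trans F X | strict_natural h},
  forall z, is_over A z (cl (sval g Bn z)).
Proof.
have [|||e [er eu]] := @linear_rel B (F Bn) (X Bn) (fun z x => is_over A z (cl x)).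
- exact: over_exists.
- by move=> a z x z' x' h h'; apply: over_add h'; apply: over_scale.
(* The class 0 x = 0 lies over 0 too, and such a class is unique. *)
- move=> x h; have h0 := over_scale 0 h; rewrite !scale0r in h0.
  exact: over_uniq h h0.
have es (s : S) z : e (theta F s z) = theta X s (e z).
  by apply: eu; apply: over_theta; apply: er.
have [h [hs he]] := extend_schur hF hX es.
by exists (exist _ h hs) => z; rewrite /= he; apply: er.
Qed.

(** A preimage x of z in E gives the lift t |-> k (t x), which exists because E is homogeneous. *)
Lemma pushout_liftable E A z : is_pushout E A -> is_over A z (cl 0).
Proof.
move=> [k [_ kp]]; apply/over0.
have [x xz] := se_surj (hexact E) z.
exists (ncomp k (yoneda (hmid_homogeneous E) x)) => M t.
by rewrite /= kp hprj_theta xz.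
Qed.

(* E is the functor of the S-module of pairs (l, z) where l : Q -> A lifts the map
   Q -> F of z; it maps to A by (l, z) |-> l(1). *)
Lemma liftable_pushout A : (forall z, is_over A z (cl 0)) -> exists E, is_pushout E A.
Proof.
move=> lift; have exA := xexact A; have nA := xmid_numerical A.
pose T : lmodType B := (lhom (Q Bn) (xmid A Bn) * F Bn)%type.
pose ok (p : T) := (forall (m : 'Hom(Bn, Bn)) t, p.1 (fmap Q m t) = fmap (xmid A) m (p.1 t)) /\
  forall t : Q Bn, xprj A Bn (p.1 t) = theta F t p.2.
have ok0 : ok 0 by split=> [m|] t; rewrite /= ?lhom0E !linear0.
have okl a p q : ok p -> ok q -> ok (a *: p + q).
  move=> [p1 p2] [q1 q2]; split=> [m|] t /=.
    by rewrite p1 q1 linearP.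
  by rewrite !linearP /= p2 q2.
pose Y : submodule T := Submodule ok0 okl.
pose sh (s : S) (p : T) : T := (lcomp p.1 (ract s Bn), theta F s p.2).
have shY s (p : smod Y) : Y (sh s (sinc Y p)).
  have [p1 p2] := sincP p; split=> [m|] t.
    by rewrite /= -[Qact _ _]/(ract s Bn _) nt_natural p1.
  by rewrite /= p2 -theta_comp.
have shl s : linear (scorestr (shY s)).
  apply: scorestr_linear => a p q; rewrite /sh linearP; congr (_, _).
    exact: lhomP.
  by rewrite linearP.
pose act s : lhom (smod Y) (smod Y) := mklin (shl s).
have Yext (p q : smod Y) : (sinc Y p).1 =1 (sinc Y q).1 -> (sinc Y p).2 = (sinc Y q).2 -> p = q.
  move=> e1 e2; apply: sinc_inj; rewrite [LHS]surjective_pairing [RHS]surjective_pairing.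
  by congr (_, _) => //; apply: lhomP.
have act1E s p t : (sinc Y (act s p)).1 t = (sinc Y p).1 (ract s Bn t) by [].
have act2E s p : (sinc Y (act s p)).2 = theta F s (sinc Y p).2 by [].
have actl : linear act.
  move=> a s s'; apply: lhomP => p; apply: Yext => [t|].
    by rewrite act1E ractE gcomp_linear_r linearP.
  by rewrite act2E theta_linear.
have act1 p : act (gpow n \1%VF) p = p.
  by apply: Yext => [t|]; rewrite ?act1E ?ract1 // act2E theta1.
have actM s t p : act (gcomp s t) p = act s (act t p).
  apply: Yext => [u|]; first by rewrite !act1E !ractE gcompA.
  by rewrite !act2E theta_comp.
have [H [i [hH [j ij ji] iact]]] := schur_module_functor actl act1 actM.
have nH := homogeneous_numerical hH.
have okX (x : H Bn) : ok (sinc Y (i x)) := sincP (i x).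
have lp : linear (fun x : H Bn => (sinc Y (i x)).2) by move=> a x y; rewrite linearP.
have [|p [ps pE]] := @extend_schur B n H F (mklin lp) hH hF.
  by move=> s x; rewrite /= iact act2E.
have lk : linear (fun x : H Bn => (sinc Y (i x)).1 one) by move=> a x y; rewrite linearP.
have [|k kE] := @extend_from_Bn B n H (xmid A) (mklin lk) nH nA.
  move=> m x; rewrite /= -(theta_pow hH) iact act1E ractE gcomp1l -Q_fmap1.
  by have [-> _] := okX x.
(* R is embedded as the pairs (l, 0) with l = (t |-> eps (t y)). *)
have lj1 (y : R Bn) : linear (fun t : Q Bn => xinj A Bn (eps Bn (theta R t y))).
  by move=> a t t'; rewrite theta_linear !linearP.
have jok y : Y (mklin (lj1 y), 0).
  split=> [m|] t /=; last by rewrite (se_prj_inj exA) linear0.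
  by rewrite -[gmap _ _]/(fmap Q m t) Q_fmapE theta_comp // theta_pow // !nt_natural.
have lj : linear (fun y : R Bn => j (smk (jok y))).
  move=> a y y'; apply: (can_inj ij); rewrite linearP !ji; apply: Yext => [t|].
    by rewrite /= !linearP.
  by rewrite /= scaler0 addr0.
have [|q [qs qE]] := @extend_schur B n R H (mklin lj) hR hH.
  move=> s y; apply: (can_inj ij); rewrite iact !mklinE !ji; apply: Yext => [t|].
    by rewrite act1E /= -theta_comp.
  by rewrite act2E /= linear0.
have iq y : i (q Bn y) = smk (jok y) by rewrite qE /= ji.
have qinj : forall M, injective (q M).
  apply: (injective_at_Bn nR) => y y' e; apply/eqP; rewrite -subr_eq0; apply/eqP/epsR.1 => t.
  apply: (se_inj0 exA).
  have := congr1 (fun x => (sinc Y (i x)).1 t) e; rewrite !iq /= => e'.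
  by rewrite !linearB /= e' subrr.
have qker : forall M x, p M x = 0 <-> exists y, q M y = x.
  apply: (kernel_at_Bn nR nH) => x; split=> [px|[y <-]]; last first.
    by rewrite pE /= iq.
  (* In a pair (l, 0) the map l takes values in G, so the coreflection writes it as t |-> eps (t
     y). *)
  have x2 : (sinc Y (i x)).2 = 0 by rewrite -[LHS]/(mklin lp x) -pE.
  have [x1 xl] := okX x.
  have [L LE] := extend_from_Bn nQ nA x1.
  have [|phi phiE] := natural_cofactor (i := xinj A) (k := L) (se_inj exA).
    move=> M t; apply: (se_ker exA); apply: (separated_at_Bn nF) => f.
    by rewrite -!nt_natural LE xl x2 linear0.
  have [y yE] := epsR.2 phi; exists y; apply: (can_inj ij); rewrite iq.
  by apply: Yext => [t|]; rewrite /= ?x2 // -yE phiE LE.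
have psurj : forall M z, exists x, p M x = z.
  apply: (surjective_at_Bn nF) => z; have /over0 [l lE] := lift z.
  have lY : Y (l Bn : lhom (Q Bn) (xmid A Bn), z).
    by split=> [m|] t /=; [rewrite -nt_natural|rewrite lE].
  by exists (j (smk lY)); rewrite pE /= ji.
pose E : homext F R := @Extension B (HomCat B n) F R H hH q p qs ps qinj qker psurj.
exists E, k; split.
  apply: (natural_ext (h := ncomp k q) (h' := ncomp (xinj A) eps) nR) => y.
  by rewrite /= kE /= iq /= theta1.
apply: (natural_ext (h := ncomp (xprj A) k) (h' := p) nH) => x.
rewrite /= kE pE /=; have [_ ->] := okX x.
exact: theta1.
Qed.

Lemma coreflection_sequence :
  exact_sequence (Ext1 (C := HomCat B n) F R) (Ext1 (C := NumCat B n) F G)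
                 (Nat (C := HomCat B n) F X).
Proof.
have [f fP] := boolp.choice pushout_exists.
have [g gP] := boolp.choice connecting_exists.
exists f, g; split.
- split=> [E E' e|E1 E2 E]; first exact: pushout_uniq (fP E) (pushout_eq e (fP E')).
  by move/pushout_add; apply; apply: fP.
- split=> [A A' e M z|A1 A2 A e M z].
    apply: (natural_ext (h := sval (g A)) (h' := sval (g A')) nF) => {}z.
    exact: over_uniq (over_ext_eq e (gP A z)) (gP A' z).
  have ls N : linear (fun z : F N => sval (g A1) N z + sval (g A2) N z).
    by move=> a u v; rewrite !linearP addrACA -scalerDr.
  have ns N (P : vectType B) (m : 'Hom(N, P)) u :
      mklin (ls P) (fmap F m u) = fmap X m (mklin (ls N) u).
    by rewrite /= !nt_natural linearD.
  apply: (natural_ext (h := sval (g A)) (h' := @NatTrans B F X (fun N => mklin (ls N)) ns) nF).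
  by move=> u; apply: over_uniq (gP A u) (over_add_ext e (gP A1 u) (gP A2 u)).
- by move=> E E'; apply: pushout_inj (fP E) (fP E').
move=> A; split=> [g0|[E e] M z].
  have [|E EA] := @liftable_pushout A; last by exists E; apply: pushout_uniq (fP E) EA.
  by move=> z; have := gP A z; rewrite g0.
have gB u : sval (g A) Bn u = 0.
  exact: over_uniq (gP A u) (pushout_liftable u (pushout_ext_eq (fP E) e)).
apply: (separated_at_Bn (homogeneous_numerical hX)) => m.
by rewrite -nt_natural gB.
Qed.

End ExactSequence.

Theorem theorem4 (B : binomialRingType) (n : nat)
    (F : strictFunctor B) (hF : homogeneous n F)
    (G : modFunctor B) (hG : numerical n G) :
  [/\ inhabited (NatQ n G), inhabited (ExtQ n G) &
      forall (R : NatQ n G) (X : ExtQ n G),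
        exact_sequence (Ext1 (C := HomCat B n) F R)
                       (Ext1 (C := NumCat B n) F G)
                       (Nat (C := HomCat B n) F X)]
  /\
  (forall G' : strictFunctor B,
     homogeneous n G' -> sfun G' = G -> functor_torsion_free G ->
     forall X : ExtQ n G,
       exact_sequence (Ext1 (C := HomCat B n) F G')
                      (Ext1 (C := NumCat B n) F G)
                      (Nat (C := HomCat B n) F X)).
Proof.
split=> [|G' hG' eG]; last first.
  (* Once G is the functor underlying G', the identity of G' serves as eps. *)
  case: _ / eG in hG * => tG X.
  exact: (coreflection_sequence hF hG hG' (torsion_free_coreflection hG' tG)).
split=> [||R X]; [exact: NatQ_exists|exact: ExtQ_exists|].
have [eps epsR] := NatQ_coreflection R hG.
exact: (coreflection_sequence hF hG (nq_homogeneous R) epsR).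
Qed.
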